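(* Let $k\ge 0$ be an integer, suppose the true density is $p_0=p_{f_0}$ with $f_0\in D^{(k)}_U([0,1])$, and let the loss be $L(f)=-\log p_f$. Let $f_n$ be the HAL-MLE, $f_n=\arg\min_{f\in D^{(k)}_M(\mathcal R_n)}P_nL(f)$. Then $$d_0(p_{f_n},p_{f_0})=O_P\!\left(n^{-\frac{2k+2}{2k+3}}\right),\qquad\text{and hence}\qquad \lVert p_{f_n}-p_{f_0}\rVert_{L^2(\mu)}=O_P\!\left(n^{-\frac{k+1}{2k+3}}\right),$$ where $d_0(p_{f_n},p_{f_0})=d_0(f_n,f_0)=P_0L(f_n)-P_0L(f_0)$.
   Context: Notation: $\mu$ is Lebesgue measure on $[0,1]$; $Pg=\int g\,dP$; $X_1,\dots,X_n$ are i.i.d. from $P_0$ on $[0,1]$ with density $p_0$ with respect to $\mu$; $P_n$ is the empirical measure. Function classes: for a (large enough) constant $0<U<\infty$, $D^{(0)}_U([0,1])$ is the set of càdlàg $f:[0,1]\to\mathbb R$ with $f(x)=f(0)+\int_{(0,x]}f(du)$ and $\|f\|_v^*=|f(0)|+\int_{(0,1]}|f(du)|\le U$. For $k\ge1$, $f\in D^{(k)}_U([0,1])$ if $f\in D^{(0)}_U([0,1])$, for each $1\le i\le k$ the $i$-th Lebesgue–Radon–Nikodym derivative $f^{(i)}=\frac{d}{du}f^{(i-1)}$ exists and lies in $D^{(0)}_U([0,1])$, and $\|f\|^*_{v,k}=\sum_{i=0}^k|f^{(i)}(0)|+\mathrm{TV}(f^{(k)})\le U$, where $f^{(0)}=f$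 and $\mathrm{TV}(g)=\int_{(0,1]}|dg|$. Link function: $p_f(x)=\exp(f(x))/\int_0^1\exp(f(u))\,du$. With $\mathcal F=D^{(k)}_U([0,1])$, $f_0=\arg\min_{f\in\mathcal F}P_0L(f)$. HAL-MLE: the initial basis is $\phi_{i,0}(x)=x^i$, $i=0,\dots,k$, and $\phi_{k,X_j}(x)=(x-X_j)_+^k=(x-X_j)^kI\{X_j\le x\}$, $j=1,\dots,n$ (index set $\mathcal R^k(n)$ with $n+k+1$ elements). For a user-specified constant $M$, $f_n=\sum_j\beta_{n,j}\phi_j$ minimizes $-P_n\log p_{f_\beta}$ over $f_\beta=\sum_{j\in\mathcal R^k(n)}\beta_j\phi_j$ with $\|\beta\|_1\le M$. $\mathcal R_n\subset\mathcal R^k(n)$ is the set of indices with nonzero coefficients in $f_n$, and $D^{(k)}_M(\mathcal R_n)=\{\sum_{j\in\mathcal R_n}\beta_j\phi_j:\|\beta\|_1\le M\}$; thus $f_n$ also minimizes $-P_n\log p_f$ over $D^{(k)}_M(\mathcal R_n)$.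
   Formalization: The formal theorem additionally assumes that f_0 lies in D^(k)_M([0,1]), i.e. ‖f_0‖*_{v,k} ≤ M (implied by U ≤ M); with M unrelated to f_0 the claim fails, e.g. M = 0 forces f_n = 0. *)

(* Defs.v *)
From HB Require Import structures.
From mathcomp Require Import all_boot all_order all_algebra finmap.
From mathcomp Require Import all_classical all_reals all_analysis.
Import Order.TTheory GRing.Theory Num.Theory.
Import numFieldNormedType.Exports.

Set Implicit Arguments.
Unset Strict Implicit.
Unset Printing Implicit Defensive.

Local Open Scope classical_set_scope.
Local Open Scope charge_scope.
Local Open Scope ring_scope.

(* Functions on [0, 1] are represented by functions R -> R.  The function
   classes, risks and distances only involve their values on [0, 1], where the
   observations lie almost surely. *)

Section function_classes.
Context {R : realType}.
Notation mu := (@lebesgue_measure R).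
Implicit Types (f g : R -> R) (nu : {charge set (measurableTypeR R) -> \bar R}).

Definition cadlag01 f : Prop :=
  (forall x : R, 0 <= x < 1 -> f y @[y --> x^'+] --> f x) /\
  (forall x : R, 0 < x <= 1 -> cvg (f y @[y --> x^'-])).

(* nu plays the role of the signed measure f(du) on ]0, 1]; it is determined
   by f on the Borel subsets of ]0, 1] and is unconstrained elsewhere. *)
Definition generates nu f : Prop :=
  forall x : R, 0 <= x <= 1 -> (f x)%:E = ((f 0)%:E + nu `]0%R, x]%classic)%E.

(* TV(f) is the mass of ]0, 1] under |f(du)|, the variation of a charge nu
   generated by f.  This value does not depend on nu nor on its Hahn
   decomposition, so the infimum is over a set with at most one element, and
   TV(f) = +oo when f generates no finite signed measure. *)
Definition TV f : \bar R :=
  ereal_inf [set t | exists nu (A B : set R) (AB : hahn_decomposition nu A B),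
    generates nu f /\ t = charge_variation AB `]0%R, 1%R]%classic].

Definition D0 (U : R) : set (R -> R) := [set f |
  [/\ cadlag01 f, (exists nu, generates nu f) &
      (`|f 0|%:E + TV f <= U%:E)%E] ].

Definition is_LRN_derivative f g : Prop :=
  exists nu, [/\ generates nu f, nu `<< mu &
    {ae mu, forall x : R, 0 < x <= 1 -> ('d nu '/d mu) x = (g x)%:E}].

(* d i is the i-th derivative of f.  Radon-Nikodym derivatives being defined
   almost everywhere, membership asks for versions of them in D0. *)
Definition D (k : nat) (U : R) : set (R -> R) := [set f |
  exists d : nat -> R -> R,
    [/\ d 0%N = f,
        (forall i, (i <= k)%N -> D0 U (d i)),
        (forall i, (i < k)%N -> is_LRN_derivative (d i) (d i.+1)) &
        ((\sum_(i < k.+1) `|d i 0|)%:E + TV (d k) <= U%:E)%E] ].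

End function_classes.

Section model.
Context {R : realType}.
Notation mu := (@lebesgue_measure R).

Definition argmin (T : Type) (A : set T) (r : T -> R) : set T :=
  [set a | A a /\ forall b, A b -> r a <= r b].

(* the density p_f *)
Definition link (f : R -> R) (x : R) : R :=
  expR (f x) / \int[mu]_(u in `[0%R, 1%R]) expR (f u).

Definition loss (f : R -> R) (x : R) : R := - ln (link f x).

Definition has_density (P0 : probability R R) (p : R -> R) : Prop :=
  forall A, measurable A ->
    P0 A = (\int[mu]_(x in A `&` `[0%R, 1%R]) (p x)%:E)%E.

Definition risk (P0 : probability R R) (f : R -> R) : R :=
  \int[P0]_(x in `[0%R, 1%R]) loss f x.

Definition emp_risk (n : nat) (x : 'I_n -> R) (f : R -> R) : R :=
  n%:R^-1 * \sum_(i < n) loss f (x i).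

Definition d0 (P0 : probability R R) (f g : R -> R) : R := risk P0 f - risk P0 g.

Definition L2dist (p q : R -> R) : \bar R :=
  'N[mu]_(2%:E)[EFin \o ((p \- q) \_ `[0%R, 1%R])].

End model.

Section hal.
Context {R : realType}.
Variables (k n : nat) (x : 'I_n -> R).

(* The monomials x^0, ..., x^k, then one spline per observation.  The
   indicator is explicit so that for k = 0 the spline is the step function
   1{x_j <= u}. *)
Definition hal_index : finType := ('I_k.+1 + 'I_n)%type.

Definition hal_basis (j : hal_index) (u : R) : R :=
  match j with
  | inl i => u ^+ i
  | inr i => if x i <= u then (u - x i) ^+ k else 0
  end.

Definition hal_comb (beta : hal_index -> R) (u : R) : R :=
  \sum_j beta j * hal_basis j u.

Definition l1_norm (beta : hal_index -> R) : R := \sum_j `|beta j|.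

Definition DM (M : R) (J : {set hal_index}) : set (R -> R) :=
  [set hal_comb beta | beta in [set beta |
    (forall j, j \notin J -> beta j = 0) /\ l1_norm beta <= M] ].

(* beta is a coefficient vector minimizing the empirical risk over the whole
   l1-ball, [set j | beta j != 0] is the set of indices it selects, and f is a
   minimizer over the l1-ball of coefficients supported on them.  The choice
   f = hal_comb beta is always possible. *)
Definition is_hal_mle (M : R) (f : R -> R) : Prop :=
  exists2 beta,
    argmin [set b | l1_norm b <= M] (emp_risk x \o hal_comb) beta &
    argmin (DM M [set j | beta j != 0]%SET) (emp_risk x) f.

End hal.

Section probability.
Context {R : realType} {d : measure_display} {T : measurableType d}.
Variable P : probability T R.

Definition mutually_independent (X : nat -> {RV P >-> R}) : Prop :=
  forall (J : {fset nat}) (A : nat -> set R),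
    (forall i, measurable (A i)) ->
    P (\bigcap_(i in [set` J]) (X i @^-1` A i)) =
    (\prod_(i <- J) P (X i @^-1` A i))%E.

Definition iid (X : nat -> {RV P >-> R}) (P0 : probability R R) : Prop :=
  mutually_independent X /\
  forall i A, measurable A -> distribution P (X i) A = P0 A.

(* Z n = O_P(r n).  The outer probability P^* makes sense of this without
   assuming that Z n is measurable (a minimizer need not be chosen measurably);
   it is P on measurable events. *)
Definition OP_rate (Z : nat -> T -> \bar R) (r : nat -> R) : Prop :=
  forall eps : R, 0 < eps -> exists C : R,
    \forall n \near \oo,
      (P^*%mu [set w | (C * r n)%:E < `|Z n w|] <= eps%:E)%E.

End probability.

(* Main.v *)
(* Put D = d_0(p_{f_n}, p_{f_0}), a Kullback-Leibler divergence, comparable to the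
   squared L^2 distance of the log-densities because all functions are uniformly
   bounded.  Let f~ be the spline that carries each increment of f_0^(k) over a cell
   of a 4-adic partition into 4^L cells of width h = 4^-L at one data point of that
   cell; it has admissible coefficients, and its divergence from f_0 is O(h).
   Comparing f_n with f~ gives D <= O(h) + (P_n - P_0)(g), where
   g = log p_{f_n} - log p_{f~} and ||g||^2 = O(D + h).

   On a cell of width 4^-l, g is within 4^(-lk) nu_l(cell) of a polynomial of degree
   at most k, where nu_l has total mass O(1).  Expand g along the L^2-projections
   onto piecewise polynomials on 4-adic partitions of levels l0, ..., L, and call
   z the empirical coefficients.  At the coarse level, Cauchy-Schwarz and Bessel
   give a small multiple of ||g||^2 plus sum z^2, of mean O(4^l0 / n).  At a finer
   level, each z is truncated at a threshold t of order 1 / sqrt n, growing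
   geometrically with the level: the truncated part costs t times the l^1-norm of
   the coefficients of g, which is O(2^-l 4^(-lk)), and the excess is absorbed by
   Young's inequality into ||g||^2 and sum z^6 / t^4.  The levels sum geometrically,
   so no logarithm is lost.  Beyond level L the bound is deterministic, every cell
   having empirical mass O(h).  Choosing 4^l0 = n^(1/(2k+3)) and h = 4^l0 / n makes
   all the terms O(n^(-(2k+2)/(2k+3))). *)

Require Import Defs.
From HB Require Import structures.
From mathcomp Require Import all_boot all_order all_algebra finmap.
From mathcomp Require Import all_classical all_reals all_analysis.
From mathcomp Require Import measurable_realfun ring lra zify.
Import Order.TTheory GRing.Theory Num.Theory.
Import numFieldNormedType.Exports.

Set Implicit Arguments.
Unset Strict Implicit.
Unset Printing Implicit Defensive.

Local Open Scope classical_set_scope.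
Local Open Scope ring_scope.

(** * Bounded functions on the unit interval *)

(** The rate is the cell width [h] itself, so a crude O(h) bias for the spline suffices whatever the
    smoothness, while n h is at least [4 ^+ l0]. The expected number of points per cell thus grows
    like a power of n, and one fixed even moment is enough to control all finest cells at once. A
    sixth power is the first even one that works. The l^1-norms of the coefficients decay like 2^-r
    above level l0, so the truncation level may grow like c^r only with c < 2. Cutting with a square
    would leave z^4 / t^2 on about 4^r coefficients, and 4 / c^2 > 1 diverges; cutting with a cube
    leaves z^6 / t^4, and 4 / c^4 < 1 as soon as c^2 > 2. The value c = 3/2 leaves room for Young
    weights (8/9)^r, which are summable as well. Apart from the exclusion of samples that leave the
    unit interval, randomness enters only through sums of even powers of empirical coefficients of a
    fixed basis. These are measurable and do not involve f_n; on the event where they are moderate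
    the bound holds for every minimizer, so no measurable selection is required. *)

Section exponential_bounds.
Context {R : realType}.
Implicit Types t T x : R.

Lemma expR_sub1_le t : expR t - 1 <= t * expR t.
Proof.
have h := expR_ge1Dx (- t); have e0 := expR_gt0 t.
have : (1 - t) * expR t <= 1.
  by rewrite -[leRHS](@expRxMexpNx_1 R t) mulrC ler_pM2l.
lra.
Qed.

Lemma normr_expR_sub1_le t T : `|t| <= T -> `|expR t - 1| <= `|t| * expR T.
Proof.
move=> tT; have h1 := expR_sub1_le t; have h2 := expR_ge1Dx t.
have eT : expR t <= expR T by rewrite ler_expR (le_trans (ler_norm t)).
have eT1 : 1 <= expR T by rewrite -expR0 ler_expR (le_trans _ tT).
have e0 := expR_gt0 t.
have [t0|t0] := leP 0 t.
  rewrite ger0_norm; last by rewrite subr_ge0 -expR0 ler_expR.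
  by rewrite ger0_norm//; nra.
rewrite ler0_norm; last by rewrite subr_le0 -expR0 ler_expR ltW.
rewrite ltr0_norm//; nra.
Qed.

Lemma expR_remainder_ge0 t : 0 <= expR t - 1 - t.
Proof. have := expR_ge1Dx t; lra. Qed.

Lemma expR_remainder_le t T : `|t| <= T ->
  expR t - 1 - t <= t ^+ 2 * expR T.
Proof.
move=> tT; have h1 := expR_sub1_le t.
have h3 : t * (expR t - 1) <= `|t| * (`|t| * expR T).
  rewrite (le_trans (ler_norm _))// normrM ler_wpM2l//.
  exact: normr_expR_sub1_le.
have : `|t| * (`|t| * expR T) = t ^+ 2 * expR T by rewrite mulrA -normrM ger0_norm ?expr2 ?sqr_ge0// -expr2 sqr_ge0.
lra.
Qed.

(** For t >= -2, squaring [1 + t / 2 <= expR (t / 2)] leaves t^2 / 4. For t < -2 the linear part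
    alone gives |t| - 1 >= |t| / 2 >= t^2 / (2 T). The loss is thus linear in [T], not
    exponential. *)
Lemma expR_remainder_ge t T : 2 <= T -> `|t| <= T ->
  t ^+ 2 / (2 * T) <= expR t - 1 - t.
Proof.
move=> T2; rewrite ler_norml => /andP[t1 t2].
rewrite ler_pdivrMr; last lra.
have [tm|tm] := leP (- 2) t.
  have h := expR_ge1Dx (t / 2).
  have e2 : expR t = expR (t / 2) ^+ 2.
    by rewrite expr2 -expRD; congr expR; lra.
  have h2 : (1 + t / 2) ^+ 2 <= expR t by rewrite e2 ler_pXn2r// nnegrE; lra.
  nra.
have := expR_gt0 t; nra.
Qed.

Lemma expR_le_quadratic t T : `|t| <= T -> expR t <= 1 + t + t ^+ 2 * expR T.
Proof. by move=> /expR_remainder_le; lra. Qed.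

Lemma exprn_le_expR (q : nat) x : 0 <= x -> x ^+ q <= q`!%:R * expR x.
Proof.
move=> x0; case: q => [|q]; first by rewrite expr0 fact0 mul1r -expR0 ler_expR.
have h : x ^+ q.+1 / q.+1`!%:R <= expR x by have := expR_ge1Dxn q x0; lra.
by rewrite mulrC -ler_pdivrMr// ltr0n fact_gt0.
Qed.

End exponential_bounds.

Section bounded_measurable.
Context {R : realType}.
Implicit Types (f g : R -> R) (c : R).

(* The half-open interval, because the 4-adic cells tile it exactly. *)
Definition bounded_mfun f := measurable_fun (`[0%R, 1%R[%classic : set (measurableTypeR R)) f /\
  exists C, forall x, 0 <= x < 1 -> `|f x| <= C.

Lemma bounded_mfun_cst c : bounded_mfun (fun=> c).
Proof. by split; [exact: measurable_cst | exists `|c|]. Qed.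

Lemma bounded_mfunD f g : bounded_mfun f -> bounded_mfun g ->
  bounded_mfun (fun x => f x + g x).
Proof.
move=> [mf [C1 h1]] [mg [C2 h2]]; split; first exact: measurable_funD.
exists (C1 + C2) => x x01; apply: le_trans (ler_normD _ _) _.
by rewrite lerD ?h1 ?h2.
Qed.

Lemma bounded_mfunM f g : bounded_mfun f -> bounded_mfun g ->
  bounded_mfun (fun x => f x * g x).
Proof.
move=> [mf [C1 h1]] [mg [C2 h2]]; split; first exact: measurable_funM.
by exists (C1 * C2) => x x01; rewrite normrM ler_pM ?h1 ?h2.
Qed.

Lemma bounded_mfunN f : bounded_mfun f -> bounded_mfun (fun x => - f x).
Proof.
move=> [mf [C h]]; split; first exact: measurable_funN.
by exists C => x x01; rewrite normrN h.
Qed.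

Lemma bounded_mfunB f g : bounded_mfun f -> bounded_mfun g ->
  bounded_mfun (fun x => f x - g x).
Proof. by move=> hf hg; apply: bounded_mfunD => //; exact: bounded_mfunN. Qed.

Lemma bounded_mfun_sum (J : Type) (s : seq J) (P : pred J) (F : J -> R -> R) :
  (forall j, P j -> bounded_mfun (F j)) ->
  bounded_mfun (fun x => \sum_(j <- s | P j) F j x).
Proof.
move=> h; elim: s => [|j s ih].
  by under eq_fun do rewrite big_nil; exact: bounded_mfun_cst.
have [Pj|nPj] := boolP (P j); last by under eq_fun do rewrite big_cons (negbTE nPj).
by under eq_fun do rewrite big_cons Pj; apply: bounded_mfunD => //; exact: h.
Qed.

Lemma bounded_mfunX f n : bounded_mfun f -> bounded_mfun (fun x => f x ^+ n).
Proof.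
move=> hf; elim: n => [|n ih]; first exact: (bounded_mfun_cst 1).
by under eq_fun do rewrite exprS; exact: bounded_mfunM.
Qed.

Lemma bounded_mfun_norm f : bounded_mfun f -> bounded_mfun (fun x => `|f x|).
Proof.
move=> [mf [C h]]; split; first exact: measurableT_comp.
by exists C => x x01; rewrite normr_id h.
Qed.

Lemma bounded_mfun_expR f : bounded_mfun f -> bounded_mfun (fun x => expR (f x)).
Proof.
move=> [mf [C h]]; split; first exact: measurableT_comp.
exists (expR C) => x x01; rewrite ger0_norm ?expR_ge0// ler_expR.
exact: le_trans (ler_norm _) (h x x01).
Qed.

Lemma bounded_mfun_indic (A : set R) : measurable A -> bounded_mfun \1_A.
Proof.
move=> mA; split; first exact: measurable_indic.
by exists 1 => x _; rewrite indicE; case: (x \in A); rewrite ?normr1 ?normr0.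
Qed.

Lemma eq_bounded_mfun f g : (forall x, 0 <= x < 1 -> f x = g x) ->
  bounded_mfun f -> bounded_mfun g.
Proof.
move=> fg [mf [C h]]; split.
  by apply: eq_measurable_fun mf => x; rewrite inE/= in_itv/= => /fg.
by exists C => x x01; rewrite -fg// h.
Qed.

End bounded_measurable.

Notation Int m f := (Rintegral m `[0%R, 1%R[%classic f).

Section integrals_on_the_unit_interval.
Context {R : realType}.
Variable m : {measure set (measurableTypeR R) -> \bar R}.
Hypothesis mfin : (m `[0%R, 1%R[%classic < +oo)%E.
Implicit Types (f g : R -> R) (c : R).

Lemma bounded_mfun_integrable f : bounded_mfun f ->
  m.-integrable `[0%R, 1%R[ (EFin \o f).
Proof.
move=> [mf [C h]]; apply: measurable_bounded_integrable => //.
exists C; split; first exact: num_real.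
move=> D CD x; rewrite /= in_itv/= => x01; apply: le_trans (h x x01) _.
exact: ltW.
Qed.

Lemma IntD f g : bounded_mfun f -> bounded_mfun g ->
  Int m (fun x => f x + g x) = Int m f + Int m g.
Proof. by move=> hf hg; rewrite RintegralD//; exact: bounded_mfun_integrable. Qed.

Lemma IntB f g : bounded_mfun f -> bounded_mfun g ->
  Int m (fun x => f x - g x) = Int m f - Int m g.
Proof. by move=> hf hg; rewrite RintegralB//; exact: bounded_mfun_integrable. Qed.

Lemma IntZ c f : bounded_mfun f -> Int m (fun x => c * f x) = c * Int m f.
Proof. by move=> hf; rewrite RintegralZl//; exact: bounded_mfun_integrable. Qed.

Lemma Int_sum (J : Type) (s : seq J) (P : pred J) (F : J -> R -> R) :
  (forall j, P j -> bounded_mfun (F j)) ->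
  Int m (fun x => \sum_(j <- s | P j) F j x) = \sum_(j <- s | P j) Int m (F j).
Proof.
move=> h; elim: s => [|j s ih].
  rewrite big_nil; under eq_Rintegral do rewrite big_nil.
  by rewrite Rintegral_cst// mul0r.
rewrite big_cons; have [Pj|nPj] := boolP (P j); last first.
  by under eq_Rintegral do rewrite big_cons (negbTE nPj).
under eq_Rintegral do rewrite big_cons Pj.
by rewrite IntD ?ih//; [exact: h | exact: bounded_mfun_sum].
Qed.

Lemma eq_Int f g : (forall x, 0 <= x < 1 -> f x = g x) -> Int m f = Int m g.
Proof. by move=> fg; apply: eq_Rintegral => x; rewrite inE/= in_itv/= => /fg. Qed.

Lemma le_Int f g : bounded_mfun f -> bounded_mfun g ->
  (forall x, 0 <= x < 1 -> f x <= g x) -> Int m f <= Int m g.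
Proof.
move=> hf hg fg; apply: le_Rintegral => //; exact: bounded_mfun_integrable.
Qed.

Lemma Int_ge0 f : (forall x, 0 <= x < 1 -> 0 <= f x) -> 0 <= Int m f.
Proof. by move=> h; apply: Rintegral_ge0 => x; rewrite /= in_itv/= => /h. Qed.

Lemma le_normr_Int f : bounded_mfun f -> `|Int m f| <= Int m (fun x => `|f x|).
Proof. by move=> hf; apply: le_normr_Rintegral => //; exact: bounded_mfun_integrable. Qed.

Lemma Int_cst c : Int m (fun=> c) = c * fine (m `[0%R, 1%R[%classic).
Proof. exact: Rintegral_cst. Qed.

Lemma Int_fineK f : bounded_mfun f ->
  (\int[m]_(x in `[0%R, 1%R[) (f x)%:E)%E = (Int m f)%:E.
Proof.
move=> hf; rewrite fineK//; apply: integrable_fin_num => //.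
exact: bounded_mfun_integrable.
Qed.

End integrals_on_the_unit_interval.

Section lebesgue_unit_interval.
Context {R : realType}.
Notation mu := (@lebesgue_measure R).

Lemma lebesgue_measure_unit : (mu `[0%R, 1%R[%classic = 1)%E.
Proof. by rewrite lebesgue_measure_itv/= lte01 sube0. Qed.

Lemma lebesgue_measure_unit_fin : (mu `[0%R, 1%R[%classic < +oo)%E.
Proof. by rewrite lebesgue_measure_unit ltry. Qed.

#[local] Hint Resolve lebesgue_measure_unit_fin : core.

Lemma Int_lebesgue_cst (c : R) : Int mu (fun=> c) = c.
Proof. by rewrite Int_cst [X in fine X]lebesgue_measure_unit mulr1. Qed.

End lebesgue_unit_interval.
#[global] Hint Resolve lebesgue_measure_unit_fin : core.

Section bounded_polynomials.
Context {R : realType}.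

Lemma measurable_horner_borel (p : {poly R}) :
  @measurable_fun _ _ (measurableTypeR R) R setT (horner p).
Proof. by apply: continuous_measurable_fun; exact: continuous_horner. Qed.

Lemma normr_horner_le (p : {poly R}) (x : R) : 0 <= x < 1 -> `|p.[x]| <= \sum_(i < size p) `|p`_i|.
Proof.
move=> /andP[x0 /ltW x1]; rewrite horner_coef (le_trans (ler_norm_sum _ _ _))//.
apply: ler_sum => i _; rewrite normrM ler_piMr// normrX ger0_norm//.
by rewrite exprn_ile1.
Qed.

Lemma bounded_mfun_horner (p : {poly R}) : bounded_mfun (horner p).
Proof.
split; first by apply: measurable_funTS; exact: measurable_horner_borel.
by exists (\sum_(i < size p) `|p`_i|) => x; exact: normr_horner_le.
Qed.
End bounded_polynomials.

(** Follows the syntax of the integrand. Atoms such as [loc a] are closed by [assumption], hence the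
    facts brought into the context before its calls; what it cannot close is left as a goal. *)
Ltac bounded := first [assumption | lazymatch goal with
  | |- bounded_mfun (fun x => @?f x + @?g x) => apply: (@bounded_mfunD _ f g); bounded
  | |- bounded_mfun (fun x => - @?f x) => apply: (@bounded_mfunN _ f); bounded
  | |- bounded_mfun (fun x => @?f x * @?g x) => apply: (@bounded_mfunM _ f g); bounded
  | |- bounded_mfun (fun x => @?f x ^+ ?n) => apply: (@bounded_mfunX _ f n); bounded
  | |- bounded_mfun (fun x => `| @?f x |) => apply: (@bounded_mfun_norm _ f); bounded
  | |- bounded_mfun (fun x => expR (@?f x)) => apply: (@bounded_mfun_expR _ f); bounded
  | |- bounded_mfun (fun x => \sum_(i <- ?r | @?P i) @?F i x) =>
      apply: bounded_mfun_sum => ? ?; bounded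
  | |- bounded_mfun (fun x => ?c) => first [exact: bounded_mfun_cst | exact: bounded_mfun_horner | done | idtac]
  | |- _ => first [done | exact: bounded_mfun_horner | exact: lebesgue_measure_unit_fin | idtac]
  end].

(** * Expectation of a product over an i.i.d. sample *)

Lemma measurable_indic_comp d (S : measurableType d) d' (Y : measurableType d')
  (R : realType) (A : set Y) (phi : S -> Y) : measurable A ->
  measurable_fun setT phi -> measurable_fun setT (fun x => \1_A (phi x) : R).
Proof.
move=> mA mphi; have mi := @measurable_indic _ Y R setT A mA.
exact: (measurableT_comp mi mphi).
Qed.

Section transfer.
Local Open Scope ereal_scope.
Context d (S : measurableType d) d' (Y : measurableType d') (R : realType).
Variables (m : {measure set S -> \bar R}) (nu : {measure set Y -> \bar R}).
Variables (phi : S -> Y) (h : S -> R).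
Hypothesis mphi : measurable_fun setT phi.
Hypothesis mh : measurable_fun setT h.
Hypothesis h0 : forall x, (0 <= h x)%R.
Hypothesis hnu : forall A, measurable A ->
  \int[m]_x (h x * \1_A (phi x))%:E = nu A.

Import HBNNSimple.

(** Image measure and density in one statement, by simple functions and monotone convergence. It
    serves with [h] a product over the other coordinates, and with [phi] the identity and [h] the
    density of the observations. *)
Lemma ge0_integral_transfer (f : Y -> \bar R) :
  measurable_fun setT f -> (forall y, 0 <= f y) ->
  \int[m]_x (f (phi x) * (h x)%:E) = \int[nu]_y f y.
Proof.
move=> mf f0; pose g := nnsfun_approx measurableT mf.
have gE y : f y = limn (fun n => (g n y)%:E).
  by apply/esym/cvg_lim => //; exact: (cvg_nnsfun_approx measurableT mf (fun y _ => f0 y)).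
have mgphi n : measurable_fun setT (fun x => g n (phi x)).
  by apply: measurableT_comp.
have -> : \int[nu]_y f y = limn (fun n => \int[nu]_y (g n y)%:E).
  under eq_integral do rewrite gE.
  apply: monotone_convergence => //.
  - by move=> n; exact/measurable_EFinP.
  - by move=> n x _; rewrite lee_fin.
  - by move=> x _ a b ab; rewrite lee_fin; exact/lefP/nd_nnsfun_approx.
have -> : \int[m]_x (f (phi x) * (h x)%:E) =
    limn (fun n => \int[m]_x ((g n (phi x))%:E * (h x)%:E)).
  have fE x : f (phi x) * (h x)%:E = limn (fun n => (g n (phi x))%:E * (h x)%:E).
    apply/esym/cvg_lim => //; apply: cvgeZr => //.
    exact: (cvg_nnsfun_approx measurableT mf (fun y _ => f0 y)).
  under eq_integral do rewrite fE.
  apply: monotone_convergence => //.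
  - by move=> n; apply: emeasurable_funM; exact/measurable_EFinP.
  - by move=> n x _; rewrite mule_ge0// lee_fin.
  - move=> x _ a b ab; rewrite lee_wpmul2r ?lee_fin//.
    exact/lefP/nd_nnsfun_approx.
congr (limn _); apply/funext => n.
have mpre r : measurable (g n @^-1` [set r]) by exact: measurable_sfunP.
have mi r : measurable_fun setT (fun x => (\1_(g n @^-1` [set r]) (phi x) : R)).
  exact: measurable_indic_comp.
transitivity (\int[m]_x (\sum_(y \in range (g n))
    (y * (h x * \1_(g n @^-1` [set y]) (phi x)))%:E)).
  apply: eq_integral => x _; rewrite fimfunE fsumEFin// -EFinM; congr EFin.
  rewrite !fsbig_finite//= mulr_suml; apply: eq_bigr => i _; ring.
have pos r x : (0%R <= (r * (h x * \1_(g n @^-1` [set r]) (phi x)))%:E).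
  have := nnfun_muleindic_ge0 (g n) r (phi x).
  rewrite !lee_fin => H; rewrite mulrCA; exact: mulr_ge0.
rewrite ge0_integral_fsum//; last first.
  move=> r; apply/measurable_EFinP/measurable_funM => //.
  exact: measurable_funM.
transitivity (\int[nu]_x (\sum_(y \in range (g n))
    (y * \1_(g n @^-1` [set y]) x)%:E)); last first.
  by apply: eq_integral => t tE; rewrite /= fimfunE -fsumEFin.
rewrite ge0_integral_fsum//; last 2 first.
- by move=> r; apply/measurable_EFinP/measurable_funM.
- by move=> r x _; exact: nnfun_muleindic_ge0.
apply: eq_fsbigr => r; rewrite inE => -[t _ tr].
have r0 : (0 <= r)%R by rewrite -tr.
under eq_integral do rewrite EFinM.
rewrite ge0_integralZl_EFin//; last 2 first.
- by move=> x _; rewrite lee_fin mulr_ge0.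
- by apply/measurable_EFinP; exact: measurable_funM.
rewrite hnu//; under [RHS]eq_integral do rewrite EFinM.
rewrite ge0_integralZl_EFin//; last by apply/measurable_EFinP.
by rewrite integral_indic// setIT.
Qed.

End transfer.

Section product_expectation.
Local Open Scope ereal_scope.
Context d (T : measurableType d) d' (Y : measurableType d') (R : realType).
Variables (P : probability T R) (X : nat -> T -> Y) (Q : probability Y R).
Hypothesis mX : forall i, measurable_fun setT (X i).
Hypothesis XQ : forall n (A : nat -> set Y), (forall i, measurable (A i)) ->
  P (\bigcap_(i in `I_n) (X i @^-1` A i)) = \prod_(i < n) Q (A i).
Variable F : Y -> R.
Hypothesis mF : measurable_fun setT F.
Hypothesis F0 : forall x, (0 <= F x)%R.
Hypothesis F_fin : \int[Q]_x (F x)%:E \is a fin_num.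

Let EF := fine (\int[Q]_x (F x)%:E).

(* The factors are replaced one coordinate at a time, from indicators to [F]. *)
Let mixed n (A : nat -> set Y) m w : R :=
  (\prod_(i < n) (if (i < m)%N then F (X i w) else \1_(A i) (X i w)))%R.

Let measurable_mixed_factor (A : nat -> set Y) (b : bool) i : (forall i, measurable (A i)) ->
  measurable_fun setT (fun w => if b then F (X i w) else \1_(A i) (X i w) : R).
Proof.
move=> mA; case: b; first exact: measurableT_comp.
exact: measurable_indic_comp.
Qed.

Let integral_mixed n (A : nat -> set Y) m : (m <= n)%N ->
  (forall i, measurable (A i)) ->
  \int[P]_w (mixed n A m w)%:E =
   (\prod_(i < n) (if (i < m)%N then EF else fine (Q (A i))))%:E.
Proof.
elim: m A => [|m ih] A mn mA.
  have mB : measurable (\bigcap_(i in `I_n) (X i @^-1` A i)).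
    apply: bigcap_measurableType => i _.
    by rewrite -[X in measurable X]setTI; exact: mX.
  transitivity (\int[P]_w (\1_(\bigcap_(i in `I_n) (X i @^-1` A i)) w)%:E).
    apply: eq_integral => w _; congr EFin; rewrite /mixed indicE.
    have [wB|wB] := boolP (w \in _).
      rewrite big1// => i _ /=; rewrite indicE mem_set//.
      by move: wB; rewrite inE => /(_ i (ltn_ord i)).
    apply/eqP/prodf_eq0.
    have /existsNP[i /not_implyP[iN Ai]] : ~ (forall i, (i < n)%N -> A i (X i w)).
      by move=> h; move/negP: wB; apply; rewrite inE => i; exact: h.
    by exists (Ordinal iN) => //=; rewrite indicE memNset.
  rewrite integral_indic// setIT [LHS]XQ//= -prodEFin; apply: eq_bigr => i _.
  by rewrite fineK// fin_num_measure.
pose i0 := Ordinal mn.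
pose H w := (\prod_(i < n | i != i0) (if (i < m)%N then F (X i w) else \1_(A i) (X i w)))%R.
pose c := (\prod_(i < n | i != i0) (if (i < m)%N then EF else fine (Q (A i))))%R.
have EF0 : (0 <= EF)%R by apply: fine_ge0; apply: integral_ge0 => x _; rewrite lee_fin.
have c0 : (0 <= c)%R.
  apply: prodr_ge0 => i _; case: ifP => // _; exact: fine_ge0.
have mixedE : mixed n A m.+1 = fun w => (F (X i0 w) * H w)%R.
  apply/funext => w; rewrite /mixed (bigD1 i0)//= ltnSn; congr (_ * _)%R.
  by apply: eq_bigr => i ii0; rewrite ltnS leq_eqVlt (negbTE (_ : (i != m :> nat))).
have -> : (\prod_(i < n) (if (i < m.+1)%N then EF else fine (Q (A i))))%R = (EF * c)%R.
  rewrite (bigD1 i0)//= ltnSn; congr (_ * _)%R.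
  by apply: eq_bigr => i ii0; rewrite ltnS leq_eqVlt (negbTE (_ : (i != m :> nat))).
rewrite mixedE; under eq_integral do rewrite EFinM.
have H0 w : (0 <= H w)%R.
  by apply: prodr_ge0 => i _; case: ifP => // _; rewrite indicE.
have mH : measurable_fun setT H.
  rewrite /H; under eq_fun do rewrite big_mkcond.
  apply: measurable_prod => i _; case: (i != i0) => //.
  exact: measurable_mixed_factor.
rewrite (@ge0_integral_transfer _ _ _ _ _ P (mscale (NngNum c0) Q) (X i0) H _ _ _ _ (EFin \o F))//; first last.
- exact/measurable_EFinP.
(* The induction hypothesis holds for all families of sets, so the m-th one may be an arbitrary [B].
   This identifies the image under [X m] of the measure with density [H] as [c] times [Q]. *)
- move=> B mB; pose A' i := if i == m then B else A i.
  have mA' i : measurable (A' i) by rewrite /A'; case: ifP.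
  have := ih A' (ltnW mn) mA'.
  rewrite (_ : mixed n A' m = fun w => (H w * \1_B (X i0 w))%R); last first.
    apply/funext => w; rewrite /mixed (bigD1 i0)//= ltnn /A' eqxx mulrC.
    by congr (_ * _)%R; apply: eq_bigr => i ii0; rewrite (negbTE (_ : (i != m :> nat))).
  move=> ->; rewrite (bigD1 i0)//= ltnn /A' eqxx.
  rewrite /mscale/= muleC EFinM fineK ?fin_num_measure//; congr (_ * _).
  by congr EFin; apply: eq_bigr => i ii0; rewrite (negbTE (_ : (i != m :> nat))).
- rewrite ge0_integral_mscale//=; last 2 first.
  + exact/measurable_EFinP.
  + by move=> x _; rewrite lee_fin.
  by rewrite EFinM muleC /EF fineK.
Qed.

Lemma expectation_prod_iid n :
  \int[P]_w (\prod_(i < n) F (X i w))%:E = ((EF ^+ n)%R)%:E.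
Proof.
have := @integral_mixed n (fun=> setT) n (leqnn _) (fun=> measurableT).
rewrite -[X in (EF ^+ X)%R](card_ord n) -prodr_const.
under [in RHS]eq_bigr do rewrite ltn_ord.
move=> <-; apply: eq_integral => w _; congr EFin.
by apply: eq_bigr => i _; rewrite ltn_ord.
Qed.

End product_expectation.

(** * Moments of the empirical process *)

Definition emp_dev {R : realType} (Q : probability (measurableTypeR R) R)
  (n : nat) (x : nat -> R) (g : R -> R) : R :=
  n%:R^-1 * (\sum_(i < n) g (x i)) - Int Q g.

Section unit_interval_probability.
Context {R : realType}.
Variable Q : probability (measurableTypeR R) R.
Hypothesis Q01 : Q `[0%R, 1%R[%classic = 1%E.
Implicit Types (f g : R -> R) (c : R).

Lemma unit_interval_prob_fin : (Q `[0%R, 1%R[%classic < +oo)%E.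
Proof. by rewrite Q01 ltry. Qed.
Hint Resolve unit_interval_prob_fin : core.

Lemma Int_prob_cst c : Int Q (fun=> c) = c.
Proof. by rewrite Int_cst [X in fine X]Q01 mulr1. Qed.

Lemma ge0_integral_unit_interval (f : R -> \bar R) :
  @measurable_fun _ _ (measurableTypeR R) _ setT f -> (forall x, (0 <= f x)%E) ->
  (\int[Q]_x f x = \int[Q]_(x in `[0%R, 1%R[) f x)%E.
Proof.
move=> mf f0.
have QC : Q (~` `[0%R, 1%R[%classic) = 0%E.
  by rewrite probability_setC// Q01 subee.
rewrite (@ge0_negligible_integral _ (measurableTypeR R) _ _ setT (~` `[0%R, 1%R[%classic))//.
- by rewrite setTD setCK.
- exact: measurableC.
Qed.

Lemma Int_centered_sqr_le f c : bounded_mfun f -> Int Q (fun x => f x ^+ 2) <= c ->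
  Int Q (fun x => (f x - Int Q f) ^+ 2) <= c.
Proof.
move=> hf; apply: le_trans; set m := Int Q f.
have -> : Int Q (fun x => (f x - m) ^+ 2) = Int Q (fun x => f x ^+ 2) - m ^+ 2.
  rewrite (@eq_Int _ _ _ (fun x => f x ^+ 2 + (m ^+ 2 - 2 * m * f x))); last first.
    by move=> x _; ring.
  by rewrite IntD; [rewrite IntB; [rewrite Int_prob_cst IntZ; [rewrite -/m; ring|..]|..]|..]; bounded.
by rewrite gerBl sqr_ge0.
Qed.

End unit_interval_probability.

Section empirical_moments.
Context d (T : measurableType d) (R : realType).
Variables (P : probability T R) (X : nat -> T -> measurableTypeR R).
Variable Q : probability (measurableTypeR R) R.
Hypothesis mX : forall i, measurable_fun setT (X i).
Hypothesis XQ : forall n (A : nat -> set (measurableTypeR R)),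
  (forall i, measurable (A i)) ->
  P (\bigcap_(i in `I_n) (X i @^-1` A i)) = (\prod_(i < n) Q (A i))%E.
Hypothesis Q01 : Q `[0%R, 1%R[%classic = 1%E.
Variable n : nat.
Hypothesis n0 : (0 < n)%N.

Let s : R := Num.sqrt n%:R.
Let s0 : 0 < s. Proof. by rewrite sqrtr_gt0 ltr0n. Qed.
Let s2 : s ^+ 2 = n%:R. Proof. by rewrite sqr_sqrtr. Qed.

Let dev q w := emp_dev Q n (X^~ w) q.

(** A Bernstein argument at the scale of the standard deviation. Each of the n factors is at most 1
    + C e^K / n, because the linear term has mean zero and the exponent is at most [K]; their
    product stays below exp (C e^K). The condition on [B] lets [q] be as large as a multiple of sqrt
    n. *)
Lemma emp_dev_expR_le (q : R -> R) (B C K : R) :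
  @measurable_fun _ _ (measurableTypeR R) R setT q ->
  (forall x, `|q x| <= B) -> Int Q (fun x => q x ^+ 2) <= C ->
  2 * B <= K * s ->
  (\int[P]_w (expR (s * dev q w))%:E <= (expR (C * expR K))%:E)%E.
Proof.
move=> mq qB qC BK; set m := Int Q q.
have bq : bounded_mfun q by split; [exact: measurable_funTS | exists B].
have mB : `|m| <= B.
  apply: le_trans (le_normr_Int _ bq) _; first exact: unit_interval_prob_fin.
  rewrite -[leRHS](Int_prob_cst Q01) le_Int//; bounded.
  exact: unit_interval_prob_fin.
pose F x := expR (s^-1 * (q x - m)).
have bF : bounded_mfun F.
  by rewrite /F; bounded.
have mF : @measurable_fun _ _ (measurableTypeR R) R setT F.
  apply: measurableT_comp => //; apply: measurable_funM => //.
  exact: measurable_funB.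
have F0 x : 0 <= F x by exact: expR_ge0.
have intF : (\int[Q]_x (F x)%:E = (Int Q F)%:E)%E.
  rewrite ge0_integral_unit_interval//; last exact/measurable_EFinP.
  by rewrite Int_fineK// unit_interval_prob_fin.
have -> : (\int[P]_w (expR (s * dev q w))%:E =
    \int[P]_w (\prod_(i < n) F (X i w))%:E)%E.
  apply: eq_integral => w _; congr EFin; rewrite /F -expR_sum; congr expR.
  rewrite -mulr_sumr big_split/= sumr_const card_ord /dev /emp_dev -/m.
  rewrite mulNrn -(mulr_natl m) -s2.
  by field; rewrite gt_eqF.
rewrite (expectation_prod_iid mX XQ)//; last by rewrite intF.
rewrite intF lee_fin /=.
have h1 : Int Q F <= 1 + C * expR K / n%:R.
  apply: (@le_trans _ _ (Int Q (fun x => 1 + (s^-1 * (q x - m) + expR K / n%:R * (q x - m) ^+ 2)))).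
    apply: le_Int => //; bounded; first exact: unit_interval_prob_fin.
    move=> x _; rewrite /F.
    have h : `|s^-1 * (q x - m)| <= K.
      rewrite normrM gtr0_norm ?invr_gt0// ler_pdivrMl// mulrC (le_trans _ BK)//.
      by rewrite (le_trans (ler_normB _ _))// mulr2n mulrDl mul1r lerD.
    apply: le_trans (expR_le_quadratic h) _; rewrite addrA lerD2l.
    by rewrite exprMn exprVn s2 mulrC mulrA.
  have hc := Int_centered_sqr_le Q01 bq qC.
  rewrite IntD; try exact: unit_interval_prob_fin; bounded.
  rewrite IntD; try exact: unit_interval_prob_fin; bounded.
  rewrite IntZ; try exact: unit_interval_prob_fin; bounded.
  rewrite IntZ; try exact: unit_interval_prob_fin; bounded.
  rewrite IntB; try exact: unit_interval_prob_fin; bounded.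
  rewrite !Int_prob_cst// subrr mulr0 add0r lerD2l.
  rewrite -[leRHS]mulrA [leRHS]mulrC ler_wpM2l//.
apply: (@le_trans _ _ (expR (C * expR K / n%:R) ^+ n)).
  rewrite ler_pXn2r// ?nnegrE ?expR_ge0 ?Int_ge0//.
  exact: le_trans h1 (expR_ge1Dx _).
by rewrite -expRM_natl -mulr_natl mulrCA mulfV ?mulr1// pnatr_eq0 -lt0n.
Qed.

Lemma emp_devN q w : bounded_mfun q -> dev (fun x => - q x) w = - dev q w.
Proof.
move=> bq; rewrite /dev /emp_dev sumrN.
rewrite (@eq_Int _ _ _ (fun x => -1 * q x)); last by move=> x _; rewrite mulN1r.
rewrite IntZ//; [ring|exact: unit_interval_prob_fin].
Qed.

Lemma measurable_emp_dev q :
  @measurable_fun _ _ (measurableTypeR R) R setT q -> measurable_fun setT (dev q).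
Proof.
move=> mq; apply: measurable_funB => //; apply: measurable_funM => //.
by apply: measurable_sum => i; exact: measurableT_comp.
Qed.

(** Uses y^(2p) <= (2p)! (e^y + e^(-y)) and the exponential moments of [q] and of its opposite. *)
Lemma emp_dev_moment_le p (q : R -> R) (B C K : R) :
  @measurable_fun _ _ (measurableTypeR R) R setT q ->
  (forall x, `|q x| <= B) -> Int Q (fun x => q x ^+ 2) <= C ->
  2 * B <= K * s ->
  (\int[P]_w ((s * dev q w) ^+ (2 * p))%:E <=
    ((2 * p)`!%:R * (2 * expR (C * expR K)))%:E)%E.
Proof.
move=> mq qB qC BK.
have bq : bounded_mfun q by split; [exact: measurable_funTS | exists B].
have mdev := measurable_emp_dev mq.
have mqN : @measurable_fun _ _ (measurableTypeR R) R setT (fun x => - q x) by exact: measurable_funN.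
have mdevN := measurable_emp_dev mqN.
have expD (g : T -> R) : measurable_fun setT g ->
    measurable_fun setT (fun w => (expR (s * g w))%:E).
  by move=> mg; apply/measurable_EFinP; apply: measurableT_comp => //; exact: measurable_funM.
apply: (@le_trans _ _ (\int[P]_w ((2 * p)`!%:R%:E *
    ((expR (s * dev q w))%:E + (expR (s * dev (fun x => - q x) w))%:E))))%E.
  apply: ge0_le_integral => //.
  - by move=> w _; rewrite lee_fin exprM exprn_ge0 ?sqr_ge0.
  - by apply/measurable_EFinP/measurable_funX/measurable_funM.
  - apply: emeasurable_funM => //; apply: emeasurable_funD; exact: expD.
  move=> w _; rewrite -EFinD -EFinM lee_fin emp_devN// mulrN.
  set y := s * _.
  have -> : y ^+ (2 * p) = `|y| ^+ (2 * p) by rewrite !exprM real_normK ?num_real.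
  apply: le_trans (exprn_le_expR _ (normr_ge0 y)) _; rewrite ler_wpM2l//.
  have := expR_ge0 y; have := expR_ge0 (- y).
  by have [y0|y0] := ger0P y; lra.
rewrite ge0_integralZl_EFin//; last 2 first.
- by move=> w _; rewrite -EFinD lee_fin addr_ge0 ?expR_ge0.
- by apply: emeasurable_funD; exact: expD.
rewrite EFinM lee_wpmul2l ?lee_fin//.
rewrite ge0_integralD//; [|exact: expD|exact: expD].
rewrite mulrDl mul1r EFinD; apply: leeD; first exact: emp_dev_expR_le qB qC BK.
apply: (@emp_dev_expR_le _ B) => //.
- by move=> x; rewrite normrN.
- by rewrite (@eq_Int _ _ _ (fun x => q x ^+ 2))// => x _; rewrite sqrrN.
Qed.

End empirical_moments.

(** * Orthonormal polynomials *)

Section polynomial_integrals.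
Context {R : realType}.
Notation mu := (@lebesgue_measure R).
Implicit Types (p q r P : {poly R}).

Lemma Rintegral_deriv_poly P (a b : R) : a <= b ->
  \int[mu]_(x in `[a, b]) (P^`()).[x] = P.[b] - P.[a].
Proof.
rewrite le_eqVlt => /predU1P[->|ab].
  by rewrite set_itv1 Rintegral_set1 subrr.
rewrite /Rintegral (@continuous_FTC2 _ _ (horner P))//.
- by apply: continuous_subspaceT => x; exact: continuous_horner.
- split.
  + by move=> x _; exact: derivable_horner.
  + by apply: cvg_at_right_filter; exact: continuous_horner.
  + by apply: cvg_at_left_filter; exact: continuous_horner.
- by move=> x _; rewrite derivE.
Qed.

Definition primitive p : {poly R} :=
  \poly_(i < (size p).+1) (p`_i.-1 / i%:R).

Lemma deriv_primitive p : (primitive p)^`() = p.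
Proof.
apply/polyP => i; rewrite coef_deriv coef_poly ltnS.
case: ltnP => [|pi]; last by rewrite mul0rn nth_default.
by move=> _; rewrite /= -[LHS]mulr_natr mulfVK// pnatr_eq0.
Qed.

Definition poly_int p : R := Int mu (horner p).

Lemma poly_intE p : poly_int p = (primitive p).[1] - (primitive p).[0].
Proof.
rewrite -Rintegral_deriv_poly// deriv_primitive -Rintegral_itv_bndo_bndc//.
by apply: bounded_mfun_integrable; bounded.
Qed.

Lemma poly_int_linear c p q :
  poly_int (c *: p + q) = c * poly_int p + poly_int q.
Proof.
rewrite /poly_int.
rewrite (@eq_Int _ _ _ (fun x => c * p.[x] + q.[x])); last by move=> x _; rewrite hornerD hornerZ.
by rewrite IntD; [rewrite IntZ|..]; bounded.
Qed.

Lemma poly_int0 : poly_int 0 = 0.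
Proof.
by have := poly_int_linear (-1) 0 0; rewrite scaler0 addr0 mulN1r addNr.
Qed.

Lemma poly_intZ c p : poly_int (c *: p) = c * poly_int p.
Proof. by have := poly_int_linear c p 0; rewrite !addr0 poly_int0 addr0. Qed.

Lemma poly_intD p q : poly_int (p + q) = poly_int p + poly_int q.
Proof. by have := poly_int_linear 1 p q; rewrite scale1r mul1r. Qed.

Lemma poly_int_sum (m : nat) (F : nat -> {poly R}) :
  poly_int (\sum_(i < m) F i) = \sum_(i < m) poly_int (F i).
Proof.
elim: m => [|m ih]; first by rewrite !big_ord0 poly_int0.
by rewrite !big_ord_recr/= poly_intD ih.
Qed.

(** A primitive of p^2 is nondecreasing; if the integral vanished it would be constant on [0, 1].
    Its difference with that constant would have more roots than its size allows, so its derivative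
    p^2 would be zero. *)
Lemma poly_int_sqr_gt0 p : p != 0 -> 0 < poly_int (p * p).
Proof.
move=> p0; set P := primitive (p * p).
have mono a b : a <= b -> P.[a] <= P.[b].
  move=> ab; rewrite -subr_ge0 -Rintegral_deriv_poly// deriv_primitive.
  by apply: Rintegral_ge0 => x _; rewrite hornerM -expr2 sqr_ge0.
rewrite poly_intE -/P lt_neqAle subr_ge0 mono// andbT eq_sym subr_eq0.
apply/eqP => P10; pose q := P - (P.[0])%:P.
suff q0 : q = 0.
  have : (q + (P.[0])%:P)^`() = 0 by rewrite q0 add0r derivC.
  rewrite subrK deriv_primitive => /eqP; by rewrite mulf_eq0 orbb (negbTE p0).
pose N := size q; pose rs := [seq (i%:R / N.+1%:R : R) | i <- iota 0 N.+1].
apply: (@roots_geq_poly_eq0 _ q rs); last by rewrite size_map size_iota.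
  apply/allP => _ /mapP[i + ->]; rewrite mem_iota add0n leq0n/= => iN.
  rewrite /root /q hornerD hornerN hornerC subr_eq0 eq_le.
  have x0 : 0 <= (i%:R / N.+1%:R : R) by rewrite divr_ge0.
  have x1 : i%:R / N.+1%:R <= 1 :> R by rewrite ler_pdivrMr ?mul1r ?ltr0n// ler_nat ltnW.
  by rewrite -{1}P10 !mono.
rewrite map_inj_uniq ?iota_uniq// => i j.
move=> /(congr1 ( *%R^~ N.+1%:R)); rewrite /= !mulfVK ?pnatr_eq0//.
by move/eqP; rewrite eqr_nat => /eqP.
Qed.

(* Gram--Schmidt, phrased through the reproducing identity *)
Lemma orthonormal_polys m : exists Q : nat -> {poly R},
  [/\ forall i, (i < m)%N -> (size (Q i) <= m)%N,
      forall i j, (i < m)%N -> (j < m)%N -> poly_int (Q i * Q j) = (i == j)%:R &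
      forall p, (size p <= m)%N ->
        p = \sum_(i < m) poly_int (p * Q i) *: Q i].
Proof.
elim: m => [|m [Q [Qs Qo Qr]]].
  exists (fun=> 0); split => // p; rewrite leqn0 size_poly_eq0 => /eqP ->.
  by rewrite big_ord0.
pose proj p := \sum_(i < m) poly_int (p * Q i) *: Q i.
pose r : {poly R} := 'X^m - proj 'X^m.
have proj_size p : (size (proj p) <= m)%N.
  apply: (leq_trans (size_sum _ _ _)); apply/bigmax_leqP => i _.
  by rewrite (leq_trans (size_scale_leq _ _))// Qs.
have rm : r`_m = 1.
  by rewrite coefB coefXn eqxx nth_default ?subr0.
have r0 : r != 0 by apply: contraTneq isT => r0; move: rm; rewrite r0 coef0 => /eqP; rewrite eq_sym oner_eq0.
have rs : (size r <= m.+1)%N.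
  rewrite (leq_trans (size_polyD _ _))// size_polyN size_polyXn geq_max leqnn/=.
  by rewrite (leq_trans (proj_size _)).
have rQ i : (i < m)%N -> poly_int (r * Q i) = 0.
  move=> im; rewrite /r mulrBl poly_intD -scaleN1r poly_intZ mulN1r.
  rewrite /proj mulr_suml.
  rewrite (poly_int_sum m (fun j => poly_int ('X^m * Q j) *: Q j * Q i)).
  rewrite (bigD1 (Ordinal im))//= big1 ?addr0.
    by rewrite -scalerAl poly_intZ Qo// eqxx mulr1 subrr.
  move=> j ji; rewrite -scalerAl poly_intZ Qo//.
  by rewrite (negbTE (_ : j != i :> nat)) ?mulr0.
pose c := Num.sqrt (poly_int (r * r)).
have c0 : 0 < c by rewrite sqrtr_gt0 poly_int_sqr_gt0.
have c2 : c ^+ 2 = poly_int (r * r) by rewrite sqr_sqrtr// ltW// poly_int_sqr_gt0.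
pose Q' i := if (i < m)%N then Q i else c^-1 *: r.
have Q'm : Q' m = c^-1 *: r by rewrite /Q' ltnn.
have Q'i i : (i < m)%N -> Q' i = Q i by rewrite /Q' => ->.
have rQ' i : (i < m)%N -> poly_int (Q' m * Q' i) = 0.
  by move=> im; rewrite Q'm Q'i// -scalerAl poly_intZ rQ// mulr0.
exists Q'; split.
- move=> i; rewrite ltnS leq_eqVlt => /predU1P[->|im].
    by rewrite Q'm (leq_trans (size_scale_leq _ _)).
  by rewrite Q'i// (leq_trans (Qs _ im)).
- move=> i j; rewrite !ltnS (leq_eqVlt i) (leq_eqVlt j).
  move=> /predU1P[->|im] /predU1P[->|jm].
  + rewrite Q'm -scalerAl -scalerAr !poly_intZ -c2 eqxx /=.
    by field; rewrite gt_eqF.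
  + by rewrite rQ'// gtn_eqF.
  + by rewrite mulrC rQ'// ltn_eqF.
  + by rewrite !Q'i// Qo.
(* [r] has coefficient 1 in degree m, so subtracting [t *: r] brings [p] down to the range of the
   induction hypothesis. *)
move=> p ps; pose t := p`_m.
have p'm : (size (p - t *: r)%R <= m)%N.
  apply/leq_sizeP => j; rewrite leq_eqVlt => /predU1P[<-|mj].
    by rewrite coefB coefZ rm mulr1 subrr.
  rewrite coefB coefZ !nth_default ?mulr0 ?subrr//.
    exact: leq_trans rs mj.
  exact: leq_trans ps mj.
have qr : poly_int ((p - t *: r) * r) = 0.
  rewrite [in LHS](Qr _ p'm) mulr_suml.
  rewrite (poly_int_sum m (fun j => poly_int ((p - t *: r) * Q j) *: Q j * r)).
  by rewrite big1// => i _; rewrite -scalerAl poly_intZ mulrC [Q i * r]mulrC rQ ?mul0r.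
have pQ' i : (i < m)%N -> poly_int (p * Q' i) = poly_int ((p - t *: r) * Q i).
  move=> im; rewrite Q'i// mulrBl poly_intD -scaleN1r poly_intZ -scalerAl.
  by rewrite poly_intZ rQ// !mulr0 addr0.
have pQ'm : poly_int (p * Q' m) = t * c.
  have -> : p * Q' m = c^-1 *: ((p - t *: r) * r + t *: (r * r)).
    by rewrite Q'm mulrBl -scalerAl subrK scalerAr.
  rewrite poly_intZ poly_intD qr add0r poly_intZ -c2.
  by field; rewrite gt_eqF.
rewrite big_ord_recr/= pQ'm Q'm scalerA mulfK ?gt_eqF//.
rewrite -[LHS](subrK (t *: r)) {1}(Qr _ p'm); congr (_ + _).
by apply: eq_bigr => i _; rewrite pQ'// Q'i.
Qed.

End polynomial_integrals.

(** * Multiscale bound for the empirical process *)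

Section local_basis.
Context {R : realType}.
Notation mu := (@lebesgue_measure R).
Variables (k : nat) (Q : nat -> {poly R}) (B : R).
Hypothesis size_Q : forall i, (i < k.+1)%N -> (size (Q i) <= k.+1)%N.
Hypothesis Q_orth : forall i j, (i < k.+1)%N -> (j < k.+1)%N ->
  poly_int (Q i * Q j) = (i == j)%:R.
Hypothesis Q_repr : forall p : {poly R}, (size p <= k.+1)%N ->
  p = \sum_(i < k.+1) poly_int (p * Q i) *: Q i.
Hypothesis Q_le : forall i x, (i < k.+1)%N -> 0 <= x < 1 -> `|(Q i).[x]| <= B.
Notation idx l := ('I_(4 ^ l) * 'I_k.+1)%type.
Implicit Types (g u : R -> R) (l j : nat) (x : R).

(** Written without division: the index of the cell of [x] is then [truncn (4 ^+ l * x)], and the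
    parent index is the quotient by 4. *)
Definition cell l j : set R := [set x | j%:R <= 4 ^+ l * x < j.+1%:R].

Lemma cellE l j : cell l j = `[j%:R / 4 ^+ l, j.+1%:R / 4 ^+ l[%classic.
Proof.
have c0 : (0 : R) < 4 ^+ l by rewrite exprn_gt0.
apply/seteqP; split => x; rewrite /= in_itv/= ler_pdivrMr// ltr_pdivlMr//;
  by rewrite mulrC.
Qed.

Lemma measurable_cell l j : measurable (cell l j : set (measurableTypeR R)).
Proof. by rewrite cellE. Qed.

Lemma cell_unit l j x : (j < 4 ^ l)%N -> cell l j x -> 0 <= x < 1.
Proof.
move=> jl /andP[h1 h2]; have c0 : (0 : R) < 4 ^+ l by rewrite exprn_gt0.
apply/andP; split.
  by rewrite -(pmulr_rge0 x c0) (le_trans _ h1).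
rewrite -(ltr_pM2l c0) mulr1 (lt_le_trans h2)//.
by rewrite -natrX ler_nat.
Qed.

Lemma cell_inj l i j x : cell l i x -> cell l j x -> i = j.
Proof.
move=> /andP[h1 h2] /andP[h3 h4]; apply/eqP.
rewrite eqn_leq -[(i <= j)%N]ltnS -[(j <= i)%N]ltnS -2!(ltr_nat R); apply/andP; split.
  exact: le_lt_trans h1 h4.
exact: le_lt_trans h3 h2.
Qed.

Lemma cell_exists l x : 0 <= x < 1 -> exists2 j, (j < 4 ^ l)%N & cell l j x.
Proof.
move=> /andP[x0 x1]; have c0 : (0 : R) < 4 ^+ l by rewrite exprn_gt0.
have y0 : 0 <= 4 ^+ l * x by rewrite mulr_ge0// ltW.
exists (Num.truncn (4 ^+ l * x)).
  rewrite -(ltr_nat R) natrX; apply: le_lt_trans (_ : 4 ^+ l * x < _).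
    by have /andP[] := truncn_itv y0.
  by rewrite gtr_pMr.
exact: truncn_itv.
Qed.

Lemma cell_parent l j x : cell l.+1 j x -> cell l (j %/ 4) x.
Proof.
rewrite /cell/= exprS -mulrA => /andP[h1 h2]; apply/andP; split.
  rewrite -(ler_pM2l (_ : 0 < 4))//; apply: le_trans h1.
  by rewrite -natrM ler_nat mulnC leq_trunc_div.
rewrite -(ltr_pM2l (_ : 0 < 4))//; apply: (lt_le_trans h2).
by rewrite -natrM ler_nat mulnC ltn_ceil.
Qed.

(** The affine change of variables is done on primitives: that of [r], composed with the affine map
    and rescaled, is differentiated back. *)
Lemma Int_cell_poly l j (r : {poly R}) : (j < 4 ^ l)%N ->
  Int mu (fun x => \1_(cell l j) x * r.[4 ^+ l * x - j%:R]) =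
  4 ^- l * poly_int r.
Proof.
move=> jl; pose c : R := 4 ^+ l; have c0 : 0 < c by rewrite exprn_gt0.
have cn0 : c != 0 by rewrite gt_eqF.
pose aff : {poly R} := c *: 'X - (j%:R)%:P.
have affE x : aff.[x] = c * x - j%:R by rewrite !hornerE.
pose S := c^-1 *: (primitive r \Po aff).
have dS : S^`() = r \Po aff.
  rewrite derivZ deriv_comp deriv_primitive derivB derivZ derivX derivC subr0.
  by rewrite -scalerAr mulr1 scalerA mulVf// scale1r.
have a01 : j%:R / c <= j.+1%:R / c by rewrite ler_pM2r ?invr_gt0// ler_nat.
rewrite (@eq_Int _ _ _ ((horner (r \Po aff)) \_ (cell l j))); last first.
  move=> x _; rewrite patchE indicE horner_comp affE; case: ifPn => _; by rewrite ?mul1r ?mul0r.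
rewrite -Rintegral_mkcondr (_ : _ `&` _ = cell l j); last first.
  by apply/setIidr => x /(cell_unit jl); rewrite /= in_itv.
rewrite cellE Rintegral_itv_bndo_bndc; last first.
  apply: (@integrableS _ _ _ mu `[0%R, 1%R[%classic) => //.
    by rewrite -cellE => x /(cell_unit jl); rewrite /= in_itv.
  by apply: bounded_mfun_integrable; bounded.
rewrite -dS Rintegral_deriv_poly// poly_intE /S !hornerZ !horner_comp !affE.
rewrite -mulrBr; congr (_ * (_.[_] - _.[_])); rewrite mulrC mulfVK// ?subrr//.
by rewrite -natr1 addrAC subrr add0r.
Qed.

(** A multiwavelet scaling function: the a.2-th orthonormal polynomial transplanted to the cell a.1.
    With base 4 the factor normalizing it in L^2 is the integer power [2 ^+ l]. *)
Definition loc l (a : idx l) x : R :=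
  \1_(cell l a.1) x * (2 ^+ l * (Q a.2).[4 ^+ l * x - a.1%:R]).

Lemma measurable_loc l (a : idx l) :
  @measurable_fun _ _ (measurableTypeR R) R setT (@loc l a).
Proof.
apply: measurable_funM; first by apply: measurable_indic; exact: measurable_cell.
apply: measurable_funM => //.
pose aff : {poly R} := 4 ^+ l *: 'X - (a.1%:R)%:P.
have -> : (fun x => (Q a.2).[4 ^+ l * x - a.1%:R]) = horner (Q a.2 \Po aff).
  by apply/funext => x; rewrite horner_comp !hornerE.
exact: measurable_horner_borel.
Qed.

Lemma loc_out l (a : idx l) x : ~ cell l a.1 x -> @loc l a x = 0.
Proof. by move=> h; rewrite /loc indicE memNset// mul0r. Qed.

Lemma loc_in l (a : idx l) x : cell l a.1 x ->
  @loc l a x = 2 ^+ l * (Q a.2).[4 ^+ l * x - a.1%:R].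
Proof. by move=> h; rewrite /loc indicE mem_set// mul1r. Qed.

Lemma B_ge0 : 0 <= B.
Proof. by apply: le_trans (Q_le (ltn0Sn k) (_ : 0 <= 0 < 1)); rewrite ?lexx ?ltr01. Qed.

Lemma normr_loc_le_indic l (a : idx l) x :
  `|@loc l a x| <= 2 ^+ l * B * \1_(cell l a.1) x.
Proof.
have [h|h] := pselect (cell l a.1 x); last first.
  by rewrite loc_out// normr0 mulr_ge0 ?indicE// mulr_ge0 ?B_ge0// exprn_ge0.
rewrite loc_in// normrM ger0_norm ?exprn_ge0// indicE mem_set// mulr1.
rewrite ler_pM2l ?exprn_gt0// Q_le//; move: h => /andP[h1 h2].
by rewrite subr_ge0 h1/= ltrBlDr addrC natr1.
Qed.

Lemma normr_loc_le l (a : idx l) x : `|@loc l a x| <= 2 ^+ l * B.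
Proof.
apply: le_trans (normr_loc_le_indic a x) _.
rewrite ler_piMr ?mulr_ge0 ?B_ge0 ?exprn_ge0// indicE.
Qed.

Lemma bounded_loc l (a : idx l) : bounded_mfun (@loc l a).
Proof.
split; first by apply: measurable_funTS; exact: measurable_loc.
by exists (2 ^+ l * B) => x _; exact: normr_loc_le.
Qed.
Hint Resolve bounded_loc : core.

Lemma Int_cell l j : (j < 4 ^ l)%N -> Int mu (\1_(cell l j)) = 4 ^- l.
Proof.
move=> jl; have := Int_cell_poly 1 jl.
have -> : poly_int (1 : {poly R}) = 1.
  rewrite -(Int_lebesgue_cst 1); apply: eq_Int => x _; exact: hornerC.
rewrite mulr1 => <-; apply: eq_Int => x _.
by rewrite [(1 : {poly R}).[_]]hornerC mulr1.
Qed.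

Lemma two_four l : (2 : R) ^+ l * 2 ^+ l = 4 ^+ l.
Proof. by rewrite -exprMn; congr (_ ^+ _); ring. Qed.

Lemma Int_normr_loc_le l (a : idx l) : Int mu (fun x => `|@loc l a x|) <= 2 ^- l * B.
Proof.
apply: (@le_trans _ _ (Int mu (fun x => 2 ^+ l * B * \1_(cell l a.1) x))).
  have := bounded_loc a; have := bounded_mfun_indic (measurable_cell l a.1) => h1 h2.
  by apply: le_Int; bounded => x _; exact: normr_loc_le_indic.
have h1 := bounded_mfun_indic (measurable_cell l a.1).
rewrite IntZ//; last exact: lebesgue_measure_unit_fin.
rewrite Int_cell// -two_four invfM.
rewrite [leLHS](_ : _ = 2 ^- l * B)//; field; exact: expf_neq0.
Qed.

Lemma loc_orthonormal l (a b : idx l) :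
  Int mu (fun x => @loc l a x * @loc l b x) = (a == b)%:R.
Proof.
case: a b => [a i] [b j]; rewrite xpair_eqE.
have [<-|ab] := eqVneq a b; last first.
  rewrite (@eq_Int _ _ _ (fun=> 0)) ?Int_lebesgue_cst// => x _.
  have [h|h] := pselect (cell l a x); last by rewrite loc_out// mul0r.
  rewrite [X in _ * X]loc_out ?mulr0// => h'; move/eqP: ab; apply.
  exact/val_inj/(cell_inj h h').
rewrite (@eq_Int _ _ _ (fun x => \1_(cell l a) x *
    (4 ^+ l *: (Q i * Q j)).[4 ^+ l * x - a%:R])).
  rewrite Int_cell_poly// poly_intZ Q_orth// mulKf// gt_eqF// exprn_gt0//.
move=> x _; rewrite /loc/= hornerZ hornerM -two_four indicE.
by case: (x \in _); rewrite ?mul0r// !mul1r; ring.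
Qed.

Definition coef l g (a : idx l) : R := Int mu (fun x => g x * @loc l a x).

Definition proj l g x : R := \sum_a coef g a * @loc l a x.

Lemma coefB l g u (a : idx l) : bounded_mfun g -> bounded_mfun u ->
  @coef l (fun x => g x - u x) a = coef g a - coef u a.
Proof.
move=> hg hu; have hl := bounded_loc a; rewrite /coef -IntB; bounded.
by apply: eq_Int => x _; rewrite mulrBl.
Qed.

Lemma bounded_proj l g : bounded_mfun (proj l g).
Proof.
apply: bounded_mfun_sum => a _; have hl := bounded_loc a; bounded.
Qed.
Hint Resolve bounded_proj : core.

Lemma projB l g u x : bounded_mfun g -> bounded_mfun u ->
  proj l (fun x => g x - u x) x = proj l g x - proj l u x.
Proof.
move=> hg hu; rewrite /proj -sumrB; apply: eq_bigr => a _.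
by rewrite coefB// mulrBl.
Qed.

Lemma proj_cell l g x (j : 'I_(4 ^ l)) : cell l j x ->
  proj l g x = \sum_(i < k.+1) coef g (j, i) * @loc l (j, i) x.
Proof.
move=> xj; rewrite /proj (eq_bigr (fun a => coef g (a.1, a.2) * @loc l (a.1, a.2) x)); last by case.
rewrite -(pair_bigA _ (fun (j : 'I_(4 ^ l)) (i : 'I_k.+1) => coef g (j, i) * @loc l (j, i) x))/=.
rewrite (bigD1 j)//= [X in _ + X]big1 ?addr0// => j' jj'.
rewrite big1// => i _; rewrite loc_out ?mulr0//= => h.
by move/eqP: jj'; apply; apply/val_inj/(cell_inj h xj).
Qed.

(** In the local coordinate of the cell of [x], [p] is again a polynomial [r] of size at most k + 1,
    which [Q_repr] expands. *)
Lemma proj_poly l (p : {poly R}) x : (size p <= k.+1)%N -> 0 <= x < 1 ->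
  proj l (horner p) x = p.[x].
Proof.
move=> pk x01; have [j0 jl xj] := cell_exists l x01; pose j := Ordinal jl.
have c0 : 4 ^+ l != 0 :> R by rewrite gt_eqF// exprn_gt0.
pose r := p \Po ((4 ^- l) *: ('X + (j%:R)%:P)).
have rs : (size r <= k.+1)%N.
  rewrite (leq_trans (size_comp_poly_leq _ _))// ltnS.
  have : (size (4 ^- l *: ('X + (j%:R)%:P) : {poly R})%R <= 2)%N.
    by rewrite (leq_trans (size_scale_leq _ _))// size_XaddC.
  case: (size _) => [|[|[|//]]] _; rewrite ?muln0 ?muln1//.
  by move: pk; case: (size p).
have rE y : r.[4 ^+ l * y - j%:R] = p.[y].
  by rewrite horner_comp !hornerE subrK mulKf.
have coefE i : @coef l (horner p) (j, i) = 2 ^- l * poly_int (r * Q i).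
  rewrite /coef (@eq_Int _ _ _ (fun x => \1_(cell l j) x *
    (2 ^+ l *: (r * Q i)).[4 ^+ l * x - j%:R])); last first.
    move=> y _; rewrite hornerZ hornerM rE /loc/=; ring.
  rewrite Int_cell_poly// poly_intZ -two_four; field; exact: expf_neq0.
rewrite (@proj_cell _ _ _ j)// -rE [in RHS](Q_repr rs) horner_sum.
apply: eq_bigr => i _; rewrite coefE loc_in// hornerZ/=; field.
exact: expf_neq0.
Qed.

(** Bounds the norm of identity minus [proj] on each cell in the supremum norm: k + 1 terms, each
    with a coefficient at most 2^-l B and a basis function at most 2^l B. *)
Definition proj_const : R := 1 + k.+1%:R * (B * B).

Lemma proj_const_ge0 : 0 <= proj_const.
Proof. by rewrite addr_ge0// mulr_ge0// mulr_ge0 ?B_ge0. Qed.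

Lemma coef_le l g (j : 'I_(4 ^ l)) i del : bounded_mfun g -> 0 <= del ->
  (forall x, cell l j x -> `|g x| <= del) ->
  `|@coef l g (j, i)| <= del * (2 ^- l * B).
Proof.
move=> hg d0 gd; have hl := bounded_loc (j, i).
rewrite /coef; have hI : `|Int mu (fun x => g x * @loc l (j, i) x)| <= Int mu (fun x => `|g x * @loc l (j, i) x|).
  by apply: le_normr_Int; bounded.
apply: (le_trans hI).
apply: (@le_trans _ _ (Int mu (fun x => del * `|@loc l (j, i) x|))).
  apply: le_Int; bounded => x _; rewrite normrM.
  have [h|h] := pselect (cell l j x); first by rewrite ler_wpM2r// gd.
  by rewrite loc_out// normr0 !mulr0.
rewrite IntZ; bounded.
by rewrite ler_wpM2l// Int_normr_loc_le.
Qed.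

(** Since [proj] fixes [p], the error for [g] is the error for g - p, where the supremum bound on
    the cell applies. *)
Lemma proj_dev_le l g (p : {poly R}) (j : 'I_(4 ^ l)) del :
  bounded_mfun g -> (size p <= k.+1)%N -> 0 <= del ->
  (forall x, cell l j x -> `|g x - p.[x]| <= del) ->
  forall x, cell l j x -> `|g x - proj l g x| <= proj_const * del.
Proof.
move=> hg pk d0 gp x xj; have x01 := cell_unit (ltn_ord j) xj.
have -> : g x - proj l g x = (g x - p.[x]) - proj l (fun x => g x - p.[x]) x.
  rewrite projB//; last by bounded.
  by rewrite (proj_poly _ pk)//; ring.
apply: le_trans (ler_normB _ _) _; rewrite /proj_const mulrDl mul1r lerD ?gp//.
rewrite (proj_cell _ xj) (le_trans (ler_norm_sum _ _ _))//.
apply: (@le_trans _ _ (\sum_(i < k.+1) (B * B * del))); last first.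
  by rewrite sumr_const card_ord -(mulr_natl (B * B * del)) !mulrA.
apply: ler_sum => i _; rewrite normrM.
apply: (@le_trans _ _ ((del * (2 ^- l * B)) * (2 ^+ l * B))).
  apply: ler_pM => //; last exact: normr_loc_le.
  by apply: coef_le => //; bounded.
by rewrite [leLHS](_ : _ = B * B * del)//; field; exact: expf_neq0.
Qed.

(** On a cell of level l + 1, contained in one of level l, [proj l g] is a polynomial of size at
    most k + 1; [proj_dev_le] with error zero concludes. *)
Lemma proj_proj l g x : 0 <= x < 1 -> proj l.+1 (proj l g) x = proj l g x.
Proof.
move=> x01; have [j0 jl xj0] := cell_exists l.+1 x01; pose j := Ordinal jl.
have xj : cell l.+1 j x by [].
have j4l : (j %/ 4 < 4 ^ l)%N by rewrite ltn_divLR// -expnSr.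
pose j4 := Ordinal j4l.
pose p : {poly R} := \sum_(i < k.+1) (@coef l g (j4, i) * 2 ^+ l) *:
  (Q i \Po (4 ^+ l *: 'X - (j4%:R)%:P)).
have pk : (size p <= k.+1)%N.
  apply: (leq_trans (size_sum _ _ _)); apply/bigmax_leqP => i _.
  rewrite (leq_trans (size_scale_leq _ _))//.
  rewrite (leq_trans (size_comp_poly_leq _ _))// ltnS.
  have : (size (4 ^+ l *: 'X - (j4%:R)%:P : {poly R})%R <= 2)%N.
    rewrite (leq_trans (size_polyD _ _))// geq_max size_polyN.
    rewrite (leq_trans (size_scale_leq _ _)) ?size_polyX//.
    by rewrite (leq_trans (size_polyC_leq1 _)).
  have := size_Q (ltn_ord i).
  case: (size _) => [|s]; first by rewrite mul0n.
  case: (size _) => [|[|[|//]]]; rewrite ?muln0 ?muln1//.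
have h y : cell l.+1 j y -> `|proj l g y - p.[y]| <= 0.
  move=> yj; rewrite (@proj_cell _ _ _ j4); last exact: cell_parent.
  rewrite /p horner_sum -sumrB big1 ?normr0// => i _.
  rewrite loc_in; last exact: cell_parent.
  by rewrite hornerZ horner_comp hornerD hornerN hornerC hornerZ hornerX mulrA subrr.
have := proj_dev_le (bounded_proj _ _) pk (lexx 0) h xj.
by rewrite mulr0 normr_le0 subr_eq0 => /eqP.
Qed.

Lemma Int_sqr_sub_proj l g : bounded_mfun g ->
  Int mu (fun x => (g x - proj l g x) ^+ 2) =
  Int mu (fun x => g x ^+ 2) - \sum_a @coef l g a ^+ 2.
Proof.
move=> hg; have hp := bounded_proj l g.
have gp : Int mu (fun x => g x * proj l g x) = \sum_a @coef l g a ^+ 2.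
  rewrite (@eq_Int _ _ _ (fun x => \sum_a coef g a * (g x * @loc l a x))); last first.
    by move=> x _; rewrite mulr_sumr; apply: eq_bigr => a _; ring.
  rewrite Int_sum; last 2 first.
    exact: lebesgue_measure_unit_fin.
    by move=> a _; have hl := bounded_loc a; bounded.
  apply: eq_bigr => a _; have hl := bounded_loc a.
  by rewrite IntZ ?expr2//; bounded.
have pp : Int mu (fun x => proj l g x * proj l g x) = \sum_a @coef l g a ^+ 2.
  rewrite (@eq_Int _ _ _ (fun x => \sum_a coef g a * (proj l g x * @loc l a x))); last first.
    by move=> x _; rewrite {2}/proj mulr_sumr; apply: eq_bigr => a _; ring.
  rewrite Int_sum; last 2 first.
    exact: lebesgue_measure_unit_fin.
    by move=> a _; have hl := bounded_loc a; bounded.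
  apply: eq_bigr => a _; have hl := bounded_loc a.
  rewrite IntZ; bounded; rewrite expr2; congr (_ * _).
  rewrite (@eq_Int _ _ _ (fun x => \sum_b coef g b * (@loc l b x * @loc l a x))); last first.
    by move=> x _; rewrite mulr_suml; apply: eq_bigr => b _; rewrite mulrA.
  rewrite Int_sum; last 2 first.
    exact: lebesgue_measure_unit_fin.
    by move=> b _; have hb := bounded_loc b; bounded.
  rewrite (bigD1 a)//= big1 ?addr0.
    by rewrite IntZ ?loc_orthonormal ?eqxx ?mulr1//; bounded.
  move=> b ba; have hb := bounded_loc b.
  by rewrite IntZ ?loc_orthonormal ?(negbTE ba) ?mulr0//; bounded.
rewrite (@eq_Int _ _ _ (fun x => g x ^+ 2 - (2 * (g x * proj l g x) -
  proj l g x * proj l g x))); last by move=> x _; ring.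
rewrite IntB; bounded; rewrite IntB; bounded; rewrite IntZ; bounded.
by rewrite gp pp; ring.
Qed.

Lemma bessel l g : bounded_mfun g ->
  \sum_a @coef l g a ^+ 2 <= Int mu (fun x => g x ^+ 2).
Proof.
move=> hg; rewrite -subr_ge0 -Int_sqr_sub_proj//.
by apply: Int_ge0 => x _; exact: sqr_ge0.
Qed.

Lemma Int_sqr_sub_proj_le l g : bounded_mfun g ->
  Int mu (fun x => (g x - proj l g x) ^+ 2) <= Int mu (fun x => g x ^+ 2).
Proof.
move=> hg; rewrite Int_sqr_sub_proj// gerBl.
by apply: sumr_ge0 => a _; exact: sqr_ge0.
Qed.

(** * The empirical process along the multiscale expansion *)

Variable P : probability (measurableTypeR R) R.
Hypothesis P01 : P `[0%R, 1%R[%classic = 1%E.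
Variables (n : nat) (x : nat -> R).
Hypothesis n0 : (0 < n)%N.
Hypothesis x01 : forall i, (i < n)%N -> 0 <= x i < 1.
Notation G := (emp_dev P n x).

Let Pfin : (P `[0%R, 1%R[%classic < +oo)%E.
Proof. exact: unit_interval_prob_fin. Qed.

Lemma emp_dev_sum (J : finType) (c : J -> R) (f : J -> R -> R) :
  (forall j : J, bounded_mfun (f j)) ->
  G (fun y => \sum_(j : J) c j * f j y) = \sum_(j : J) c j * G (f j).
Proof.
move=> hf; rewrite /emp_dev Int_sum//; last by move=> j _; have := hf j => ?; bounded.
rewrite exchange_big/= mulr_sumr -sumrB; apply: eq_bigr => j _.
by rewrite -mulr_sumr IntZ//; ring.
Qed.

Lemma emp_devB f h : bounded_mfun f -> bounded_mfun h ->
  G (fun y => f y - h y) = G f - G h.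
Proof. by move=> hf hh; rewrite /emp_dev IntB// sumrB; ring. Qed.

Lemma eq_emp_dev f h : (forall y, 0 <= y < 1 -> f y = h y) -> G f = G h.
Proof.
move=> fh; rewrite /emp_dev (@eq_Int _ _ f h)//; congr (_ * _ - _).
by apply: eq_bigr => i _; rewrite fh// x01.
Qed.

(** The sum of the empirical and true masses, not their difference: beyond the finest level the two
    integrals are bounded separately, without cancellation. *)
Definition cell_mass l j : R :=
  n%:R^-1 * (\sum_(i < n) \1_(cell l j) (x i)) + Int P (\1_(cell l j)).

Lemma normr_emp_dev_le_cells l u (c : nat -> R) : bounded_mfun u ->
  (forall j y, (j < 4 ^ l)%N -> cell l j y -> `|u y| <= c j) ->
  `|G u| <= \sum_(j < 4 ^ l) c j * cell_mass l j.
Proof.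
move=> hu uc.
have hc y : 0 <= y < 1 -> `|u y| <= \sum_(j < 4 ^ l) c j * \1_(cell l j) y.
  move=> y01; have [j jl yj] := cell_exists l y01.
  rewrite (bigD1 (Ordinal jl))//= big1 ?addr0.
    by rewrite indicE mem_set// mulr1 uc.
  move=> i ij; rewrite indicE memNset ?mulr0// => yi.
  by move/eqP: ij; apply; apply/val_inj/(cell_inj yi yj).
have hi j := bounded_mfun_indic (measurable_cell l j).
apply: le_trans (ler_normB _ _) _.
rewrite /cell_mass (eq_bigr (fun j : 'I_(4 ^ l) => n%:R^-1 * \sum_(i < n) c j * \1_(cell l j) (x i) +
   c j * Int P (\1_(cell l j)))); last first.
  by move=> j _; rewrite -mulr_sumr; ring.
rewrite big_split/=; apply: lerD.
  rewrite -mulr_sumr exchange_big/= normrM ger0_norm ?invr_ge0//.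
  rewrite ler_wpM2l ?invr_ge0// (le_trans (ler_norm_sum _ _ _))//.
  by apply: ler_sum => i _; rewrite hc// x01.
have h : `|Int P u| <= Int P (fun y => `|u y|) by apply: le_normr_Int.
apply: (le_trans h).
apply: (@le_trans _ _ (Int P (fun y => \sum_(j < 4 ^ l) c j * \1_(cell l j) y))).
  apply: le_Int => //; first by bounded.
  by apply: bounded_mfun_sum => j _; have := hi j => ?; bounded.
rewrite Int_sum//; last by move=> j _; have := hi j => ?; bounded.
by apply: ler_sum => j _; rewrite IntZ.
Qed.

(** How bounded variation of the k-th derivative enters. The local errors are bounded in sum over
    the cells rather than uniformly, which yields l^1 control of the coefficients with the same [V]
    at all levels. *)
Definition piecewise_poly_approx g (V : R) := forall l, exists nu : nat -> R,
  [/\ forall j, 0 <= nu j, \sum_(j < 4 ^ l) nu j <= V &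
    forall j, (j < 4 ^ l)%N -> exists2 p : {poly R}, (size p <= k.+1)%N &
      forall y, cell l j y -> `|g y - p.[y]| <= (4 ^- l) ^+ k * nu j].

Lemma young_le (b z e : R) : 0 < e -> `|b * z| <= e * b ^+ 2 + z ^+ 2 / (4 * e).
Proof.
move=> e0; rewrite -subr_ge0.
have -> : e * b ^+ 2 + z ^+ 2 / (4 * e) - `|b * z| =
    e * (`|b| - `|z| / (2 * e)) ^+ 2.
  rewrite normrM -(real_normK (num_real b)) -(real_normK (num_real z)).
  by field; rewrite gt_eqF.
by rewrite mulr_ge0 ?sqr_ge0// ltW.
Qed.

(* Truncating [z] at level [t] and bounding the excess by its cube. *)
Lemma truncated_young_le (b z t e : R) : 0 < t -> 0 < e ->
  `|b * z| <= t * `|b| + e * b ^+ 2 + z ^+ 6 / (4 * e * t ^+ 4).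
Proof.
move=> t0 e0.
have hz : `|z| <= t + `|z| ^+ 3 / t ^+ 2.
  have [zt|tz] := leP `|z| t.
    by rewrite (le_trans zt)// lerDl divr_ge0// ?exprn_ge0// ltW.
  apply: (@le_trans _ _ (`|z| ^+ 3 / t ^+ 2)); last by rewrite lerDr ltW.
  rewrite ler_pdivlMr ?exprn_gt0// [leRHS]exprS ler_wpM2l//.
  by rewrite ler_pXn2r ?nnegrE// ltW.
have := young_le b (`|z| ^+ 3 / t ^+ 2) e0.
have -> : (`|z| ^+ 3 / t ^+ 2) ^+ 2 / (4 * e) = z ^+ 6 / (4 * e * t ^+ 4).
  have -> : z ^+ 6 = (`|z| ^+ 2) ^+ 3 by rewrite real_normK ?num_real// -exprM.
  by field; rewrite !gt_eqF.
rewrite [X in X <= _]normrM [X in _ * X <= _]ger0_norm; last first.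
  by rewrite divr_ge0 ?exprn_ge0// ltW.
move=> h; rewrite normrM.
have := ler_wpM2l (normr_ge0 b) hz; lra.
Qed.

Lemma sum_parent (N : nat) (F : nat -> R) :
  \sum_(j < N * 4) F (j %/ 4)%N = 4 * \sum_(j < N) F j.
Proof.
elim: N => [|N ih]; first by rewrite mul0n !big_ord0 mulr0.
rewrite [in RHS]big_ord_recr/= mulrDr -ih mulSnr.
have -> : (N * 4 + 4 = (N * 4).+4)%N by rewrite addnC.
rewrite !big_ord_recr/= -!addrA; congr (_ + _).
have d i : (i < 4)%N -> ((N * 4 + i) %/ 4 = N)%N.
  by move=> i4; rewrite divnMDl// divn_small// addn0.
have -> : ((N * 4) %/ 4 = N)%N by rewrite -[(N * 4)%N]addn0 d.
have -> : ((N * 4).+1 %/ 4 = N)%N by rewrite -addn1 d.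
have -> : ((N * 4).+2 %/ 4 = N)%N by rewrite -addn2 d.
have -> : ((N * 4).+3 %/ 4 = N)%N by rewrite -addn3 d.
by ring.
Qed.

Lemma proj_emp_dev l g : G (proj l g) = \sum_a coef g a * G (@loc l a).
Proof. by rewrite -emp_dev_sum//; exact: bounded_loc. Qed.

(** The factor 2 is 4 / 2: four children for each parent cell, and 2^-(l+1) where the bound is
    stated with 2^-l. *)
Definition detail_const : R := 2 * k.+1%:R * proj_const * B.

Lemma detail_const_ge0 : 0 <= detail_const.
Proof. by rewrite /detail_const mulr_ge0 ?B_ge0// mulr_ge0 ?proj_const_ge0// mulr_ge0. Qed.

Lemma inv_exp4_ge0 l j : 0 <= (4 ^- l) ^+ j :> R.
Proof. by rewrite exprn_ge0// invr_ge0 exprn_ge0. Qed.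

Lemma inv_exp2_ge0 l : 0 <= 2 ^- l :> R.
Proof. by rewrite invr_ge0 exprn_ge0. Qed.

(** The coefficients [b] are small in l^1 by polynomial approximation on the parent cells and
    bounded in l^2 by Bessel; [truncated_young_le] spends the first bound on the truncated noise and
    the second on the excess. *)
Lemma detail_le l g V t e : bounded_mfun g -> piecewise_poly_approx g V ->
  0 < t -> 0 < e ->
  `|G (proj l.+1 g) - G (proj l g)| <=
    t * (detail_const * (2 ^- l * (4 ^- l) ^+ k) * V) +
    e * Int mu (fun y => g y ^+ 2) +
    (\sum_a G (@loc l.+1 a) ^+ 6) / (4 * e * t ^+ 4).
Proof.
move=> hg hV t0 e0; have hp := bounded_proj l g; have hp1 := bounded_proj l.+1 g.
pose u y := g y - proj l g y; have hu : bounded_mfun u by rewrite /u; bounded.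
pose b := @coef l.+1 u.
(* The finer projection leaves [proj l g] unchanged, so the increment is the finer projection of
   [u]. *)
have -> : G (proj l.+1 g) - G (proj l g) = \sum_a b a * G (@loc l.+1 a).
  rewrite -emp_devB// -proj_emp_dev; apply: eq_emp_dev => y y01.
  by rewrite projB// proj_proj.
apply: le_trans (ler_norm_sum _ _ _) _.
have [nu [nu0 nuV nup]] := hV l.
have b1 : \sum_a `|b a| <= detail_const * (2 ^- l * (4 ^- l) ^+ k) * V.
  pose c := proj_const * (4 ^- l) ^+ k * (2 ^- l.+1 * B).
  have c0 : 0 <= c.
    by rewrite /c !mulr_ge0 ?proj_const_ge0 ?B_ge0 ?exprn_ge0 ?invr_ge0 ?exprn_ge0.
  have ba (a : idx l.+1) : `|b a| <= c * nu (a.1 %/ 4)%N.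
    case: a => j i /=.
    have j4l : (j %/ 4 < 4 ^ l)%N by rewrite ltn_divLR// -expnSr.
    have [p pk pg] := nup _ j4l.
    have d0 : 0 <= (4 ^- l) ^+ k * nu (j %/ 4)%N.
      by rewrite mulr_ge0 ?exprn_ge0 ?invr_ge0 ?exprn_ge0.
    have h y : cell l.+1 j y -> `|u y| <= proj_const * ((4 ^- l) ^+ k * nu (j %/ 4)%N).
      move=> /cell_parent yj.
      exact: (@proj_dev_le l g p (Ordinal j4l) _ hg pk d0 pg).
    have := coef_le i hu (mulr_ge0 proj_const_ge0 d0) h.
    by rewrite /c; congr (_ <= _); ring.
  apply: (@le_trans _ _ (\sum_(a : idx l.+1) c * nu (a.1 %/ 4)%N)).
    by apply: ler_sum => a _; exact: ba.
  rewrite -mulr_sumr -(pair_bigA _ (fun (j : 'I_(4 ^ l.+1)) (i : 'I_k.+1) => nu (j %/ 4)%N))/=.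
  under eq_bigr do rewrite sumr_const card_ord.
  rewrite sumrMnl -[_ *+ k.+1]mulr_natl.
  have -> : \sum_(j < 4 ^ l.+1) nu (j %/ 4)%N = 4 * \sum_(j < 4 ^ l) nu j.
    by rewrite expnSr sum_parent.
  have -> : c * (k.+1%:R * (4 * \sum_(j < 4 ^ l) nu j)) =
      detail_const * (2 ^- l * (4 ^- l) ^+ k) * \sum_(j < 4 ^ l) nu j.
    by rewrite /c /detail_const exprS; field; rewrite !expf_neq0.
  by rewrite ler_wpM2l// mulr_ge0 ?detail_const_ge0// mulr_ge0 ?inv_exp4_ge0 ?inv_exp2_ge0.
have b2 : \sum_a b a ^+ 2 <= Int mu (fun y => g y ^+ 2).
  exact: le_trans (bessel _ hu) (Int_sqr_sub_proj_le _ hg).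
apply: (@le_trans _ _ (\sum_a (t * `|b a| + e * b a ^+ 2 +
    G (@loc l.+1 a) ^+ 6 / (4 * e * t ^+ 4)))).
  by apply: ler_sum => a _; exact: truncated_young_le.
rewrite !big_split/= -!mulr_sumr -mulr_suml.
by rewrite !lerD// ler_wpM2l// ltW.
Qed.

Lemma geometric_sum_le (q : R) m : 0 <= q -> q < 1 ->
  \sum_(r < m) q ^+ r <= (1 - q)^-1.
Proof.
move=> q0 q1; rewrite -div1r ler_pdivlMr ?subr_gt0//.
have -> : (\sum_(r < m) q ^+ r) * (1 - q) = 1 - q ^+ m.
  elim: m => [|m ih]; first by rewrite big_ord0 mul0r expr0 subrr.
  by rewrite big_ord_recr/= mulrDl ih exprS; ring.
by rewrite gerBl exprn_ge0.
Qed.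

(** The factor n^2 makes sixth powers, of mean O(n^-3), comparable with squares, of mean O(n^-1). *)
Definition coefficient_noise l0 m : R :=
  \sum_a G (@loc l0 a) ^+ 2 +
  \sum_(r < m) (2 / 9) ^+ r * (n%:R ^+ 2 * \sum_a G (@loc (l0 + r).+1 a) ^+ 6).

(* The level [l0 + r] is truncated at [t = (3/2) ^ r / sqrt n] with Young weight
   [e * (8/9) ^ r].  The truncated parts then sum as [(3/4) ^ r], since the
   coefficients have total size [2 ^- r], and the [4 ^ r] sixth powers are weighted
   by [(8/9) ^- r * (3/2) ^- (4 * r) = (2/9) ^ r], which is summable as [2/9 < 1/4]. *)
Lemma emp_dev_le l0 m g V e W : bounded_mfun g -> piecewise_poly_approx g V ->
  0 < e -> 0 <= V ->
  (forall j, (j < 4 ^ (l0 + m))%N -> cell_mass (l0 + m) j <= W) ->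
  `|G g| <= 10 * e * Int mu (fun y => g y ^+ 2) + coefficient_noise l0 m / (4 * e) +
    4 * detail_const * (Num.sqrt n%:R)^-1 * (2 ^- l0 * (4 ^- l0) ^+ k) * V +
    proj_const * (4 ^- (l0 + m)) ^+ k * V * W.
Proof.
move=> hg hV e0 V0 hW; pose s : R := Num.sqrt n%:R.
have s0 : 0 < s by rewrite sqrtr_gt0 ltr0n.
have s2 : s ^+ 2 = n%:R by rewrite sqr_sqrtr.
set I := Int mu _; set c := 2 ^- l0 * (4 ^- l0) ^+ k.
have I0 : 0 <= I by apply: Int_ge0 => y _; exact: sqr_ge0.
have c0 : 0 <= c by rewrite mulr_ge0 ?inv_exp4_ge0 ?inv_exp2_ge0.
have D0 := detail_const_ge0.
have coarse : `|G (proj l0 g)| <= e * I + (\sum_a G (@loc l0 a) ^+ 2) / (4 * e).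
  rewrite proj_emp_dev; apply: le_trans (ler_norm_sum _ _ _) _.
  apply: (@le_trans _ _ (\sum_a (e * coef g a ^+ 2 + G (@loc l0 a) ^+ 2 / (4 * e)))).
    by apply: ler_sum => a _; exact: young_le.
  by rewrite big_split/= -mulr_sumr -mulr_suml lerD2r ler_wpM2l ?bessel// ltW.
have detail r : `|G (proj (l0 + r).+1 g) - G (proj (l0 + r) g)| <=
    (3 / 4) ^+ r * (detail_const * s^-1 * c * V) + (8 / 9) ^+ r * (e * I) +
    (2 / 9) ^+ r * (n%:R ^+ 2 * \sum_a G (@loc (l0 + r).+1 a) ^+ 6) / (4 * e).
  have q0 : 0 < s^-1 * (3 / 2) ^+ r by rewrite mulr_gt0 ?invr_gt0 ?exprn_gt0//; lra.
  have e1 : 0 < e * (8 / 9) ^+ r by rewrite mulr_gt0// exprn_gt0//; lra.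
  have := detail_le (l0 + r) hg hV q0 e1.
  move=> /le_trans; apply; apply: lerD; first apply: lerD.
  - have h4 : (4 ^- (l0 + r)) ^+ k <= (4 ^- l0) ^+ k :> R.
      rewrite lerXn2r ?nnegrE ?invr_ge0 ?exprn_ge0// lef_pV2 ?posrE ?exprn_gt0//.
      by rewrite ler_weXn2l ?leq_addr//; lra.
    have -> : (3 / 4) ^+ r * (detail_const * s^-1 * c * V) =
        s^-1 * (3 / 2) ^+ r * (detail_const * (2 ^- (l0 + r) * (4 ^- l0) ^+ k) * V).
      rewrite /c exprD.
      have -> : (3 / 4 : R) ^+ r = (3 / 2) ^+ r * 2 ^- r.
        by rewrite -exprVn -exprMn; congr (_ ^+ _); by field.
      by field; rewrite !expf_neq0 ?gt_eqF.
    by rewrite (ler_wpM2l (ltW q0))// ler_wpM2r// ler_wpM2l// ler_wpM2l// inv_exp2_ge0.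
  - by rewrite -/I mulrC mulrA mulrC [_ * e]mulrC.
  - set S := \sum_a _.
    have -> : 4 * (e * (8 / 9) ^+ r) * (s^-1 * (3 / 2) ^+ r) ^+ 4 =
        (4 * e) * (n%:R ^+ 2)^-1 * (2 / 9) ^- r.
      have -> : (2 / 9 : R) ^- r = (8 / 9) ^+ r * ((3 / 2) ^+ r) ^+ 4.
        rewrite -exprM mulnC exprM -exprMn -exprVn; congr (_ ^+ _); by field.
      by rewrite exprMn -s2; field; rewrite gt_eqF.
    have nn0 : n%:R != 0 :> R by rewrite -s2 expf_neq0// gt_eqF.
    have r0 : (2 / 9 : R) ^+ r != 0 by rewrite expf_neq0// mulf_neq0 ?invr_eq0 ?pnatr_eq0.
    rewrite [leLHS](_ : _ = (2 / 9) ^+ r * (n%:R ^+ 2 * S) / (4 * e))//.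
    by field; rewrite nn0 r0 gt_eqF.
have tele : `|G (proj (l0 + m) g)| <= `|G (proj l0 g)| +
    \sum_(r < m) ((3 / 4) ^+ r * (detail_const * s^-1 * c * V) + (8 / 9) ^+ r * (e * I) +
    (2 / 9) ^+ r * (n%:R ^+ 2 * \sum_a G (@loc (l0 + r).+1 a) ^+ 6) / (4 * e)).
  elim: {hW} m => [|m ih]; first by rewrite addn0 big_ord0 addr0.
  rewrite big_ord_recr/= addrA addnS.
  rewrite -[G (proj (l0 + m).+1 g)](subrK (G (proj (l0 + m) g))) addrC.
  by rewrite (le_trans (ler_normD _ _))// lerD.
have fine : `|G (fun y => g y - proj (l0 + m) g y)| <=
    proj_const * (4 ^- (l0 + m)) ^+ k * V * W.
  have [nu [nu0 nuV nup]] := hV (l0 + m)%N.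
  have hp := bounded_proj (l0 + m) g.
  have W0 : 0 <= W.
    have pos : (0 < 4 ^ (l0 + m))%N by rewrite expn_gt0.
    apply: le_trans (hW 0%N pos); rewrite /cell_mass addr_ge0//.
      by rewrite mulr_ge0 ?invr_ge0// sumr_ge0// => i _; rewrite indicE.
    by apply: Int_ge0 => y _; rewrite indicE.
  set h := (4 ^- (l0 + m)) ^+ k.
  have h0 : 0 <= h by exact: inv_exp4_ge0.
  have hu : bounded_mfun (fun y => g y - proj (l0 + m) g y) by bounded.
  have := @normr_emp_dev_le_cells (l0 + m) _ (fun j => proj_const * (h * nu j)) hu.
  have cl j y : (j < 4 ^ (l0 + m))%N -> cell (l0 + m) j y ->
      `|g y - proj (l0 + m) g y| <= proj_const * (h * nu j).
    move=> jl; have [p pk pg] := nup _ jl.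
    exact: (@proj_dev_le _ g p (Ordinal jl) _ hg pk (mulr_ge0 h0 (nu0 j)) pg).
  move=> /(_ cl) /le_trans; apply.
  apply: (@le_trans _ _ (\sum_(j < 4 ^ (l0 + m)) proj_const * (h * nu j) * W)).
    apply: ler_sum => j _; rewrite ler_wpM2l ?hW//.
    by rewrite mulr_ge0 ?proj_const_ge0// mulr_ge0.
  rewrite -mulr_suml -!mulr_sumr mulrA ler_wpM2r// ler_wpM2l//.
  by rewrite mulr_ge0 ?proj_const_ge0.
move: fine; rewrite emp_devB//.
move=> fine.
have fin2 : `|G g| <= `|G g - G (proj (l0 + m) g)| + `|G (proj (l0 + m) g)|.
  by rewrite -{1}[G g](subrK (G (proj (l0 + m) g))) ler_normD.
(* This 4 is the one in front of [detail_const]; the 10 in front of [e] is the 9 of the next sum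
   plus 1 from the coarse level. *)
have g34 : \sum_(r < m) (3 / 4 : R) ^+ r <= 4.
  rewrite [leRHS](_ : _ = (1 - 3 / 4)^-1); last by field.
  by apply: geometric_sum_le; lra.
have g89 : \sum_(r < m) (8 / 9 : R) ^+ r <= 9.
  rewrite [leRHS](_ : _ = (1 - 8 / 9)^-1); last by field.
  by apply: geometric_sum_le; lra.
move: tele; rewrite !big_split/= -!mulr_suml => tele.
have d1 : 0 <= detail_const * s^-1 * c * V.
  by apply: mulr_ge0 => //; apply: mulr_ge0 => //; rewrite mulr_ge0// invr_ge0 ltW.
have eI : 0 <= e * I by rewrite mulr_ge0// ltW.
rewrite /coefficient_noise -/s -/c [X in _ <= _ + X + _ + _]mulrDl.
have -> : 4 * detail_const * s^-1 * c * V = 4 * (detail_const * s^-1 * c * V) by ring.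
have -> : 10 * e * I = 10 * (e * I) by ring.
have := ler_wpM2r d1 g34; have := ler_wpM2r eI g89.
lra.
Qed.

End local_basis.

(** * Expected noise *)

Section expectation_bounds.
Context d (T : measurableType d) (R : realType) (P : probability T R).
Implicit Types (g h : T -> R) (a c : R).

Definition mean_le g c : Prop := [/\ measurable_fun setT g,
  forall w, 0 <= g w & (\int[P]_w (g w)%:E <= c%:E)%E].

Lemma mean_leD g h a c : mean_le g a -> mean_le h c ->
  mean_le (fun w => g w + h w) (a + c).
Proof.
move=> [mg g0 ga] [mh h0 hc]; split.
- exact: measurable_funD.
- by move=> w; exact: addr_ge0.
under eq_integral do rewrite EFinD.
rewrite ge0_integralD//; first by rewrite EFinD leeD.
- by move=> w _; rewrite lee_fin.
- exact/measurable_EFinP.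
- by move=> w _; rewrite lee_fin.
- exact/measurable_EFinP.
Qed.

Lemma mean_leZ g a c : 0 <= a -> mean_le g c ->
  mean_le (fun w => a * g w) (a * c).
Proof.
move=> a0 [mg g0 gc]; split.
- exact: measurable_funM.
- by move=> w; exact: mulr_ge0.
under eq_integral do rewrite EFinM.
rewrite ge0_integralZl_EFin//; first by rewrite EFinM lee_wpmul2l ?lee_fin.
  by move=> w _; rewrite lee_fin.
exact/measurable_EFinP.
Qed.

Lemma mean_le0 : mean_le (fun=> 0) 0.
Proof. by split => //; rewrite integral0. Qed.

Lemma mean_le_sum (J : Type) (s : seq J) (F : J -> T -> R) (c : J -> R) :
  (forall j, mean_le (F j) (c j)) ->
  mean_le (fun w => \sum_(j <- s) F j w) (\sum_(j <- s) c j).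
Proof.
move=> h; elim: s => [|j s ih].
  by rewrite big_nil; under eq_fun do rewrite big_nil; exact: mean_le0.
rewrite big_cons; under eq_fun do rewrite big_cons.
exact: mean_leD.
Qed.

Lemma mean_le_trans g a c : a <= c -> mean_le g a -> mean_le g c.
Proof. by move=> ac [mg g0 ga]; split => //; rewrite (le_trans ga)// lee_fin. Qed.

Lemma measurable_gt_set g a : measurable_fun setT g ->
  measurable [set w | a < g w].
Proof.
move=> mg; rewrite -[X in measurable X]setTI -preimage_itvoy.
exact: (mg measurableT _ (measurable_itv _)).
Qed.

Lemma markov_le g a c : 0 < a -> mean_le g c ->
  (P [set w | (a < g w)%R] <= (c / a)%:E)%E.
Proof.
move=> a0 [mg g0 gc]; pose A := [set w | a < g w].
have mA : measurable A by exact: measurable_gt_set.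
have : (a%:E * P A <= c%:E)%E.
  apply: le_trans gc; rewrite -(setIT A) -integral_indic// -ge0_integralZl_EFin//.
  - apply: ge0_le_integral => //.
    + by move=> w _; rewrite mule_ge0 ?lee_fin// ltW.
    + by apply: emeasurable_funM => //; exact/measurable_EFinP/measurable_indic.
    + exact/measurable_EFinP.
    + move=> w _; rewrite -EFinM lee_fin indicE.
      have [|_] := boolP (w \in A); last by rewrite mulr0.
      by rewrite inE mulr1 => /ltW.
  - exact/measurable_EFinP/measurable_indic.
  - exact: ltW.
by rewrite -[P _]fineK ?fin_num_measure// -EFinM !lee_fin ler_pdivlMr// mulrC.
Qed.

End expectation_bounds.

Section noise_expectation.
Context d (T : measurableType d) (R : realType).
Notation mu := (@lebesgue_measure R).
Variables (P : probability T R) (X : nat -> T -> measurableTypeR R).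
Variable S : probability (measurableTypeR R) R.
Hypothesis mX : forall i, measurable_fun setT (X i).
Hypothesis XS : forall n (A : nat -> set (measurableTypeR R)),
  (forall i, measurable (A i)) ->
  P (\bigcap_(i in `I_n) (X i @^-1` A i)) = (\prod_(i < n) S (A i))%E.
Hypothesis S01 : S `[0%R, 1%R[%classic = 1%E.
Variable C : R.
Hypothesis SC : forall f, bounded_mfun f -> (forall x, 0 <= x < 1 -> 0 <= f x) ->
  Int S f <= C * Int mu f.
Variables (k : nat) (Q : nat -> {poly R}) (B : R).
Hypothesis Q_orth : forall i j, (i < k.+1)%N -> (j < k.+1)%N ->
  poly_int (Q i * Q j) = (i == j)%:R.
Hypothesis Q_le : forall i x, (i < k.+1)%N -> 0 <= x < 1 -> `|(Q i).[x]| <= B.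
Variable n : nat.
Hypothesis n0 : (0 < n)%N.

Let s : R := Num.sqrt n%:R.
Let s2 : s ^+ 2 = n%:R. Proof. by rewrite sqr_sqrtr. Qed.
Let s0 : 0 < s. Proof. by rewrite sqrtr_gt0 ltr0n. Qed.

(** The bound of [emp_dev_moment_le] for supremum norm 2^l D, second moment [C] and K = 2 D. *)
Definition moment_const (p : nat) (D : R) : R := (2 * p)`!%:R * (2 * expR (C * expR (2 * D))).

Lemma moment_const_ge0 p D : 0 <= moment_const p D.
Proof. by rewrite mulr_ge0// mulr_ge0// expR_ge0. Qed.

Let exp2_le_s l : (4 ^ l <= n)%N -> 2 ^+ l <= s.
Proof.
move=> ln; rewrite -(@ler_pXn2r _ 2) ?nnegrE ?exprn_ge0 ?(ltW s0)// s2 expr2 two_four.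
by rewrite -natrX ler_nat.
Qed.

(** A function of unit L^2-norm concentrated on one cell has height of order 2^l, at most sqrt n as
    long as 4^l <= n. Moments are therefore uniform over all levels used. *)
Lemma normalized_moment p l (q : R -> R) (D : R) : (4 ^ l <= n)%N -> 0 <= D ->
  @measurable_fun _ _ (measurableTypeR R) R setT q ->
  (forall x, `|q x| <= 2 ^+ l * D) -> Int mu (fun x => q x ^+ 2) <= 1 -> 0 <= C ->
  mean_le P (fun w => (s * emp_dev S n (X^~ w) q) ^+ (2 * p)) (moment_const p D).
Proof.
move=> ln D0 mq qD q2 C0.
have bq : bounded_mfun q by split; [exact: measurable_funTS | exists (2 ^+ l * D)].
split.
- apply: measurable_funX; apply: measurable_funM => //.
  exact: measurable_emp_dev.
- by move=> w; rewrite exprM exprn_ge0 ?sqr_ge0.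
apply: (emp_dev_moment_le mX XS S01 n0 _ mq qD).
- apply: le_trans (SC _ _) _; [by bounded|by move=> x _; exact: sqr_ge0|].
  by rewrite ler_piMr.
- rewrite [leLHS](_ : _ = 2 * D * 2 ^+ l); last by ring.
  by rewrite ler_wpM2l ?mulr_ge0// exp2_le_s.
Qed.

Let loc_moment p l (a : 'I_(4 ^ l) * 'I_k.+1) : (4 ^ l <= n)%N -> 0 <= C ->
  mean_le P (fun w => (s * emp_dev S n (X^~ w) (loc Q a)) ^+ (2 * p)) (moment_const p B).
Proof.
move=> ln C0; apply: (@normalized_moment p l) => //.
- exact: B_ge0 Q_le.
- exact: measurable_loc.
- by move=> x; exact: normr_loc_le.
- rewrite (@eq_Int _ _ _ (fun x => loc Q a x * loc Q a x)); last by move=> x _; rewrite expr2.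
  by rewrite loc_orthonormal// eqxx.
Qed.

Lemma coefficient_noise_expectation l0 m : (4 ^ (l0 + m) <= n)%N -> 0 <= C ->
  mean_le P (fun w => coefficient_noise k Q S n (X^~ w) l0 m)
    (37 * k.+1%:R * (moment_const 1 B + moment_const 3 B) * (4 ^+ l0 / n%:R)).
Proof.
move=> lmn C0; set M := moment_const 1 B + moment_const 3 B.
have nn0 : n%:R != 0 :> R by rewrite pnatr_eq0 -lt0n.
have M1 : moment_const 1 B <= M by rewrite lerDl moment_const_ge0.
have M3 : moment_const 3 B <= M by rewrite lerDr moment_const_ge0.
have M0 : 0 <= M := le_trans (moment_const_ge0 _ _) M1.
have nV0 : 0 <= (n%:R^-1 : R) by rewrite invr_ge0.
have coarse : mean_le P
    (fun w => \sum_(a : 'I_(4 ^ l0) * 'I_k.+1) emp_dev S n (X^~ w) (loc Q a) ^+ 2)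
    (\sum_(a : 'I_(4 ^ l0) * 'I_k.+1) (n%:R^-1 * M)).
  apply: mean_le_sum => a.
  apply: mean_le_trans (ler_wpM2l nV0 M1) _.
  have l0n : (4 ^ l0 <= n)%N by rewrite (leq_trans _ lmn)// leq_exp2l// leq_addr.
  have := mean_leZ nV0 (loc_moment 1 a l0n C0).
  congr (mean_le _ _ _); apply/funext => w.
  by rewrite muln1 exprMn s2 mulrA mulVf ?mul1r.
have fine r : (r < m)%N -> mean_le P
    (fun w => n%:R ^+ 2 * \sum_(a : 'I_(4 ^ (l0 + r).+1) * 'I_k.+1) emp_dev S n (X^~ w) (loc Q a) ^+ 6)
    (\sum_(a : 'I_(4 ^ (l0 + r).+1) * 'I_k.+1) (n%:R^-1 * M)).
  move=> rm; under eq_fun do rewrite mulr_sumr.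
  apply: mean_le_sum => a.
  apply: mean_le_trans (ler_wpM2l nV0 M3) _.
  have l0n : (4 ^ (l0 + r).+1 <= n)%N by rewrite (leq_trans _ lmn)// leq_exp2l// -addnS leq_add2l.
  have := mean_leZ nV0 (loc_moment 3 a l0n C0).
  congr (mean_le _ _ _); apply/funext => w.
  by rewrite exprMn (exprM s 2 3) s2; field.
have cardE l : #|{: 'I_(4 ^ l) * 'I_k.+1}|%:R = 4 ^+ l * k.+1%:R :> R.
  by rewrite card_prod !card_ord natrM natrX.
have sumE l : \sum_(a : 'I_(4 ^ l) * 'I_k.+1) (n%:R^-1 * M) = 4 ^+ l * (k.+1%:R * (n%:R^-1 * M)).
  by rewrite sumr_const -[LHS]mulr_natl cardE -mulrA.
(* The weight (2/9)^r meets 4 * 4^l0 * 4^r cells, and (2/9) * 4 = 8/9. The total is 37 = 1 + 4 * 9,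
   with 1 for the coarse level. *)
pose c r : R := (8 / 9) ^+ r * (4 * 4 ^+ l0 * (k.+1%:R * (n%:R^-1 * M))).
apply: (@mean_le_trans _ _ _ _ _ (4 ^+ l0 * (k.+1%:R * (n%:R^-1 * M)) + \sum_(r < m) c r)).
  rewrite /c -mulr_suml.
  have g89 : \sum_(r < m) (8 / 9 : R) ^+ r <= 9.
    rewrite [leRHS](_ : _ = (1 - 8 / 9)^-1); last by field.
    by apply: geometric_sum_le; lra.
  set D := k.+1%:R * _.
  have D0 : 0 <= 4 * 4 ^+ l0 * D by rewrite mulr_ge0 ?mulr_ge0 ?exprn_ge0.
  have := ler_wpM2r D0 g89.
  have -> : 37 * k.+1%:R * M * (4 ^+ l0 / n%:R) = 37 * 4 ^+ l0 * D by rewrite /D; ring.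
  lra.
apply: mean_leD; first by rewrite -sumE.
apply: mean_le_sum => r; rewrite /c.
have -> : (8 / 9) ^+ r * (4 * 4 ^+ l0 * (k.+1%:R * (n%:R^-1 * M))) =
    (2 / 9) ^+ r * (\sum_(a : 'I_(4 ^ (l0 + r).+1) * 'I_k.+1) (n%:R^-1 * M)).
  have -> : (8 / 9 : R) ^+ r = (2 / 9) ^+ r * 4 ^+ r.
    by rewrite -exprMn; congr (_ ^+ _); field.
  by rewrite sumE exprS exprD; ring.
by apply: mean_leZ; [rewrite exprn_ge0// divr_ge0 | exact: fine].
Qed.

Definition scaled_cell l j (x : R) : R := 2 ^+ l * \1_(cell l j) x.

(** Dominates each of its terms, so one Markov inequality for the sum acts as a union bound over the
    cells. *)
Definition cell_noise l p w : R :=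
  \sum_(j < 4 ^ l) (s * emp_dev S n (X^~ w) (scaled_cell l j)) ^+ (2 * p).

Lemma cell_noise_expectation l p : (4 ^ l <= n)%N -> 0 <= C ->
  mean_le P (cell_noise l p) (4 ^+ l * moment_const p 1).
Proof.
move=> ln C0.
have -> : 4 ^+ l * moment_const p 1 = \sum_(j < 4 ^ l) moment_const p 1.
  by rewrite sumr_const card_ord -[RHS]mulr_natl natrX.
apply: mean_le_sum => j; apply: (@normalized_moment p l) => //.
- by apply: measurable_funM => //; apply: measurable_indic; exact: measurable_cell.
- move=> x; rewrite /scaled_cell normrM ger0_norm ?exprn_ge0// ler_pM2l ?exprn_gt0//.
  by rewrite indicE; case: (x \in _); rewrite ?normr1 ?normr0.
have hi := bounded_mfun_indic (@measurable_cell R l j).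
rewrite (@eq_Int _ _ _ (fun x => 4 ^+ l * \1_(cell l j) x)).
  rewrite IntZ; bounded; rewrite Int_cell// mulfV// expf_neq0//.
move=> x _; rewrite /scaled_cell exprMn indicE -exprM mulnC exprM.
have -> : (2 : R) ^+ 2 = 4 by ring.
by case: (x \in _); rewrite ?expr1n ?expr0n.
Qed.

End noise_expectation.

(** * Functions of bounded variation and iterated integrals *)

Section variation.
Context {R : realType}.
Notation mu := (@lebesgue_measure R).
Local Open Scope charge_scope.
Implicit Types (f g e W : R -> R).

(** [W] plays the cumulative variation of [f]; it replaces charges and Hahn decompositions in the
    spline estimates. *)
Definition variation_majorant f W := forall a b, 0 <= a -> a <= b -> b <= 1 ->
  `|f b - f a| <= W b - W a.

(** [W x] is the mass of ]0, x] under the variation of [nu], which dominates [nu] on every ]a,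
    b]. *)
Lemma generates_majorant (nu : {charge set (measurableTypeR R) -> \bar R}) f
  (A B : set R) (AB : hahn_decomposition nu A B) : generates nu f ->
  exists2 W, variation_majorant f W &
    (W 1 - W 0)%:E = charge_variation AB `]0%R, 1%R]%classic.
Proof.
move=> nuf; pose v := charge_variation AB.
have vfin (D : set (measurableTypeR R)) : measurable D -> v D \is a fin_num.
  by move=> mD; exact: fin_num_measure.
pose W x := fine (v `]0%R, x]%classic).
have W0 : W 0 = 0 by rewrite /W set_itvoc0 /v measure0.
have split (m : {charge set (measurableTypeR R) -> \bar R}) a b : 0 <= a -> a <= b ->
    (m `]0%R, b]%classic = m `]0%R, a]%classic + m `]a, b]%classic)%E.
  move=> a0 ab; rewrite -chargeU//; last first.
    apply/seteqP; split => // x /=; rewrite !in_itv/= => -[/andP[_ h1] /andP[h2 _]].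
    by have := lt_le_trans h2 h1; rewrite ltxx.
  congr (m _); apply/seteqP; split => x /=; rewrite !in_itv/=.
    move=> /andP[x0 xb]; have [xa|ax] := leP x a; [left|right].
      by rewrite x0.
    by rewrite xb.
  move=> [|] /andP[h1 h2].
    by rewrite h1 (le_trans h2).
  by rewrite h2 (le_lt_trans a0 h1).
exists W.
  move=> a b a0 ab b1.
  have bI : 0 <= b <= 1 by rewrite (le_trans a0 ab).
  have aI : 0 <= a <= 1 by rewrite a0 (le_trans ab).
  have fb := nuf _ bI; have fa := nuf _ aI.
  have nuab : (f b - f a)%:E = nu `]a, b]%classic.
    move: fb; rewrite (split nu a b)// addeA -fa => /eqP; rewrite -(@fineK _ (nu _)) ?fin_num_measure//.
    by rewrite -EFinD eqe => /eqP ->; congr EFin; ring.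
  have Wab : (W b - W a)%:E = v `]a, b]%classic.
    have vab : (v `]0%R, b]%classic = v `]0%R, a]%classic + v `]a, b]%classic)%E.
      exact: (split (charge_variation AB) a b a0 ab).
    rewrite /W vab fineD ?vfin// -[in RHS](fineK (vfin _ _))//.
    by congr EFin; ring.
  rewrite -lee_fin Wab -[(`|_|)%:E]/(`|(f b - f a)%:E|)%E nuab.
  exact: abse_charge_variation.
by rewrite W0 subr0 /W fineK// vfin.
Qed.

Lemma majorant_ndecr f W a b : variation_majorant f W ->
  0 <= a -> a <= b -> b <= 1 -> W a <= W b.
Proof. by move=> fW a0 ab b1; rewrite -subr_ge0 (le_trans _ (fW _ _ a0 ab b1)). Qed.

(** [f] is the difference of the nondecreasing functions f + W and [W]. The clamp [cl] makes them
    monotone on the whole line, since nothing is known outside [0, 1]. *)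
Lemma majorant_bounded f W : variation_majorant f W -> bounded_mfun f.
Proof.
move=> fW; pose cl x : R := Num.max 0 (Num.min x 1).
have cl0 x : 0 <= cl x by rewrite le_max lexx.
have cl1 x : cl x <= 1 by rewrite ge_max ler01/= ge_min lexx orbT.
have clm x y : x <= y -> cl x <= cl y.
  move=> xy; rewrite ge_max !le_max lexx/=; apply/orP; right.
  by rewrite le_min !ge_min xy lexx !orbT.
have clE x : 0 <= x < 1 -> cl x = x.
  by move=> /andP[x0 /ltW x1]; rewrite /cl min_l// max_r.
split.
  apply: (@eq_measurable_fun _ _ (measurableTypeR R) _ _ (fun x => (f (cl x) + W (cl x)) - W (cl x))).
    by move=> x; rewrite inE/= in_itv/= => /clE ->; rewrite addrK.
  apply: measurable_funTS; apply: measurable_funB;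
    apply: nondecreasing_measurable => // x y xy; last first.
    by apply: majorant_ndecr fW _ _ _ => //; exact: clm.
  have := fW _ _ (cl0 x) (clm _ _ xy) (cl1 y); rewrite ler_norml => /andP[h _].
  lra.
exists (`|f 0| + (W 1 - W 0)) => x /andP[x0 /ltW x1].
rewrite -[f x](subrK (f 0)) addrC (le_trans (ler_normD _ _))// lerD2l.
apply: le_trans (fW _ _ (lexx 0) x0 x1) _; rewrite lerB//.
exact: majorant_ndecr fW x0 x1 (lexx 1).
Qed.

(** As [TV] is an infimum, the increments are compared with each representing charge. The constant 1
    matters: it puts the approximating spline in the l^1-ball of the same radius [M]. *)
Lemma increments_le_TV f m : (0 < m)%N ->
  ((\sum_(j < m) `|f (j.+1%:R / m%:R) - f (j%:R / m%:R)|)%:E <= TV f)%E.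
Proof.
move=> m0; apply: le_ereal_inf_tmp => _ [nu [A [B [AB [nuf ->]]]]].
have [W fW <-] := generates_majorant AB nuf; rewrite lee_fin.
have mR : 0 < m%:R :> R by rewrite ltr0n.
apply: (@le_trans _ _ (\sum_(j < m) (W (j.+1%:R / m%:R) - W (j%:R / m%:R)))).
  apply: ler_sum => j _; apply: fW.
  - by rewrite divr_ge0.
  - by rewrite ler_pM2r ?invr_gt0// ler_nat.
  - by rewrite ler_pdivrMr// mul1r ler_nat.
rewrite -(big_mkord xpredT (fun j => W (j.+1%:R / m%:R) - W (j%:R / m%:R))).
by rewrite telescope_sumr// mulfV ?gt_eqF// mul0r.
Qed.

End variation.

Section iterated_integrals.
Context {R : realType}.
Notation mu := (@lebesgue_measure R).
Local Open Scope charge_scope.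
Implicit Types (f g : R -> R) (x xi : R).

Definition running_int f x : R := Int mu (fun t => \1_(`[0%R, x]%classic) t * f t).

Let bounded_indic_itv x : bounded_mfun (\1_(`[0%R, x]%classic) : R -> R).
Proof. exact: bounded_mfun_indic. Qed.

Lemma running_int_Rintegral f x : 0 <= x < 1 ->
  running_int f x = \int[mu]_(t in `[0%R, x]) f t.
Proof.
move=> /andP[x0 x1]; rewrite /running_int.
rewrite (@eq_Int _ _ _ (f \_ (`[0%R, x]%classic))); last first.
  by move=> t _; rewrite patchE indicE; case: ifPn; rewrite ?mul1r ?mul0r.
rewrite -Rintegral_mkcondr; congr (Rintegral _ _ _).
by apply/setIidr => t; rewrite /= !in_itv/= => /andP[-> /le_lt_trans]; exact.
Qed.

Lemma running_intB f g x : bounded_mfun f -> bounded_mfun g ->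
  running_int (fun t => f t - g t) x = running_int f x - running_int g x.
Proof.
move=> hf hg; have hi := bounded_indic_itv x; rewrite /running_int -IntB; bounded.
by apply: eq_Int => t _; rewrite mulrBr.
Qed.

Lemma running_int_sum (J : Type) (s : seq J) (c : J -> R) (F : J -> R -> R) x :
  (forall j, bounded_mfun (F j)) ->
  running_int (fun t => \sum_(j <- s) c j * F j t) x =
  \sum_(j <- s) c j * running_int (F j) x.
Proof.
move=> hF; have hi := bounded_indic_itv x; rewrite /running_int.
rewrite (@eq_Int _ _ _ (fun t => \sum_(j <- s) c j * (\1_(`[0%R, x]%classic) t * F j t))); last first.
  by move=> t _; rewrite mulr_sumr; apply: eq_bigr => j _; ring.
rewrite Int_sum; bounded; last by move=> j _; have := hF j => ?; bounded.
by apply: eq_bigr => j _; have := hF j => ?; rewrite IntZ//; bounded.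
Qed.

Lemma running_intD f g x : bounded_mfun f -> bounded_mfun g ->
  running_int (fun t => f t + g t) x = running_int f x + running_int g x.
Proof.
move=> hf hg; have hi := bounded_indic_itv x; rewrite /running_int -IntD; bounded.
by apply: eq_Int => t _; rewrite mulrDr.
Qed.

Lemma normr_running_int_le f x : bounded_mfun f ->
  `|running_int f x| <= Int mu (fun t => `|f t|).
Proof.
move=> hf; have hi := bounded_indic_itv x; rewrite /running_int.
have h : `|Int mu (fun t => \1_(`[0%R, x]%classic) t * f t)| <=
    Int mu (fun t => `|\1_(`[0%R, x]%classic) t * f t|).
  by apply: le_normr_Int; bounded.
apply: (le_trans h); apply: le_Int; bounded => t _.
by rewrite normrM indicE; case: (t \in _); rewrite ?normr1 ?normr0 ?mul1r ?mul0r.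
Qed.

Lemma LRN_derivative_running_int f g x : is_LRN_derivative f g ->
  bounded_mfun g -> 0 <= x < 1 -> f x = f 0 + running_int g x.
Proof.
move=> [nu [nuf numu aeg]] hg /[dup] x01 /andP[x0 x1].
have xI : 0 <= x <= 1 by rewrite x0 ltW.
apply: EFin_inj; rewrite (nuf _ xI) EFinD; congr (_ + _)%E.
have mg : @measurable_fun _ _ (measurableTypeR R) _ `]0%R, x] g.
  apply: measurable_funS hg.1 => // t; rewrite /= !in_itv/= => /andP[t0 tx].
  by rewrite ltW//= (le_lt_trans tx).
have ig : mu.-integrable `]0%R, x] (EFin \o g).
  apply: (@integrableS _ _ _ mu `[0%R, 1%R[%classic) => //.
    move=> t; rewrite /= !in_itv/= => /andP[t0 tx].
    by rewrite ltW//= (le_lt_trans tx).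
  by apply: bounded_mfun_integrable; bounded.
rewrite (Radon_Nikodym_integral numu)//.
rewrite running_int_Rintegral// -Rintegral_itv_obnd_cbnd//.
rewrite /Rintegral fineK; last exact: integrable_fin_num.
apply: ae_eq_integral => //.
- apply: measurable_funTS; apply: (measurable_int mu); exact: Radon_Nikodym_integrable.
- exact/measurable_EFinP.
apply: (negligibleS _ aeg) => t /= + h; apply; rewrite in_itv/= => /andP[t0 tx].
by apply: h; rewrite t0 (le_trans tx)// ltW.
Qed.

(** Normalized by the factorial, so that integration from 0 raises [m] by one with no constant; m =
    0 is the right-continuous step at [xi]. *)
Definition truncated_power m xi x : R :=
  if xi <= x then (x - xi) ^+ m / m`!%:R else 0.

Lemma bounded_truncated_power m xi : bounded_mfun (truncated_power m xi).
Proof.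
pose p : {poly R} := (m`!%:R^-1) *: ('X - xi%:P) ^+ m.
apply: (@eq_bounded_mfun _ (fun x => \1_(`[xi, +oo[%classic) x * p.[x])).
  move=> x _; rewrite indicE /truncated_power !hornerE.
  have -> : (x \in `[xi, +oo[%classic) = (xi <= x).
    by apply/idP/idP; rewrite inE/= in_itv/= andbT.
  by case: ifP => _ /=; rewrite ?mul1r ?mul0r//; ring.
have h := @bounded_mfun_indic R `[xi, +oo[%classic (measurable_itv _).
by bounded.
Qed.

Lemma running_int_truncated_power m xi x : 0 <= xi -> 0 <= x < 1 ->
  running_int (truncated_power m xi) x = truncated_power m.+1 xi x.
Proof.
move=> xi0 /andP[x0 x1].
pose p : {poly R} := (m`!%:R^-1) *: ('X - xi%:P) ^+ m.
pose P : {poly R} := ((m.+1)`!%:R^-1) *: ('X - xi%:P) ^+ m.+1.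
have f0 j : j`!%:R != 0 :> R by rewrite pnatr_eq0 -lt0n fact_gt0.
have dP : P^`() = p.
  rewrite /P /p derivZ deriv_exp derivXsubC mul1r -(scaler_nat m.+1 (_ ^+ m)) scalerA.
  by rewrite factS natrM invfM mulrAC mulVf ?mul1r// pnatr_eq0.
rewrite /truncated_power; have [xix|xxi] := leP xi x; last first.
  rewrite /running_int (@eq_Int _ _ _ (fun=> 0)) ?Int_lebesgue_cst// => t _.
  rewrite indicE /truncated_power; have [|_] := boolP (t \in _); last by rewrite mul0r.
  rewrite inE/= in_itv/= => /andP[_ tx].
  by rewrite leNgt (le_lt_trans tx)//= mulr0.
rewrite /running_int (@eq_Int _ _ _ ((horner p) \_ (`[xi, x]%classic))); last first.
  move=> t /andP[t0 t1]; rewrite patchE indicE /truncated_power !hornerE.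
  have -> : (t \in `[0%R, x]%classic) = (t <= x).
    by apply/idP/idP; rewrite inE/= in_itv/= t0.
  have -> : (t \in `[xi, x]%classic) = (xi <= t) && (t <= x).
    by apply/idP/idP; rewrite inE/= in_itv/=.
  by case: (xi <= t); case: (t <= x); rewrite ?mul1r ?mul0r// mulrC.
rewrite -Rintegral_mkcondr (_ : _ `&` _ = `[xi, x]%classic); last first.
  apply/setIidr => t; rewrite /= !in_itv/= => /andP[h1 h2].
  by rewrite (le_trans xi0)//= (le_lt_trans h2).
rewrite -dP Rintegral_deriv_poly// /P !hornerE subrr expr0n mulr0 subr0.
by rewrite mulrC.
Qed.

End iterated_integrals.

(** * Spline approximation *)

Section spline_approximation.
Context {R : realType}.
Notation mu := (@lebesgue_measure R).
Variables (k : nat) (f : nat -> R -> R) (W : R -> R).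
Hypothesis bounded_f : forall i, (i <= k)%N -> bounded_mfun (f i).
Hypothesis f_int : forall i x, (i < k)%N -> 0 <= x < 1 ->
  f i x = f i 0 + running_int (f i.+1) x.
Hypothesis fW : variation_majorant (f k) W.
Variables (l : nat) (xi : 'I_(4 ^ l) -> R).
Hypothesis xi_cell : forall j : 'I_(4 ^ l), cell l j (xi j).

Let grid j : R := j%:R / 4 ^+ l.
Let c j := f k (grid j.+1) - f k (grid j).
Let V := W 1 - W 0.

(* The [(k - r)]-th derivative of a spline approximating [f 0], with a single knot
   [xi j] per cell: the increment of [f k] over the cell is moved to that knot. *)
Definition spline r x : R :=
  \sum_(m < r.+1) f (k - r + m)%N 0 * truncated_power m 0 x +
  \sum_(j < 4 ^ l) c j * truncated_power r (xi j) x.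

Let exp4_gt0 : (0 : R) < 4 ^+ l. Proof. by rewrite exprn_gt0. Qed.

Let xi_unit j : 0 <= xi j < 1.
Proof. exact: cell_unit (ltn_ord j) (xi_cell j). Qed.

Let bounded_spline r : bounded_mfun (spline r).
Proof.
apply: bounded_mfunD; apply: bounded_mfun_sum => j _.
  by have := bounded_truncated_power j 0 => ?; bounded.
by have := bounded_truncated_power r (xi j) => ?; bounded.
Qed.

Let spline_step r x : (r < k)%N -> 0 <= x < 1 ->
  spline r.+1 x = f (k - r.+1)%N 0 + running_int (spline r) x.
Proof.
move=> rk x01; have x0 : 0 <= x by case/andP: x01.
rewrite /spline running_intD; last 2 first.
- apply: bounded_mfun_sum => j _.
  by have := bounded_truncated_power j 0 => ?; bounded.
- apply: bounded_mfun_sum => j _.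
  by have := bounded_truncated_power r (xi j) => ?; bounded.
rewrite running_int_sum; last by move=> j; exact: bounded_truncated_power.
rewrite running_int_sum; last by move=> j; exact: bounded_truncated_power.
rewrite addrA; congr (_ + _); last first.
  apply: eq_bigr => j _; rewrite running_int_truncated_power//.
  by case/andP: (xi_unit j).
rewrite big_ord_recl/= addn0 {1}/truncated_power x0 expr0 fact0 divr1 mulr1.
congr (_ + _); apply: eq_bigr => j _; rewrite running_int_truncated_power//.
by congr (f _ _ * _); rewrite /bump/= addnA addn1 subnSK.
Qed.

Let grid_ge0 j : 0 <= grid j.
Proof. by rewrite divr_ge0// exprn_ge0. Qed.

Let grid_mono i j : (i <= j)%N -> grid i <= grid j.
Proof. by move=> ij; rewrite ler_pM2r ?invr_gt0// ler_nat. Qed.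

Let grid_le1 j : (j <= 4 ^ l)%N -> grid j <= 1.
Proof. by move=> jl; rewrite ler_pdivrMr// mul1r -natrX ler_nat. Qed.

Let cell_grid j x : cell l j x -> grid j <= x < grid j.+1.
Proof. by rewrite cellE /= in_itv. Qed.

(** At a point of cell j, the knots of all earlier cells have been passed and none of the later
    ones. So [spline 0] equals [f k] at the left or right end of the cell, according to the side of
    [xi j]. *)
Let spline0_dev (j : 'I_(4 ^ l)) x : cell l j x ->
  `|spline 0 x - f k x| <= W (grid j.+1) - W (grid j).
Proof.
move=> xj; have /andP[jx xj1] := cell_grid xj.
have x0 : 0 <= x by exact: le_trans (grid_ge0 j) jx.
have j1 : grid j.+1 <= 1 by exact: grid_le1 (ltn_ord j).
have tp (t : R) : truncated_power 0 t x = (t <= x)%R%:R.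
  by rewrite /truncated_power expr0 fact0 divr1; case: ifP.
have -> : spline 0 x = f k (grid j) + c j * (xi j <= x)%R%:R.
  rewrite /spline big_ord_recl big_ord0 addr0/= subn0 addn0 tp x0 mulr1.
  have -> : f k (grid j) = f k 0 + \sum_(i < j) c i.
    rewrite -(big_mkord xpredT c) telescope_sumr// {3}/grid mul0r.
    by rewrite addrC subrK.
  rewrite -addrA; congr (_ + _).
  rewrite (bigD1 j)//= tp addrC; congr (_ + _).
  rewrite (big_ord_widen_cond _ xpredT c (ltnW (ltn_ord j)))/=.
  rewrite [RHS]big_mkcond/= [RHS](bigD1 j)//= ltnn add0r.
  apply: eq_bigr => i ij; rewrite tp.
  have /andP[ix xi1] := cell_grid (xi_cell i).
  case: ltnP => h.
    by rewrite (le_trans (ltW xi1)) ?mulr1// (le_trans (grid_mono h)).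
  have {}h : (j.+1 <= i)%N by rewrite ltn_neqAle h andbT eq_sym; exact: ij.
  rewrite leNgt (lt_le_trans xj1) ?mulr0//.
  exact: le_trans (grid_mono h) ix.
have hW1 := fW (grid_ge0 j) jx (le_trans (ltW xj1) j1).
have hW2 := fW x0 (ltW xj1) j1.
have m1 := majorant_ndecr fW (grid_ge0 j) jx (le_trans (ltW xj1) j1).
have m2 := majorant_ndecr fW x0 (ltW xj1) j1.
have [_|_] := leP (xi j) x.
  rewrite mulr1 (_ : _ + _ - _ = f k (grid j.+1) - f k x); last by rewrite /c; ring.
  by apply: le_trans hW2 _; rewrite lerB.
rewrite mulr0 addr0 distrC; apply: le_trans hW1 _; rewrite lerB//.
Qed.

Let V_ge0 : 0 <= V.
Proof. by rewrite subr_ge0; apply: majorant_ndecr fW _ _ _. Qed.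

Let spline0_sup x : 0 <= x < 1 -> `|spline 0 x - f k x| <= V.
Proof.
move=> x01; have [j jl xj] := cell_exists l x01.
apply: le_trans (spline0_dev (j := Ordinal jl) xj) _; apply: lerB.
  exact: majorant_ndecr fW (grid_ge0 _) (grid_le1 jl) (lexx 1).
apply: majorant_ndecr fW _ (grid_ge0 _) _ => //.
exact: grid_le1 (ltnW jl).
Qed.

Let spline0_int : Int mu (fun x => `|spline 0 x - f k x|) <= 4 ^- l * V.
Proof.
have hs := bounded_spline 0; have hf := bounded_f (leqnn k).
have hi j := bounded_mfun_indic (@measurable_cell R l j).
have hb : bounded_mfun (fun x => \sum_(j < 4 ^ l) (W (grid j.+1) - W (grid j)) * \1_(cell l j) x).
  by apply: bounded_mfun_sum => j _; have := hi j => ?; bounded.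
apply: (@le_trans _ _ (Int mu (fun x => \sum_(j < 4 ^ l) (W (grid j.+1) - W (grid j)) * \1_(cell l j) x))).
  apply: le_Int; bounded.
  move=> x x01; have [j jl xj] := cell_exists l x01.
  rewrite (bigD1 (Ordinal jl))//= big1 ?addr0.
    rewrite indicE mem_set// mulr1; exact: (spline0_dev (j := Ordinal jl) xj).
  move=> i ij; rewrite indicE memNset ?mulr0// => yi.
  by move/eqP: ij; apply; apply/val_inj/(cell_inj yi xj).
rewrite Int_sum; bounded; last by move=> j _; have := hi j => ?; bounded.
rewrite (eq_bigr (fun j : 'I_(4 ^ l) => (W (grid j.+1) - W (grid j)) * 4 ^- l)); last first.
  by move=> j _; have := hi j => ?; rewrite IntZ ?Int_cell//; bounded.
rewrite -mulr_suml mulrC -(big_mkord xpredT (fun j => W (grid j.+1) - W (grid j))).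
by rewrite telescope_sumr// /grid natrX mulfV ?gt_eqF// mul0r.
Qed.

Let scale_le1 : 4 ^- l <= 1 :> R.
Proof. by rewrite invf_le1// exprn_ege1//; lra. Qed.

(** The two bounds travel together: the L^1 error at order r bounds the supremum at order r + 1,
    which in turn bounds the L^1 error there. *)
Let spline_dev r : (r <= k)%N ->
  (forall x, 0 <= x < 1 -> `|spline r x - f (k - r)%N x| <= V) /\
  Int mu (fun x => `|spline r x - f (k - r)%N x|) <= 4 ^- l * V.
Proof.
elim: r => [_|r ih rk]; first by rewrite subn0; split; [exact: spline0_sup | exact: spline0_int].
have [sup int] := ih (ltnW rk).
have hs := bounded_spline r; have hf := bounded_f (leq_subr r k).
have hs1 := bounded_spline r.+1; have hf1 := bounded_f (leq_subr r.+1 k).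
have h x : 0 <= x < 1 -> `|spline r.+1 x - f (k - r.+1)%N x| <= 4 ^- l * V.
  move=> x01; rewrite spline_step// (f_int (x := x) (i := (k - r.+1)%N))//; last first.
    by rewrite ltn_subrL/= (leq_ltn_trans (leq0n r)).
  rewrite subnSK//.
  have -> : f (k - r.+1)%N 0 + running_int (spline r) x -
      (f (k - r.+1)%N 0 + running_int (f (k - r)%N) x) =
      running_int (fun t => spline r t - f (k - r)%N t) x.
    by rewrite running_intB//; ring.
  by apply: le_trans (normr_running_int_le _ _) _; bounded.
split.
  by move=> x x01; rewrite (le_trans (h x x01))// ler_piMl.
rewrite -[leRHS]Int_lebesgue_cst; apply: le_Int; bounded.
Qed.

Lemma spline_sup x : 0 <= x < 1 -> `|spline k x - f 0%N x| <= V.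
Proof. by have [h _] := spline_dev (leqnn k); move: h; rewrite subnn; apply. Qed.

(** Supremum error [V] times L^1 error 4^-l V; for k = 0 the supremum error need not be small. *)
Lemma spline_sqr : Int mu (fun x => (spline k x - f 0%N x) ^+ 2) <= V ^+ 2 * 4 ^- l.
Proof.
have hs := bounded_spline k; have hf := bounded_f (leq0n k).
apply: (@le_trans _ _ (Int mu (fun x => V * `|spline k x - f 0%N x|))).
  apply: le_Int; bounded => x x01.
  by rewrite -real_normK ?num_real// expr2 ler_wpM2r// spline_sup.
rewrite IntZ; bounded; rewrite expr2 -mulrA ler_wpM2l// mulrC.
by have [_ h] := spline_dev (leqnn k); move: h; rewrite subnn.
Qed.

Variables (n : nat) (x : 'I_n -> R) (iota : 'I_(4 ^ l) -> 'I_n) (M : R).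
Hypothesis x_iota : forall j, x (iota j) = xi j.
Hypothesis fM : ((\sum_(i < k.+1) `|f i 0|)%:E + TV (f k) <= M%:E)%E.

(** The HAL basis has no factorials, so they move into the coefficients, where dividing by them only
    lowers the l^1-norm. What remains is the sum of the |f i 0| plus the increments of [f k],
    bounded through [TV]. *)
Lemma spline_hal_comb : exists2 beta : hal_index k n -> R, l1_norm beta <= M &
  forall u, 0 <= u -> hal_comb x beta u = spline k u.
Proof.
have f0 m : m`!%:R != 0 :> R by rewrite pnatr_eq0 -lt0n fact_gt0.
have f1 m : `|(m`!%:R : R)^-1| <= 1.
  by rewrite ger0_norm ?invr_ge0// invf_le1 ?ltr0n ?fact_gt0// ler1n fact_gt0.
exists (fun a : 'I_k.+1 + 'I_n => match a with
  | inl m => f m 0 / m`!%:R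
  | inr i => \sum_(j | iota j == i) c j / k`!%:R end).
  rewrite /l1_norm big_sumType/=.
  have cM : (\sum_(i < k.+1) `|f i 0|) + \sum_(j < 4 ^ l) `|c j| <= M.
    rewrite -lee_fin (le_trans _ fM)// EFinD leeD2l//.
    have := @increments_le_TV _ (f k) (4 ^ l).
    rewrite expn_gt0 natrX => /(_ isT).
    exact.
  apply: le_trans cM; apply: lerD.
    by apply: ler_sum => m _; rewrite normrM ler_piMr.
  apply: (@le_trans _ _ (\sum_i \sum_(j | iota j == i) `|c j|)).
    apply: ler_sum => i _; apply: le_trans (ler_norm_sum _ _ _) _.
    by apply: ler_sum => j _; rewrite normrM ler_piMr.
  by rewrite [leRHS](partition_big iota xpredT).
move=> u u0; rewrite /hal_comb big_sumType/= /spline subnn; congr (_ + _).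
  apply: eq_bigr => m _; rewrite add0n /truncated_power u0 subr0; field; exact: f0.
rewrite (eq_bigr (fun i => \sum_(j | iota j == i) c j * truncated_power k (xi j) u)).
  by rewrite [RHS](partition_big iota xpredT).
move=> i _; rewrite mulr_suml; apply: eq_bigr => j /eqP <-.
rewrite x_iota /truncated_power; case: ifP => _; last by rewrite !mulr0.
by field; exact: f0.
Qed.

End spline_approximation.

(** * Kullback-Leibler divergence in the exponential model *)

Section kullback_leibler.
Context {R : realType}.
Notation mu := (@lebesgue_measure R).
Implicit Types (f g : R -> R) (x : R).

(* Locked so that conversion never unfolds the integral. *)
Definition partition_fun : (R -> R) -> R :=
  locked (fun f => Int mu (fun x => expR (f x))).

Lemma partition_funE f : partition_fun f = Int mu (fun x => expR (f x)).
Proof. by rewrite /partition_fun -lock. Qed.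

Definition log_density f x : R := f x - ln (partition_fun f).

Lemma partition_fun_itv f b : bounded_mfun f -> (forall x, 0 <= x < 1 -> `|f x| <= b) ->
  expR (- b) <= partition_fun f <= expR b.
Proof.
move=> hf fb; rewrite partition_funE -[X in X <= _ <= _]Int_lebesgue_cst -[X in _ <= _ <= X]Int_lebesgue_cst.
by apply/andP; split; apply: le_Int; bounded => x /fb; rewrite ler_norml => /andP[h1 h2]; rewrite ler_expR.
Qed.

Lemma partition_fun_gt0 f : bounded_mfun f -> 0 < partition_fun f.
Proof.
move=> /[dup] hf [_ [b fb]]; have /andP[h _] := partition_fun_itv hf fb.
exact: lt_le_trans (expR_gt0 _) h.
Qed.

Lemma link_log_density f : bounded_mfun f -> link f = fun x => expR (log_density f x).
Proof.
move=> hf; apply/funext => x; rewrite /link /log_density expRB lnK ?posrE ?partition_fun_gt0//.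
congr (_ / _); rewrite partition_funE Rintegral_itv_bndo_bndc//.
by apply: bounded_mfun_integrable; bounded.
Qed.

Lemma loss_log_density f : bounded_mfun f -> loss f = fun x => - log_density f x.
Proof. by move=> hf; apply/funext => x; rewrite /loss link_log_density// expRK. Qed.

Lemma bounded_log_density f : bounded_mfun f -> bounded_mfun (log_density f).
Proof. by move=> hf; rewrite /log_density; bounded. Qed.

Lemma normr_log_density_le f b : bounded_mfun f ->
  (forall x, 0 <= x < 1 -> `|f x| <= b) ->
  forall x, 0 <= x < 1 -> `|log_density f x| <= 2 * b.
Proof.
move=> hf fb x x01; have /andP[h1 h2] := partition_fun_itv hf fb.
have Z0 := partition_fun_gt0 hf.
have Zb : `|ln (partition_fun f)| <= b.
  rewrite ler_norml -{1}[- b]expRK -{2}[b]expRK.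
  by rewrite !ler_ln ?posrE ?expR_gt0// h1 h2.
by rewrite /log_density (le_trans (ler_normB _ _))// mulrDl mul1r lerD// fb.
Qed.

Variable S : probability (measurableTypeR R) R.
Hypothesis S01 : S `[0%R, 1%R[%classic = 1%E.
Variable f0 : R -> R.
Hypothesis bf0 : bounded_mfun f0.
Hypothesis S_density : forall f, bounded_mfun f -> (forall x, 0 <= x < 1 -> 0 <= f x) ->
  Int S f = Int mu (fun x => f x * expR (log_density f0 x)).
Variable b : R.
Hypothesis f0b : forall x, 0 <= x < 1 -> `|f0 x| <= b.
(** 4 b bounds the log-ratio of two densities; the extra 2 meets the requirement 2 <= T of
    [expR_remainder_ge]. *)
Notation T := (4 * b + 2).

Let Sfin : (S `[0%R, 1%R[%classic < +oo)%E.
Proof. exact: unit_interval_prob_fin. Qed.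

Let b0 : 0 <= b.
Proof. by apply: le_trans (f0b (_ : 0 <= 0 < 1)); rewrite ?lexx ?ltr01. Qed.

Let bl0 : bounded_mfun (log_density f0). Proof. exact: bounded_log_density. Qed.

Lemma Int_prob_le f : bounded_mfun f -> (forall x, 0 <= x < 1 -> 0 <= f x) ->
  Int S f <= expR (2 * b) * Int mu f.
Proof.
move=> hf f_ge0; rewrite S_density// -IntZ; bounded; apply: le_Int; bounded => x x01.
rewrite mulrC ler_wpM2r ?f_ge0// ler_expR.
exact: le_trans (ler_norm _) (normr_log_density_le bf0 f0b x01).
Qed.

Lemma Int_prob_ge f : bounded_mfun f -> (forall x, 0 <= x < 1 -> 0 <= f x) ->
  expR (- (2 * b)) * Int mu f <= Int S f.
Proof.
move=> hf f_ge0; rewrite S_density// -IntZ; bounded; apply: le_Int; bounded => x x01.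
rewrite [leRHS]mulrC ler_wpM2r ?f_ge0// ler_expR.
by have := normr_log_density_le bf0 f0b x01; rewrite ler_norml => /andP[].
Qed.

Definition log_ratio f x : R := log_density f x - log_density f0 x.
Definition kl f : R := - Int S (log_ratio f).

Lemma bounded_log_ratio f : bounded_mfun f -> bounded_mfun (log_ratio f).
Proof. by move=> /bounded_log_density hf; exact: bounded_mfunB. Qed.

Section bounded_log.
Variable f : R -> R.
Hypothesis bf : bounded_mfun f.
Hypothesis fb : forall x, 0 <= x < 1 -> `|f x| <= b.

Let bt : bounded_mfun (log_ratio f). Proof. exact: bounded_log_ratio. Qed.
Let bl : bounded_mfun (log_density f). Proof. exact: bounded_log_density. Qed.

Lemma normr_log_ratio_le x : 0 <= x < 1 -> `|log_ratio f x| <= T.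
Proof.
move=> x01; rewrite (le_trans (ler_normB _ _))//.
have -> : T = 2 * b + 2 * b + 2 by ring.
by rewrite -[leLHS]addr0 !lerD ?(normr_log_density_le bf fb x01) ?(normr_log_density_le bf0 f0b x01).
Qed.

Let Int_link : Int mu (fun x => expR (log_density f x)) = 1.
Proof.
have Z0 := partition_fun_gt0 bf.
rewrite (@eq_Int _ _ _ (fun x => (partition_fun f)^-1 * expR (f x))); last first.
  by move=> x _; rewrite /log_density expRB lnK ?posrE// mulrC.
by rewrite IntZ; bounded; rewrite -partition_funE mulVf// gt_eqF.
Qed.

Let Int_exp_log_ratio : Int S (fun x => expR (log_ratio f x)) = 1.
Proof.
rewrite S_density; last 2 first.
- by bounded.
- by move=> x _; exact: expR_ge0.
rewrite -[RHS]Int_link; apply: eq_Int => x _.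
by rewrite -expRD /log_ratio subrK.
Qed.

(** The likelihood ratio has mean 1, so adding e^t - 1 changes nothing in the mean but makes the
    integrand nonnegative and quadratic in t. *)
Lemma kl_remainder : kl f = Int S (fun x => expR (log_ratio f x) - 1 - log_ratio f x).
Proof.
rewrite IntB; bounded; rewrite IntB; bounded.
by rewrite Int_exp_log_ratio Int_prob_cst// subrr sub0r.
Qed.

Lemma kl_ge0 : 0 <= kl f.
Proof. by rewrite kl_remainder; apply: Int_ge0 => x _; exact: expR_remainder_ge0. Qed.

Lemma log_ratio_sqr_le_kl : Int S (fun x => log_ratio f x ^+ 2) <= 2 * T * kl f.
Proof.
have T0 : 0 < 2 * T by have := b0; lra.
rewrite kl_remainder -IntZ; bounded; apply: le_Int; bounded => x x01.
rewrite mulrC -ler_pdivrMr//; apply: expR_remainder_ge; last exact: normr_log_ratio_le.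
by have := b0; lra.
Qed.

(** With u = f - f0, the ratio of partition functions is the mean of e^u under [S]. Then ln y <= y -
    1 leaves the mean of e^u - 1 - u, and the normalizing constants need no separate estimate. *)
Lemma kl_le_sqr : kl f <= expR T * (expR (2 * b) * Int mu (fun x => (f x - f0 x) ^+ 2)).
Proof.
pose u x := f x - f0 x; have bu : bounded_mfun u by rewrite /u; bounded.
have uE x : u x = f x - f0 x by [].
clearbody u.
have Z0 := partition_fun_gt0 bf; have Z00 := partition_fun_gt0 bf0.
have Iu : Int S (fun x => expR (u x)) = partition_fun f / partition_fun f0.
  rewrite S_density; last 2 first.
  - by bounded.
  - by move=> x _; exact: expR_ge0.
  rewrite (@eq_Int _ _ _ (fun x => (partition_fun f0)^-1 * expR (f x))); last first.
    move=> x _; rewrite uE /log_density !expRB lnK ?posrE//.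
    by field; rewrite !gt_eqF// expR_gt0.
  by rewrite IntZ; bounded; rewrite -partition_funE mulrC.
have -> : kl f = ln (partition_fun f / partition_fun f0) - Int S u.
  rewrite ln_div ?posrE// /kl.
  rewrite (@eq_Int _ _ _ (fun x => u x - (ln (partition_fun f) - ln (partition_fun f0)))); last first.
    by move=> x _; rewrite /log_ratio /log_density uE; ring.
  by rewrite IntB; bounded; rewrite Int_prob_cst//; ring.
apply: (@le_trans _ _ (Int S (fun x => expR (u x) - 1 - u x))).
  rewrite IntB; bounded; rewrite IntB; bounded; rewrite Int_prob_cst// Iu lerB//.
  rewrite -[X in ln X](addrNK 1) addrC; apply: le_ln1Dx.
  by rewrite ltrBrDl subrr divr_gt0.
apply: (@le_trans _ _ (expR T * Int S (fun x => u x ^+ 2))).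
  rewrite -IntZ; bounded; apply: le_Int; bounded => x x01.
  rewrite mulrC; apply: expR_remainder_le; rewrite uE (le_trans (ler_normB _ _))//.
  by have := fb x01; have := f0b x01; have := b0; lra.
rewrite ler_wpM2l ?expR_ge0// [X in _ <= _ * X](@eq_Int _ _ _ (fun x => u x ^+ 2)).
  by apply: Int_prob_le; [bounded | move=> x _; exact: sqr_ge0].
by move=> x _; rewrite uE.
Qed.

(** The difference of densities is p_0 (e^t - 1) with t the log-ratio. After squaring, one p_0 is
    bounded by e^(2b) and the other turns Lebesgue measure into [S]. *)
Lemma link_sqr_dist_le : Int mu (fun x => (link f x - link f0 x) ^+ 2) <=
  expR (2 * b) * expR T ^+ 2 * (2 * T * kl f).
Proof.
have d0 : 0 <= expR (2 * b) * expR T ^+ 2 by rewrite mulr_ge0 ?exprn_ge0 ?expR_ge0.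
apply: le_trans _ (ler_wpM2l d0 log_ratio_sqr_le_kl).
rewrite S_density; [|by bounded|by move=> x _; exact: sqr_ge0].
rewrite -IntZ; bounded; rewrite !link_log_density//; apply: le_Int; bounded => x x01.
have -> : expR (log_density f x) - expR (log_density f0 x) =
    expR (log_density f0 x) * (expR (log_ratio f x) - 1).
  by rewrite mulrBr mulr1 -expRD; congr (expR _ - _); rewrite /log_ratio addrC subrK.
set q := expR (log_density f0 x); set t := log_ratio f x.
have q0 : 0 <= q by exact: expR_ge0.
have qb : q <= expR (2 * b).
  by rewrite ler_expR (le_trans (ler_norm _)) ?(normr_log_density_le bf0 f0b x01).
have et : `|expR t - 1| ^+ 2 <= (`|t| * expR T) ^+ 2.
  rewrite ler_pXn2r ?nnegrE ?mulr_ge0 ?expR_ge0//.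
  exact/normr_expR_sub1_le/normr_log_ratio_le.
rewrite real_normK ?num_real// exprMn real_normK ?num_real// in et.
rewrite exprMn expr2 -!mulrA.
have : q * (q * (expR t - 1) ^+ 2) <= expR (2 * b) * (q * (t ^+ 2 * expR T ^+ 2)).
  apply: ler_pM => //; first by rewrite mulr_ge0 ?sqr_ge0.
  by rewrite ler_wpM2l.
move=> /le_trans; apply; rewrite le_eqVlt; apply/orP; left; apply/eqP; ring.
Qed.

End bounded_log.

End kullback_leibler.

(** * The HAL sieve *)

Section hal_combinations.
Context {R : realType}.
Variables (k n : nat) (x : 'I_n -> R).
Implicit Types (beta : hal_index k n -> R).

Lemma bounded_hal_comb beta : bounded_mfun (hal_comb x beta).
Proof.
apply: bounded_mfun_sum => -[m|i] _ /=.
  rewrite (_ : (fun u => _) = fun u => beta (inl m) * ('X^m).[u]); first by bounded.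
  by apply/funext => u; rewrite hornerXn.
have h := bounded_truncated_power k (x i).
rewrite (_ : (fun u => _) = fun u => beta (inr i) * (k`!%:R * truncated_power k (x i) u)).
  by bounded.
apply/funext => u; rewrite /truncated_power; case: ifP => _; last by rewrite !mulr0.
by congr (_ * _); rewrite mulrCA mulfV ?mulr1// pnatr_eq0 -lt0n fact_gt0.
Qed.

Hypothesis x01 : forall i, 0 <= x i < 1.

Lemma normr_hal_basis_le (j : hal_index k n) u : 0 <= u < 1 -> `|hal_basis x j u| <= 1.
Proof.
move=> /andP[u0 u1]; case: j => [m|i] /=.
  by rewrite normrX ger0_norm// exprn_ile1// ltW.
case: ifP => [xu|_]; last by rewrite normr0.
have /andP[xi0 xi1] := x01 i.
by rewrite normrX ger0_norm ?subr_ge0// exprn_ile1 ?subr_ge0//; lra.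
Qed.

Lemma normr_hal_comb_le beta u : 0 <= u < 1 -> `|hal_comb x beta u| <= l1_norm beta.
Proof.
move=> u01; apply: le_trans (ler_norm_sum _ _ _) _; apply: ler_sum => j _.
by rewrite normrM ler_piMr// normr_hal_basis_le.
Qed.

Lemma hal_combB beta gam u :
  hal_comb x (fun j => beta j - gam j) u = hal_comb x beta u - hal_comb x gam u.
Proof. by rewrite /hal_comb -sumrB; apply: eq_bigr => j _; rewrite mulrBl. Qed.

Lemma l1_normB beta gam : l1_norm (fun j => beta j - gam j) <= l1_norm beta + l1_norm gam.
Proof. by rewrite /l1_norm -big_split/=; apply: ler_sum => j _; exact: ler_normB. Qed.

(** On a cell, knots to the left contribute polynomials and knots to the right nothing. A knot
    inside contributes at most |beta| 4^(-lk), so the local mass is the l^1-norm of the coefficients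
    of the knots in the cell. The constant [c] accommodates log-normalizers. *)
Lemma hal_comb_piecewise_poly beta c V : l1_norm beta <= V ->
  piecewise_poly_approx k (fun u => hal_comb x beta u + c) V.
Proof.
move=> bV l; exists (fun j => \sum_(i | x i \in cell l j) `|beta (inr i)|); split.
- by move=> j; apply: sumr_ge0.
- apply: le_trans bV; rewrite /l1_norm big_sumType/=.
  apply: (@le_trans _ _ (\sum_i `|beta (inr i)|)); last first.
    by rewrite lerDr sumr_ge0.
  under eq_bigr do rewrite big_mkcond.
  rewrite exchange_big/=; apply: ler_sum => i _.
  have [j jl xij] := cell_exists l (x01 i).
  rewrite (bigD1 (Ordinal jl))//= mem_set// big1 ?addr0// => j' jj'.
  rewrite memNset// => xij'; move/eqP: jj'; apply; exact/val_inj/(cell_inj xij' xij).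
move=> j jl.
pose p : {poly R} := \sum_(m < k.+1) beta (inl m) *: 'X^m +
  \sum_(i | 4 ^+ l * x i < j%:R) beta (inr i) *: ('X - (x i)%:P) ^+ k + c%:P.
exists p.
  have s1 : (size (\sum_(m < k.+1) beta (inl m) *: 'X^m : {poly R})%R <= k.+1)%N.
    apply: (leq_trans (size_sum _ _ _)); apply/bigmax_leqP => m _.
    by rewrite (leq_trans (size_scale_leq _ _))// size_polyXn.
  have s2 : (size (\sum_(i | 4 ^+ l * x i < j%:R) beta (inr i) *: ('X - (x i)%:P) ^+ k : {poly R})%R <= k.+1)%N.
    apply: (leq_trans (size_sum _ _ _)); apply/bigmax_leqP => i _.
    by rewrite (leq_trans (size_scale_leq _ _))// size_exp_XsubC.
  rewrite (leq_trans (size_polyD _ _))// geq_max (leq_trans (size_polyD _ _)) ?geq_max ?s1//.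
  by rewrite (leq_trans (size_polyC_leq1 _)).
move=> u /[dup] uj /andP[uj1 uj2]; have /andP[u0 u1] := cell_unit jl uj.
have c0 : (0 : R) < 4 ^+ l by rewrite exprn_gt0.
have -> : hal_comb x beta u + c - p.[u] = \sum_(i | x i \in cell l j) beta (inr i) * hal_basis x (inr i : hal_index k n) u.
  rewrite /p !hornerD hornerC !horner_sum /hal_comb big_sumType/=.
  rewrite (eq_bigr (fun m : 'I_k.+1 => (beta (inl m) *: 'X^m).[u])); last first.
    by move=> m _; rewrite hornerZ hornerXn.
  rewrite [\sum_(i | 4 ^+ l * x i < _) _](eq_bigr (fun i => beta (inr i) * hal_basis x (inr i : hal_index k n) u)); last first.
    move=> i xij; rewrite hornerZ horner_exp hornerXsubC /= ifT//.
    by rewrite -(ler_pM2l c0) ltW// (lt_le_trans xij).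
  rewrite [\sum_(i | x i \in _) _]big_mkcond [\sum_(i | _ < _) _]big_mkcond/=.
  set A := \sum_(m < _) _.
  rewrite (_ : forall y z : R, A + y + c - (A + z + c) = y - z); last by move=> y z; ring.
  rewrite -sumrB; apply: eq_bigr => i _.
  have [xj|xj] := boolP (x i \in cell l j).
    move: xj; rewrite inE => /andP[h1 h2]; rewrite ltNge h1/= subr0//.
  have [h|h] := ltP; first by rewrite subrr.
  rewrite subr0 ifF ?mulr0//; apply/negbTE; rewrite -ltNge -(ltr_pM2l c0).
  apply: (lt_le_trans uj2); rewrite leNgt; apply: contra xj => h'.
  by rewrite inE/= /cell/= h h'.
apply: le_trans (ler_norm_sum _ _ _) _; rewrite mulr_sumr; apply: ler_sum => i.
rewrite inE => /andP[h1 h2]; rewrite normrM mulrC ler_wpM2r//=.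
case: ifP => [xu|_]; last by rewrite normr0 inv_exp4_ge0.
rewrite normrX ger0_norm ?subr_ge0// lerXn2r ?nnegrE ?subr_ge0// ?invr_ge0 ?exprn_ge0//.
rewrite -(ler_pM2l c0) mulfV ?gt_eqF// mulrBr.
by rewrite lerBlDl (le_trans (ltW uj2))// -natr1 lerD2r.
Qed.

End hal_combinations.

Section hal_mle.
Context {R : realType}.
Variables (k n : nat) (x : 'I_n -> R) (M : R) (f : R -> R).
Hypothesis mle : is_hal_mle k x M f.

Lemma hal_mle_comb : exists2 beta : hal_index k n -> R, l1_norm beta <= M &
  f = hal_comb x beta.
Proof. by have [b0 _ [[b [_ bM] <-] _]] := mle; exists b. Qed.

(** The first-stage minimizer is itself supported on the indices it selects, so minimizing over
    these does at least as well as over the whole ball. *)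
Lemma hal_mle_min (beta : hal_index k n -> R) : l1_norm beta <= M ->
  emp_risk x f <= emp_risk x (hal_comb x beta).
Proof.
move=> bM; have [b0 [b0M b0min] [_ fmin]] := mle.
apply: le_trans (b0min _ bM); apply: fmin; exists b0 => //; split => // j.
by rewrite inE negbK => /eqP.
Qed.

End hal_mle.

(** * Bound for a fixed sample *)

(** Half of [D] is absorbed on the left; doubling what is left turns 3/2, 1/2 and 1 into the factors
    3, 1 and 2. *)
Lemma combine_bounds (R : realFieldType) (D D1 N G I s1 s2 t1 t2 t3 : R) :
  I <= (D + D1) / 2 -> s1 <= t2 -> s2 <= t3 -> G <= I + N / 2 + s1 + s2 ->
  D <= D1 + G -> D1 <= t1 -> D <= N + (3 * t1 + 2 * t2 + 2 * t3).
Proof. lra. Qed.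

Section deterministic_rate.
Context {R : realType}.
Notation mu := (@lebesgue_measure R).
Variable S : probability (measurableTypeR R) R.
Hypothesis S01 : S `[0%R, 1%R[%classic = 1%E.
Variables (k : nat) (f : nat -> R -> R) (W : R -> R) (M b : R).
Hypothesis bounded_f : forall i, (i <= k)%N -> bounded_mfun (f i).
Hypothesis f_int : forall i x, (i < k)%N -> 0 <= x < 1 ->
  f i x = f i 0 + running_int (f i.+1) x.
Hypothesis fW : variation_majorant (f k) W.
Hypothesis fM : ((\sum_(i < k.+1) `|f i 0|)%:E + TV (f k) <= M%:E)%E.
Notation f0 := (f 0%N).
Hypothesis S_density : forall g, bounded_mfun g -> (forall x, 0 <= x < 1 -> 0 <= g x) ->
  Int S g = Int mu (fun x => g x * expR (log_density f0 x)).
Hypothesis f0b : forall x, 0 <= x < 1 -> `|f0 x| <= b.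
Hypothesis M0 : 0 <= M.
Hypothesis Mb : M <= b.
Variables (Q : nat -> {poly R}) (B : R).
Hypothesis size_Q : forall i, (i < k.+1)%N -> (size (Q i) <= k.+1)%N.
Hypothesis Q_orth : forall i j, (i < k.+1)%N -> (j < k.+1)%N ->
  poly_int (Q i * Q j) = (i == j)%:R.
Hypothesis Q_repr : forall p : {poly R}, (size p <= k.+1)%N ->
  p = \sum_(i < k.+1) poly_int (p * Q i) *: Q i.
Hypothesis Q_le : forall i x, (i < k.+1)%N -> 0 <= x < 1 -> `|(Q i).[x]| <= B.

Variables (n : nat) (x : nat -> R) (l0 m : nat).
Hypothesis n0 : (0 < n)%N.
Hypothesis x01 : forall i, (i < n)%N -> 0 <= x i < 1.
Notation L := (l0 + m)%N.
Notation T := (4 * b + 2).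
Notation low := (expR (- (2 * b))).
Notation high := (expR (2 * b)).
Hypothesis cells : forall j, (j < 4 ^ L)%N ->
  `|emp_dev S n x (\1_(cell L j))| <= low / 2 * 4 ^- L.

Let Sfin : (S `[0%R, 1%R[%classic < +oo)%E.
Proof. exact: unit_interval_prob_fin. Qed.

Let bf0 : bounded_mfun f0. Proof. exact: bounded_f. Qed.

Let b0 : 0 <= b := le_trans M0 Mb.

Let bi j : bounded_mfun (\1_(cell L j) : R -> R).
Proof. exact: bounded_mfun_indic (@measurable_cell R L j). Qed.

Let indic_ge0 j (y : R) : 0 <= (\1_(cell L j) y : R).
Proof. by rewrite indicE. Qed.

Let h0 : 0 < 4 ^- L :> R. Proof. by rewrite invr_gt0 exprn_gt0. Qed.

(** An empty cell would deviate by its whole mass, at least [low * 4 ^- L], which is twice what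
    [cells] allows. *)
Lemma cell_nonempty j : (j < 4 ^ L)%N -> exists i : 'I_n, (cell L j : set R) (x i).
Proof.
move=> jL; apply: contrapT => /forallNP h.
have := cells jL; rewrite /emp_dev big1; last first.
  by move=> i _; rewrite indicE memNset//; exact: h.
rewrite mulr0 sub0r normrN => /(le_trans (ler_norm _)).
have := Int_prob_ge bf0 S_density f0b (bi j) (fun y _ => indic_ge0 j y).
rewrite Int_cell// => h1 h2.
have l_gt0 : 0 < low * 4 ^- L by rewrite mulr_gt0// expR_gt0.
by move: (le_trans h1 h2) l_gt0; rewrite mulrAC; lra.
Qed.

Lemma cell_mass_le j : (j < 4 ^ L)%N ->
  cell_mass S n x L j <= (2 * high + low) * 4 ^- L.
Proof.
move=> jL; have := cells jL => /(le_trans (ler_norm _)); rewrite /emp_dev /cell_mass.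
have := Int_prob_le bf0 S_density f0b (bi j) (fun y _ => indic_ge0 j y).
rewrite Int_cell//; set A := n%:R^-1 * _; set I := Int S _ => h1 h2.
have l_gt0 : 0 < low * 4 ^- L by rewrite mulr_gt0// expR_gt0.
rewrite mulrDl -mulrA; move: h2; rewrite mulrAC => h2; lra.
Qed.

Let xo (i : 'I_n) := x i.
Let xo01 i : 0 <= xo i < 1. Proof. exact: x01. Qed.

Let V := W 1 - W 0.

Lemma sieve_approximation : exists2 beta : hal_index k n -> R, l1_norm beta <= M &
  kl S f0 (hal_comb xo beta) <= expR T * high * V ^+ 2 * 4 ^- L.
Proof.
have [iota iotaP] := choice (fun j : 'I_(4 ^ L) => cell_nonempty (ltn_ord j)).
have [beta bM bE] := @spline_hal_comb R k f L (fun j => xo (iota j)) n xo iota M (fun=> erefl) fM.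
exists beta => //.
have hb := bounded_hal_comb xo beta.
have bb y : 0 <= y < 1 -> `|hal_comb xo beta y| <= b.
  by move=> y01; rewrite (le_trans (normr_hal_comb_le xo01 _ y01))// (le_trans bM).
apply: le_trans (kl_le_sqr S01 bf0 S_density f0b hb bb) _.
rewrite [leRHS](_ : _ = expR T * (high * (V ^+ 2 * 4 ^- L))); last by ring.
rewrite ler_wpM2l ?expR_ge0// ler_wpM2l ?expR_ge0//.
rewrite (@eq_Int _ _ _ (fun y => (spline k f (fun j => xo (iota j)) k y - f0 y) ^+ 2)).
  exact: (spline_sqr bounded_f f_int fW iotaP).
by move=> y /andP[y0 _]; rewrite bE.
Qed.

Variable fn : R -> R.
Hypothesis mle : is_hal_mle k xo M fn.

Lemma bounded_hal_mle : bounded_mfun fn.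
Proof. by have [beta _ ->] := hal_mle_comb mle; exact: bounded_hal_comb. Qed.

Lemma normr_hal_mle_le y : 0 <= y < 1 -> `|fn y| <= b.
Proof.
have [beta bM ->] := hal_mle_comb mle => y01.
by rewrite (le_trans (normr_hal_comb_le xo01 _ y01))// (le_trans bM).
Qed.

(* The empirical comparison of [fn] with a competitor turns into the empirical
   process at the difference of the log-densities. *)
Lemma basic_inequality (beta : hal_index k n -> R) : l1_norm beta <= M ->
  kl S f0 fn <= kl S f0 (hal_comb xo beta) +
    emp_dev S n x (fun y => log_density fn y - log_density (hal_comb xo beta) y).
Proof.
move=> bM; have bfn := bounded_hal_mle; have hb := bounded_hal_comb xo beta.
have l1 := bounded_log_density bfn; have l2 := bounded_log_density hb.
have l3 := bounded_log_density bf0.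
have := hal_mle_min mle bM; rewrite /emp_risk !loss_log_density// !sumrN !mulrN lerN2.
rewrite /emp_dev /kl /log_ratio; move: l1 l2 l3; rewrite -/xo.
set lf := log_density fn; set lt := log_density (hal_comb xo beta); set lo := log_density f0.
clearbody lf lt lo => l1 l2 l3 h.
rewrite (@IntB _ S Sfin _ _ l1 l3) (@IntB _ S Sfin _ _ l2 l3) (@IntB _ S Sfin _ _ l1 l2).
rewrite sumrB mulrBr; move: h; rewrite /xo; lra.
Qed.

(** Two log-densities of the sieve differ by a HAL combination, whose coefficients have l^1-norm at
    most 2 M, plus a constant. *)
Lemma log_density_difference_approx (beta : hal_index k n -> R) : l1_norm beta <= M ->
  piecewise_poly_approx k
    (fun y => log_density fn y - log_density (hal_comb xo beta) y) (2 * M).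
Proof.
move=> bM; have [gam gM ->] := hal_mle_comb mle.
pose c := ln (partition_fun (hal_comb xo beta)) - ln (partition_fun (hal_comb xo gam)).
have -> : (fun y => log_density (hal_comb xo gam) y - log_density (hal_comb xo beta) y) =
    fun y => hal_comb xo (fun j => gam j - beta j) y + c.
  by apply/funext => y; rewrite hal_combB /log_density /c; ring.
apply: hal_comb_piecewise_poly => //.
by apply: le_trans (l1_normB _ _) _; lra.
Qed.

Definition noise_const := (40 * T) / low.
Definition rate_const := 3 * (expR T * high * V ^+ 2) +
   2 * (8 * detail_const k B * M) +
   2 * (2 * proj_const k B * M * (2 * high + low)).

Lemma kl_hal_mle_le : (2 ^- l0 * (4 ^- l0) ^+ k) / Num.sqrt n%:R <= 4 ^- L :> R ->
  kl S f0 fn <= noise_const * coefficient_noise k Q S n x l0 m + rate_const * 4 ^- L.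
Proof.
move=> scale; have [beta bM klb] := sieve_approximation.
have bfn := bounded_hal_mle; have hb := bounded_hal_comb xo beta.
have bb y : 0 <= y < 1 -> `|hal_comb xo beta y| <= b.
  by move=> y01; rewrite (le_trans (normr_hal_comb_le xo01 _ y01))// (le_trans bM).
have l1 := bounded_log_density bfn; have l2 := bounded_log_density hb.
have T0 : 0 < T by have := b0; lra.
have low0 : 0 < low by exact: expR_gt0.
pose g y := log_density fn y - log_density (hal_comb xo beta) y.
have bg : bounded_mfun g by exact: bounded_mfunB.
have gV := log_density_difference_approx bM.
(* Chosen so that 10 e times the factor 4 T / low of [gsq] is 1/2. Then 1 / (4 e) = 20 T / low, and
   doubling it gives [noise_const]. *)
pose e := low / (80 * T).
have e0 : 0 < e by rewrite divr_gt0// mulr_gt0.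
have M2 : 0 <= 2 * M by rewrite mulr_ge0.
have := emp_dev_le size_Q Q_orth Q_repr Q_le S01 n0 x01 bg gV e0 M2 cell_mass_le.
have := basic_inequality bM.
set D := kl S f0 fn; set D1 := kl S f0 (hal_comb xo beta); rewrite -/g; rewrite -/D1 in klb.
move=> /le_trans/(_ (lerD (lexx D1) (ler_norm _))) basic dev.
(* [g] is the difference of the log-ratios of both densities to the truth, each controlled in L^2(S)
   by its divergence; [low] passes from [S] to Lebesgue measure. *)
have gsq : Int mu (fun y => g y ^+ 2) <= low^-1 * (4 * T * (D + D1)).
  rewrite ler_pdivlMl//.
  apply: le_trans (Int_prob_ge bf0 S_density f0b _ _) _; [by bounded|by move=> y _; exact: sqr_ge0|].
  have lr1 := bounded_log_ratio bf0 bfn; have lr2 := bounded_log_ratio bf0 hb.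
  apply: (@le_trans _ _ (Int S (fun y => 2 * log_ratio f0 fn y ^+ 2 + 2 * log_ratio f0 (hal_comb xo beta) y ^+ 2))).
    apply: le_Int => //; [by bounded|by bounded|] => y _.
    have -> : g y = log_ratio f0 fn y - log_ratio f0 (hal_comb xo beta) y.
      by rewrite /g /log_ratio; ring.
    set p := log_ratio f0 fn y; set q := log_ratio f0 (hal_comb xo beta) y.
    rewrite -subr_ge0.
    have -> : 2 * p ^+ 2 + 2 * q ^+ 2 - (p - q) ^+ 2 = (p + q) ^+ 2 by ring.
    exact: sqr_ge0.
  rewrite IntD//; [|by bounded|by bounded].
  rewrite IntZ//; last by bounded.
  rewrite IntZ//; last by bounded.
  have h1 := log_ratio_sqr_le_kl S01 bf0 S_density f0b bfn normr_hal_mle_le.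
  have h2 := log_ratio_sqr_le_kl S01 bf0 S_density f0b hb bb.
  rewrite -/D in h1; rewrite -/D1 in h2.
  have -> : 4 * T * (D + D1) = 2 * (2 * T * D) + 2 * (2 * T * D1) by ring.
  by rewrite lerD// ler_wpM2l.
have half : 10 * e * Int mu (fun y => g y ^+ 2) <= (D + D1) / 2.
  have e10 : 0 <= 10 * e by rewrite mulr_ge0// ltW.
  apply: le_trans (ler_wpM2l e10 gsq) _.
  rewrite [leLHS](_ : _ = (D + D1) / 2)// /e; field.
  by rewrite !gt_eqF.
have noiseE (N : R) : N / (4 * e) = noise_const * N / 2.
  by rewrite /e /noise_const; field; rewrite !gt_eqF.
rewrite noiseE in dev.
have scale2 : 4 * detail_const k B / Num.sqrt n%:R * (2 ^- l0 * (4 ^- l0) ^+ k) * (2 * M) <=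
    8 * detail_const k B * M * 4 ^- L.
  have dM : 0 <= 8 * detail_const k B * M.
    by rewrite mulr_ge0// mulr_ge0// (detail_const_ge0 Q_le).
  apply: le_trans (ler_wpM2l dM scale).
  by rewrite le_eqVlt; apply/orP; left; apply/eqP; ring.
have fine : proj_const k B * (4 ^- L) ^+ k * (2 * M) * ((2 * high + low) * 4 ^- L) <=
    2 * proj_const k B * M * (2 * high + low) * 4 ^- L.
  have pM : 0 <= 2 * proj_const k B * M * (2 * high + low) * 4 ^- L.
    by rewrite mulr_ge0 ?(ltW h0)// mulr_ge0// ?addr_ge0 ?mulr_ge0 ?expR_ge0 ?(proj_const_ge0 Q_le).
  have h1 : (4 ^- L) ^+ k <= 1 :> R.
    by rewrite exprn_ile1 ?(ltW h0)// invf_le1 ?exprn_gt0// exprn_ege1//; lra.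
  rewrite [leLHS](_ : _ = (2 * proj_const k B * M * (2 * high + low) * 4 ^- L) * (4 ^- L) ^+ k); last by ring.
  by rewrite ler_piMr.
have -> : rate_const * 4 ^- L = 3 * (expR T * high * V ^+ 2 * 4 ^- L) +
    2 * (8 * detail_const k B * M * 4 ^- L) +
    2 * (2 * proj_const k B * M * (2 * high + low) * 4 ^- L).
  by rewrite /rate_const; ring.
move: half scale2 fine dev basic klb {scale gsq noiseE}.
set t1 := expR T * _ * _ * _; set t2 := 8 * _ * _ * _; set t3 := 2 * _ * _ * _ * _.
set N := noise_const * _.
set G := `|emp_dev _ _ _ _|; set I := 10 * e * _.
set s1 := 4 * _ * _ * _ * _; set s2 := _ * (4 ^- L) ^+ k * _ * _.
move=> half h1 h2 h3 h4 h5.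
by move: half h1 h2 h3 h4 h5; exact: combine_bounds.
Qed.

End deterministic_rate.

(** * The law of the observations *)

Section borel_law.
Context {R : realType}.
Notation mu := (@lebesgue_measure R).

Let to_borel (x : R) : measurableTypeR R := x.

Let measurable_to_borel : measurable_fun setT to_borel.
Proof. by move=> _ A mA; rewrite setTI. Qed.

Let to_borel_isMeasurableFun := isMeasurableFun.Build _ _ _ _ _ measurable_to_borel.
Let to_borel_mfun : {mfun R >-> measurableTypeR R} := HB.pack to_borel to_borel_isMeasurableFun.

(* [measurableTypeR R] and [R] have the same Borel sets but distinct displays. *)
Definition borel_law (P0 : probability R R) : probability (measurableTypeR R) R :=
  distribution P0 to_borel_mfun.

Lemma borel_lawE (P0 : probability R R) (A : set R) : borel_law P0 A = P0 A.
Proof. by []. Qed.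

Lemma integral_borel_law (P0 : probability R R) (g : R -> \bar R) :
  measurable_fun setT g -> P0.-integrable setT g ->
  (\int[borel_law P0]_x g x = \int[P0]_x g x)%E.
Proof. by move=> mg ig; rewrite integral_distribution. Qed.

Variables (P0 : probability R R) (f0 : R -> R).
Hypothesis bf0 : bounded_mfun f0.
Hypothesis P0_density : has_density P0 (link f0).
Notation S := (borel_law P0).

Lemma borel_law_unit : S `[0%R, 1%R[%classic = 1%E.
Proof.
have mC : measurable (~` `[0%R, 1%R[%classic : set (measurableTypeR R)).
  exact: measurableC.
have SC : S (~` `[0%R, 1%R[%classic) = 0%E.
  rewrite borel_lawE P0_density//; apply: (@integral_Sset1 _ _ _ 1).
  move=> x [] /=; rewrite !in_itv/= => /negP + /andP[x0 x1].
  by rewrite x0/= -leNgt => x1'; apply/eqP; rewrite eq_le x1 x1'.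
have := probability_setC S mC; rewrite setCK SC sube0.
exact.
Qed.

Lemma law_one : P0 [set 1] = 0%E.
Proof.
rewrite P0_density; last exact: measurable_set1.
by apply: (@integral_Sset1 _ _ _ 1) => x [].
Qed.

Let measurable_closed g : bounded_mfun g ->
  @measurable_fun _ _ (measurableTypeR R) _ `[0%R, 1%R] g.
Proof. by case => + _; exact: (measurable_fun_itv_bndo_bndcP _ _ _).1. Qed.

(** Risks are integrals over the closed interval; the extra point 1 is null because the law has a
    density. *)
Lemma Rintegral_closed_law g : bounded_mfun g ->
  \int[P0]_(x in `[0%R, 1%R]) g x = Int S g.
Proof.
move=> bg; congr fine.
pose G := (EFin \o g) \_ `[0%R, 1%R[%classic.
have mG : @measurable_fun _ _ (measurableTypeR R) _ setT G.
  by apply/(measurable_restrictT _ _).1 => //; apply/measurable_EFinP; case: bg.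
have mG' : @measurable_fun _ _ (measurableTypeR R) _ setT ((EFin \o g) \_ `[0%R, 1%R]%classic).
  apply/(measurable_restrictT _ _).1 => //; apply/measurable_EFinP.
  exact: measurable_closed.
have iG : P0.-integrable setT G.
  have [_ [C gC]] := bg.
  apply: (@le_integrable _ _ _ _ setT measurableT _ (cst `|C|%:E)) => //.
    move=> x _; rewrite /G patchE; case: ifPn => [|_]; last by rewrite abse0 lee_fin.
    rewrite inE/= in_itv/= => /gC gx; rewrite lee_fin normr_id.
    by rewrite (le_trans gx)// ler_norm.
  exact: finite_measure_integrable_cst.
rewrite integral_mkcond [RHS]integral_mkcond -/G integral_borel_law//.
apply: ae_eq_integral => //.
exists [set 1]; split; [exact: measurable_set1|exact: law_one|].
move=> x /= /not_implyP[_]; rewrite /G !patchE.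
apply: contra_notP => x1; congr (if _ then _ else _).
apply/idP/idP; rewrite !inE/= !in_itv/= => /andP[x0 xl]; rewrite x0/=.
  by rewrite lt_neqAle xl andbT; apply/eqP.
exact: ltW.
Qed.

Lemma borel_law_density g : bounded_mfun g -> (forall x, 0 <= x < 1 -> 0 <= g x) ->
  Int S g = Int mu (fun x => g x * expR (log_density f0 x)).
Proof.
move=> bg g0; congr fine; have bl := bounded_log_density bf0.
pose h := (fun x => expR (log_density f0 x)) \_ (`[0%R, 1%R[%classic : set R).
have mh : @measurable_fun _ _ (measurableTypeR R) _ setT h.
  apply/(measurable_restrictT _ _).1 => //.
  have : bounded_mfun (fun x => expR (log_density f0 x)) by bounded.
  by case.
have h0 x : 0 <= h x.
  by rewrite /h patchE; case: ifP => // _; exact: expR_ge0.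
have hS (A : set (measurableTypeR R)) : measurable A ->
    (\int[mu]_x (h x * \1_A x)%:E = S A)%E.
  move=> mA; rewrite borel_lawE P0_density// link_log_density//.
  rewrite (@ge0_negligible_integral _ (measurableTypeR R) _ mu (A `&` `[0%R, 1%R]%classic) ([set 1] : set R))//; last 3 first.
  - exact: measurableI.
  - apply/measurable_EFinP.
    have bh : bounded_mfun (fun x => expR (log_density f0 x)) by bounded.
    by apply: measurable_funS (measurable_closed bh) => //; exact: subIsetr.
  - exact: lebesgue_measure_set1.
  rewrite [RHS]integral_mkcond; apply: eq_integral => x _.
  rewrite /h !patchE indicE.
  have -> : (x \in ((A `&` `[0%R, 1%R]%classic) `\` [set 1] : set R)) = (x \in (`[0%R, 1%R[%classic : set R)) && (x \in A).
    apply/idP/andP; rewrite !inE/= !in_itv/=.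
      move=> [[Ax /andP[x0 x1]] xn1]; split => //.
      by rewrite x0/= lt_neqAle x1 andbT; exact/eqP.
    move=> [/andP[x0 x1] Ax]; split; last by apply/eqP; rewrite lt_eqF.
    by split => //; rewrite x0 ltW.
  by case: (x \in _) => /=; case: (x \in A); rewrite ?mulr1 ?mulr0 ?mul0r.
pose G := (EFin \o g) \_ `[0%R, 1%R[%classic.
have mG : @measurable_fun _ _ (measurableTypeR R) _ setT G.
  by apply/(measurable_restrictT _ _).1 => //; apply/measurable_EFinP; case: bg.
have G0 x : (0 <= G x)%E.
  rewrite /G patchE; case: ifPn => //; rewrite inE/= in_itv/= => /g0.
  by rewrite lee_fin.
rewrite [LHS]integral_mkcond -/G.
rewrite -(@ge0_integral_transfer _ _ _ _ _ mu S id h _ mh h0 hS G mG G0)//.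
rewrite [RHS]integral_mkcond; apply: eq_integral => x _; rewrite /G /h !patchE.
by case: (x \in _); rewrite ?mul0e// EFinM.
Qed.

Lemma risk_borel_law f : bounded_mfun f -> risk P0 f = - Int S (log_density f).
Proof.
move=> bf; have bl := bounded_log_density bf.
have bn : bounded_mfun (fun x => - log_density f x) by bounded.
rewrite /risk loss_log_density// Rintegral_closed_law//.
rewrite (@eq_Int _ _ _ (fun x => -1 * log_density f x)); last by move=> x _; rewrite mulN1r.
by rewrite IntZ ?mulN1r//; exact: (unit_interval_prob_fin borel_law_unit).
Qed.

Lemma d0_kl f : bounded_mfun f -> d0 P0 f f0 = kl S f0 f.
Proof.
move=> bf; rewrite /d0 !risk_borel_law// /kl.
have l1 := bounded_log_density bf; have l2 := bounded_log_density bf0.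
rewrite (@eq_Int _ _ (log_ratio f0 f) (fun x => log_density f x - log_density f0 x))//.
by rewrite (@IntB _ S (unit_interval_prob_fin borel_law_unit) _ _ l1 l2); ring.
Qed.

Lemma L2dist_link f : bounded_mfun f ->
  L2dist (link f) (link f0) =
    ((Num.sqrt (Int mu (fun x => (link f x - link f0 x) ^+ 2)))%:E).
Proof.
move=> bf; set p := link f; set q := link f0.
have bp : bounded_mfun p.
  by rewrite /p link_log_density//; have bl := bounded_log_density bf; bounded.
have bq : bounded_mfun q.
  by rewrite /q link_log_density//; have bl := bounded_log_density bf0; bounded.
have bs : bounded_mfun (fun x => (p x - q x) ^+ 2) by clearbody p q; bounded.
have -> : L2dist p q = ((\int[mu]_(x in `[0%R, 1%R]) ((p x - q x) ^+ 2)%:E) `^ 2^-1)%E.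
  rewrite /L2dist unlock; congr (_ `^ _)%E; rewrite [RHS]integral_mkcond.
  apply: eq_integral => x _; rewrite /= !patchE; case: ifP => _; last first.
    by rewrite normr0 powR0.
  by rewrite powR_mulrn// real_normK ?num_real.
rewrite -integral_itv_bndo_bndc; last by apply/measurable_EFinP; case: bs.
rewrite Int_fineK//; last exact: lebesgue_measure_unit_fin.
by rewrite /= powR12_sqrt// Int_ge0// => x _; exact: sqr_ge0.
Qed.

End borel_law.

(** * Rates *)

Section class_unpacking.
Context {R : realType}.
Notation mu := (@lebesgue_measure R).

Lemma TV_ge0 (f : R -> R) : (0 <= TV f)%E.
Proof. by apply: le_trans (increments_le_TV f (ltn0Sn 0)); rewrite lee_fin sumr_ge0. Qed.

Lemma D0_majorant (U : R) (f : R -> R) : D0 U f -> exists W, variation_majorant f W.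
Proof.
move=> [_ [nu nuf] _]; have [A [B AB]] := Hahn_decomposition nu.
by have [W fW _] := generates_majorant AB nuf; exists W.
Qed.

Lemma D_unpack k (M : R) (f0 : R -> R) : D k M f0 -> exists (f : nat -> R -> R) W,
  [/\ f 0%N = f0, forall i, (i <= k)%N -> bounded_mfun (f i),
    forall i x, (i < k)%N -> 0 <= x < 1 -> f i x = f i 0 + running_int (f i.+1) x,
    variation_majorant (f k) W &
    ((\sum_(i < k.+1) `|f i 0|)%:E + TV (f k) <= M%:E)%E].
Proof.
move=> [f [f0E fD0 fder fM]]; have [W fW] := D0_majorant (fD0 k (leqnn k)).
have bf i : (i <= k)%N -> bounded_mfun (f i).
  by move=> ik; have [V fV] := D0_majorant (fD0 i ik); exact: majorant_bounded fV.
exists f, W; split => // i x ik x01.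
exact: LRN_derivative_running_int (fder i ik) (bf _ ik) x01.
Qed.

Lemma D_bound_ge0 k (M : R) (f : nat -> R -> R) :
  ((\sum_(i < k.+1) `|f i 0|)%:E + TV (f k) <= M%:E)%E -> 0 <= M.
Proof.
by rewrite -lee_fin; apply: le_trans; rewrite adde_ge0 ?TV_ge0// lee_fin sumr_ge0.
Qed.

End class_unpacking.

Lemma iid_rectangle (R : realType) d (T : measurableType d) (P : probability T R)
  (X : nat -> {RV P >-> R}) (P0 : probability R R) : iid X P0 ->
  forall n (A : nat -> set R), (forall i, measurable (A i)) ->
  P (\bigcap_(i in `I_n) (X i @^-1` A i)) = (\prod_(i < n) P0 (A i))%E.
Proof.
move=> [indep dist] n A mA; pose J := [fset i in iota 0 n]%fset.
have <- : [set` J] = `I_n by apply/seteqP; split => i /=; rewrite !inE/= mem_iota add0n.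
rewrite indep// (perm_big (iota 0 n)); last first.
  apply: uniq_perm; rewrite ?fset_uniq ?iota_uniq// => i.
  by rewrite !inE.
rewrite -(big_mkord xpredT (fun i => P0 (A i))) /index_iota subn0.
by apply: eq_bigr => i _; exact: dist.
Qed.

Section rates.
Context {R : realType}.
Variables (k n l0 : nat).
(* With [l0] the integer part of the logarithm of [n] in base [4 ^ (2 * k + 3)],
   [4 ^ L] is of order [n `^ ((2 * k + 2) / (2 * k + 3))] and [4 ^ l0] of order
   [n `^ (1 / (2 * k + 3))]. *)
Notation L := (l0 + (2 * k + 1) * l0)%N.
Lemma level_exponent : ((2 * k + 3) * l0 = L + l0)%N.
Proof. by rewrite !mulnDl; lia. Qed.

Hypothesis nlow : ((4 ^ (2 * k + 3)) ^ l0 <= n)%N.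

Let n_ge : (4 : R) ^+ (L + l0) <= n%:R.
Proof. by rewrite -level_exponent -natrX ler_nat expnM. Qed.

Let n_gt0 : (0 : R) < n%:R. Proof. exact: lt_le_trans (exprn_gt0 _ _) n_ge. Qed.

Lemma cells_le_sample : (4 ^ L <= n)%N.
Proof.
by apply: leq_trans nlow; rewrite -expnM level_exponent leq_exp2l// leq_addr.
Qed.

(** The exponents balance exactly: the numerator is 2^(-(2k+1) l0), sqrt n is at least 2^((2k+3)
    l0), and 4^-L is 2^(-(4k+4) l0). *)
Lemma bias_scale_le : (2 ^- l0 * (4 ^- l0) ^+ k) / Num.sqrt n%:R <= 4 ^- L :> R.
Proof.
have s0 : (0 : R) < Num.sqrt n%:R by rewrite sqrtr_gt0.
have s_ge : 2 ^+ (L + l0) <= Num.sqrt n%:R :> R.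
  rewrite -(@ler_pXn2r _ 2)// ?nnegrE ?exprn_ge0 ?sqrtr_ge0//.
  by rewrite sqr_sqrtr ?ler0n// expr2 two_four.
rewrite ler_pdivrMr//; apply: le_trans (ler_wpM2l _ s_ge); last by rewrite invr_ge0 exprn_ge0.
pose u : R := 2 ^+ l0; pose v := u ^+ k.
have u0 : u != 0 by rewrite expf_neq0.
have v0 : v != 0 by rewrite expf_neq0.
have e2 : 2 ^+ L = u ^+ 2 * v ^+ 2 :> R.
  by rewrite /v /u -!exprM -exprD; congr (_ ^+ _); lia.
have e4 : (4 ^- l0) ^+ k = v ^- 2 :> R.
  by rewrite -two_four -expr2 -/u exprVn -exprM mulnC exprM.
rewrite [leLHS](_ : _ = 4 ^- L * 2 ^+ (L + l0))//.
by rewrite e4 -two_four (exprD _ L l0) e2 -/u; field; rewrite u0 v0.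
Qed.

Lemma coefficient_scale_le : 4 ^+ l0 / n%:R <= 4 ^- L :> R.
Proof.
rewrite ler_pdivrMr// ler_pdivlMl ?exprn_gt0//.
by rewrite -exprD.
Qed.

(** The factor [4 ^+ (2 * k + 2)] is the price of rounding the level down to the integer [l0]. *)
Lemma rate_scale_le : (n < (4 ^ (2 * k + 3)) ^ l0.+1)%N ->
  4 ^- L <= 4 ^+ (2 * k + 2) * n%:R `^ (- ((2 * k + 2)%:R / (2 * k + 3)%:R)) :> R.
Proof.
move=> nhigh; rewrite powRN.
set q : R := _ / _.
have q0 : 0 <= q by rewrite divr_ge0.
have h : n%:R `^ q <= 4 ^+ ((2 * k + 2) * l0.+1).
  have -> : 4 ^+ ((2 * k + 2) * l0.+1) = (4 ^+ ((2 * k + 3) * l0.+1)) `^ q :> R.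
    rewrite -!powR_mulrn// -powRrM; congr (_ `^ _).
    by rewrite /q !natrM [RHS]mulrC -mulrA mulKf// pnatr_eq0 addnC.
  rewrite ge0_ler_powR ?nnegrE ?exprn_ge0 ?ler0n//.
  by rewrite -natrX ler_nat expnM ltnW.
rewrite ler_pdivlMr ?powR_gt0// ler_pdivrMl ?exprn_gt0//.
apply: (le_trans h); rewrite -exprD.
by rewrite ler_weXn2l//; [lra | lia].
Qed.

End rates.

Section main.
Context {R : realType} {d : measure_display} {T : measurableType d}.
Notation mu := (@lebesgue_measure R).
Variables (P : probability T R) (X : nat -> {RV P >-> R}) (P0 : probability R R).
Variables (k : nat) (M : R) (f0 : R -> R) (fn : nat -> T -> R -> R).
Hypothesis X_iid : iid X P0.
Hypothesis P0_density : has_density P0 (link f0).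
Hypothesis f0_class : D k M f0.
Hypothesis mle : forall n w, (0 < n)%N -> is_hal_mle k (fun i : 'I_n => X i w) M (fn n w).
Notation S := (borel_law P0).
Notation rate n := (n%:R `^ (- ((2 * k + 2)%:R / (2 * k + 3)%:R)) : R).

Let sample_in_unit n : P (\bigcap_(i in `I_n) (X i @^-1` `[0%R, 1%R[%classic)) = 1%E.
Proof.
have S01 := borel_law_unit P0_density.
rewrite (@iid_rectangle _ _ _ _ _ _ X_iid n (fun=> `[0%R, 1%R[%classic))// big1//.
Qed.

Let bf0 : bounded_mfun f0.
Proof. by have [f [W [<- bf _ _ _]]] := D_unpack f0_class; exact: bf. Qed.

(** Both rates are read off one exceptional event. It is built from the sample alone, hence
    measurable, and dominates the outer probabilities in the conclusion. *)
Lemma hal_mle_kl_rate eps : 0 < eps -> exists2 K : R, 0 <= K &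
  \forall n \near \oo, exists E : set T, [/\ measurable E, (P E <= eps%:E)%E &
    forall w, ~ E w -> (0 < n)%N /\ [/\ bounded_mfun (fn n w),
      kl S f0 (fn n w) <= K * rate n &
      Int mu (fun x => (link (fn n w) x - link f0 x) ^+ 2) <= K * rate n]].
Proof.
move=> eps0; have [f [W [f0E bf f_int fW fM]]] := D_unpack f0_class.
have M0 := D_bound_ge0 fM.
(* [M] bounds every function of the sieve and [b0] bounds the truth. *)
have [_ [b0 f0b0]] := bf0; pose b := Num.max M b0.
have f0b x : 0 <= x < 1 -> `|f 0%N x| <= b.
  by move=> x01; rewrite f0E (le_trans (f0b0 x x01))// le_max lexx orbT.
have Mb : M <= b by rewrite le_max lexx.
have S01 : S `[0%R, 1%R[%classic = 1%E by exact: (borel_law_unit P0_density).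
have S_dens g : bounded_mfun g -> (forall x, 0 <= x < 1 -> 0 <= g x) ->
    Int S g = Int mu (fun x => g x * expR (log_density (f 0%N) x)).
  by rewrite f0E; exact: borel_law_density.
have [Q [size_Q Q_orth Q_repr]] := @orthonormal_polys R k.+1.
pose B := \sum_(i < k.+1) \sum_(j < size (Q i)) `|(Q i)`_j|.
have Q_le i x : (i < k.+1)%N -> 0 <= x < 1 -> `|(Q i).[x]| <= B.
  move=> ik x01; apply: le_trans (normr_horner_le (Q i) x01) _.
  rewrite /B (bigD1 (Ordinal ik))//= lerDl; apply: sumr_ge0 => j _.
  exact: sumr_ge0.
pose C := expR (2 * b); have C0 : 0 <= C by exact: expR_ge0.
have SC g : bounded_mfun g -> (forall x, 0 <= x < 1 -> 0 <= g x) -> Int S g <= C * Int mu g.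
  have bf00 : bounded_mfun (f 0%N) by exact: bf.
  move=> bg g0; exact: (Int_prob_le bf00 S_dens f0b bg g0).
pose low := expR (- (2 * b)); have low0 : 0 < low by exact: expR_gt0.
(* Markov at order 2p over 4^L cells costs 4^L / (n 4^-L)^p up to a constant. As n 4^-L >= 4^l0 and
   p l0 = L + l0, this is at most 4^-l0, which tends to 0. *)
pose p := (2 * k + 3)%N.
pose Kn := 37 * k.+1%:R * (moment_const C 1 B + moment_const C 3 B).
have Kn0 : 0 <= Kn.
  by rewrite /Kn mulr_ge0// ?mulr_ge0// addr_ge0// moment_const_ge0.
pose Kc := moment_const C p 1 / (low / 2) ^+ (2 * p).
have Kc0 : 0 <= Kc by rewrite divr_ge0 ?moment_const_ge0// exprn_ge0// divr_ge0// ltW.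
(* Makes the noise event of probability at most eps / 2; the added 1 keeps [a] positive whatever
   [Kn] is. *)
pose a := 2 * (Kn + 1) / eps.
have a0 : 0 < a by rewrite divr_gt0// mulr_gt0// ltr_wpDl.
pose K1 := (noise_const b * a + rate_const k W M b B) * 4 ^+ (2 * k + 2).
pose K2 := expR (2 * b) * expR (4 * b + 2) ^+ 2 * (2 * (4 * b + 2) * K1).
have b_ge0 : 0 <= b := le_trans M0 Mb.
have T0 : 0 <= 4 * b + 2 by rewrite addr_ge0// mulr_ge0.
have noise0 : 0 <= noise_const b.
  by rewrite /noise_const divr_ge0 ?expR_ge0// mulr_ge0.
have rate0 : 0 <= rate_const k W M b B.
  rewrite /rate_const !addr_ge0//.
  - by rewrite mulr_ge0// mulr_ge0 ?sqr_ge0// mulr_ge0 ?expR_ge0.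
  - by rewrite mulr_ge0// mulr_ge0// mulr_ge0// (detail_const_ge0 Q_le).
  - rewrite mulr_ge0// mulr_ge0// ?addr_ge0 ?mulr_ge0 ?expR_ge0//.
    exact: proj_const_ge0 Q_le.
have K10 : 0 <= K1.
  by rewrite mulr_ge0 ?exprn_ge0// addr_ge0// mulr_ge0// ltW.
have K20 : 0 <= K2.
  apply: mulr_ge0; first by rewrite mulr_ge0 ?exprn_ge0 ?expR_ge0.
  by apply: mulr_ge0 => //; apply: mulr_ge0.
exists (K1 + K2); first exact: addr_ge0.
(* Since 4^l1 > l1, any level l0 >= l1 makes Kc 4^-l0 at most eps / 2; the lower bound on n forces
   such a level. *)
pose l1 := (Num.truncn (2 * Kc / eps)).+1.
have l1_large : 2 * Kc / eps <= 4 ^+ l1.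
  have ratio0 : 0 <= 2 * Kc / eps by apply: divr_ge0; [exact: mulr_ge0 | exact: ltW].
  have /andP[_ h] := truncn_itv ratio0.
  apply: le_trans (ltW h) _; rewrite -/l1 -natrX ler_nat.
  by apply: ltnW; exact: ltn_expl.
exists ((4 ^ p) ^ l1)%N => // n /= n1n.
have n0 : (0 < n)%N by rewrite (leq_trans _ n1n)// !expn_gt0.
have p4 : (1 < 4 ^ p)%N by rewrite -[1%N](expn0 4) ltn_exp2l// /p addnC.
pose l0 := trunc_log (4 ^ p) n.
have /andP[nlow nhigh] := trunc_log_bounds p4 n0.
rewrite -/l0 in nlow nhigh.
have l01 : (l1 <= l0)%N by exact: trunc_log_max.
pose m := ((2 * k + 1) * l0)%N; pose L := (l0 + m)%N.
have Ln : (4 ^ L <= n)%N by exact: cells_le_sample nlow.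
have h0 : 0 < 4 ^- L :> R by rewrite invr_gt0 exprn_gt0.
pose s : R := Num.sqrt n%:R.
have s0 : 0 < s by rewrite sqrtr_gt0 ltr0n.
have s2 : s ^+ 2 = n%:R by rewrite sqr_sqrtr.
pose Y i : T -> measurableTypeR R := X i.
have mY i : measurable_fun setT (Y i).
  exact: (@measurable_funPT _ _ _ _ (X i)).
have YS (j : nat) (A : nat -> set (measurableTypeR R)) : (forall i, measurable (A i)) ->
    P (\bigcap_(i in `I_j) (Y i @^-1` A i)) = (\prod_(i < j) S (A i))%E.
  exact: (@iid_rectangle _ _ _ _ _ _ X_iid j A).
pose noise w := coefficient_noise k Q S n (Y^~ w) l0 m.
pose cnoise := cell_noise Y S n L p.
have noiseE : mean_le P noise (Kn * (4 ^+ l0 / n%:R)).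
  exact: (coefficient_noise_expectation mY YS S01 SC Q_orth Q_le n0 Ln C0).
have cellE : mean_le P cnoise (4 ^+ L * moment_const C p 1).
  exact: (cell_noise_expectation mY YS S01 SC n0 p Ln C0).
(* The allowed deviation [low / 2 * 4 ^- L] of one cell, after scaling by s 2^L and raising to the
   power 2p. *)
pose a2 := (low / 2 * (s * 2 ^- L)) ^+ (2 * p).
have a20 : 0 < a2 by rewrite exprn_gt0// mulr_gt0 ?divr_gt0// mulr_gt0// ?invr_gt0 ?exprn_gt0.
pose G := \bigcap_(i in `I_n) (X i @^-1` `[0%R, 1%R[%classic).
have mG : measurable G.
  apply: bigcap_measurableType => i _.
  by rewrite -[X in measurable X]setTI; exact: (mY i).
have mE1 : measurable [set w | a * 4 ^- L < noise w].
  by apply: measurable_gt_set; case: noiseE.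
have mE2 : measurable [set w | a2 < cnoise w].
  by apply: measurable_gt_set; case: cellE.
exists (~` G `|` [set w | a * 4 ^- L < noise w] `|` [set w | a2 < cnoise w]); split.
- by apply: measurableU => //; apply: measurableU => //; exact: measurableC.
- have PG : P (~` G) = 0%E by rewrite probability_setC// sample_in_unit subee//.
  have P1 : (P [set w | (a * 4 ^- L < noise w)%R] <= (eps / 2)%:E)%E.
    have aL : 0 < a * 4 ^- L by rewrite mulr_gt0.
    apply: le_trans (markov_le aL noiseE) _; rewrite lee_fin ler_pdivrMr//.
    apply: (@le_trans _ _ (Kn * 4 ^- L)).
      by rewrite ler_wpM2l// (coefficient_scale_le nlow).
    rewrite /a [leRHS](_ : _ = (Kn + 1) * 4 ^- L); last first.
      set t := 4 ^- L; field; by rewrite gt_eqF.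
    by rewrite ler_wpM2r ?(ltW h0)// lerDl.
  have P2 : (P [set w | (a2 < cnoise w)%R] <= (eps / 2)%:E)%E.
    apply: le_trans (markov_le a20 cellE) _; rewrite lee_fin ler_pdivrMr//.
    have a2E : a2 = (low / 2) ^+ (2 * p) * (n%:R * 4 ^- L) ^+ p.
      rewrite /a2 exprMn; congr (_ * _); rewrite exprM; congr (_ ^+ _).
      by rewrite exprMn s2 exprVn expr2 two_four.
    have nL : 4 ^+ l0 <= n%:R * 4 ^- L :> R.
      rewrite ler_pdivlMr ?exprn_gt0// -exprD addnC -(level_exponent k l0).
      by rewrite -natrX ler_nat expnM.
    have nLp : 4 ^+ L * 4 ^+ l0 <= (n%:R * 4 ^- L) ^+ p :> R.
      by rewrite -exprD -(level_exponent k l0) mulnC exprM lerXn2r ?nnegrE ?exprn_ge0//.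
    have lp : 0 < (low / 2) ^+ (2 * p) by rewrite exprn_gt0// divr_gt0.
    rewrite a2E; set D := (low / 2) ^+ (2 * p) in lp *.
    have -> : 4 ^+ L * moment_const C p 1 = D * (4 ^+ L * Kc).
      by rewrite /Kc -/D; field; rewrite gt_eqF.
    have : 4 ^+ L * Kc <= eps / 2 * (4 ^+ L * 4 ^+ l0).
      rewrite [leRHS]mulrCA ler_wpM2l ?exprn_ge0//.
      have : 2 * Kc / eps <= 4 ^+ l0.
        by rewrite (le_trans l1_large)// ler_weXn2l// ler1n.
      rewrite ler_pdivrMr// => h.
      rewrite [leRHS](_ : _ = (4 ^+ l0 * eps) / 2); last by rewrite mulrC mulrA.
      by rewrite ler_pdivlMr// mulrC.
    move=> h; have {}h := le_trans h (ler_wpM2l (ltW (divr_gt0 eps0 (ltr0n _ 2))) nLp).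
    by have := ler_wpM2l (ltW lp) h; rewrite [X in _ <= X -> _]mulrCA.
  have mC : measurable (~` G) by exact: measurableC.
  have hU := measureU2 P (measurableU _ _ mC mE1) mE2.
  apply: (le_trans hU).
  have -> : (eps%:E = (eps / 2)%:E + (eps / 2)%:E)%E by rewrite -EFinD -splitr.
  apply: leeD => //; apply: le_trans P1.
  have hV := measureU2 P mC mE1.
  by apply: (le_trans hV); rewrite [X in (X + _)%E]PG add0e.
move=> w; rewrite !not_orP => -[[/contrapT Gw /negP noise_le] /negP cnoise_le].
rewrite -leNgt in noise_le; rewrite -leNgt in cnoise_le.
have x01 i : (i < n)%N -> 0 <= Y i w < 1.
  by move=> /Gw; rewrite /= in_itv.
have cells j : (j < 4 ^ L)%N ->
    `|emp_dev S n (Y^~ w) (\1_(cell L j))| <= low / 2 * 4 ^- L.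
  move=> jL; have bi := bounded_mfun_indic (@measurable_cell R L j).
  set e1 := emp_dev _ _ _ _.
  have e1E : emp_dev S n (Y^~ w) (scaled_cell L j) = 2 ^+ L * e1.
    rewrite /e1 /emp_dev /scaled_cell IntZ//; last exact: (unit_interval_prob_fin S01).
    by rewrite -mulr_sumr; ring.
  (* One nonnegative summand of [cell_noise] is at most the sum, so the bound holds for all cells
     simultaneously. *)
  have : (s * (2 ^+ L * e1)) ^+ (2 * p) <= a2.
    rewrite -e1E; apply: le_trans cnoise_le.
    rewrite /cnoise /cell_noise (bigD1 (Ordinal jL))//= lerDl.
    by apply: sumr_ge0 => i _; rewrite exprM exprn_ge0// sqr_ge0.
  have -> : (s * (2 ^+ L * e1)) ^+ (2 * p) = `|s * (2 ^+ L * e1)| ^+ (2 * p).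
    by rewrite !exprM real_normK ?num_real.
  rewrite /a2 ler_pXn2r ?nnegrE//; last 2 first.
  - by rewrite muln_gt0 /p addnC.
  - by apply: ltW; rewrite mulr_gt0 ?divr_gt0 ?exprn_gt0.
  have c0 : 0 < 2 ^+ L :> R by rewrite exprn_gt0.
  rewrite !normrM (gtr0_norm s0) (gtr0_norm c0) [X in _ <= X -> _]mulrCA.
  rewrite ler_pM2l// -ler_pdivlMl//.
  move=> /le_trans; apply; rewrite -two_four invfM.
  by rewrite le_eqVlt; apply/orP; left; apply/eqP; ring.
pose y := Y^~ w.
have hmle : is_hal_mle k (fun i : 'I_n => y i) M (fn n w) := mle w n0.
have scale : (2 ^- l0 * (4 ^- l0) ^+ k) / Num.sqrt n%:R <= 4 ^- L :> R := bias_scale_le nlow.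
have bfn : bounded_mfun (fn n w) := @bounded_hal_mle R k M n y (fn n w) hmle.
have fnb : forall u, 0 <= u < 1 -> `|fn n w u| <= b.
  exact: (@normr_hal_mle_le _ _ _ _ Mb n y x01 (fn n w) hmle).
have bound := @kl_hal_mle_le R S S01 k f W M b bf f_int fW fM S_dens f0b M0 Mb Q B size_Q Q_orth Q_repr Q_le n y l0 m n0 x01 cells (fn n w) hmle scale.
rewrite f0E in bound.
have rate_n : 4 ^- L <= 4 ^+ (2 * k + 2) * rate n := rate_scale_le nlow nhigh.
have klK1 : kl S f0 (fn n w) <= K1 * rate n.
  apply: (le_trans bound).
  apply: (@le_trans _ _ ((noise_const b * a + rate_const k W M b B) * 4 ^- L)).
    by rewrite [leRHS]mulrDl lerD2r -[leRHS]mulrA ler_wpM2l.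
  have A0 : 0 <= noise_const b * a + rate_const k W M b B.
    by rewrite addr_ge0// mulr_ge0// ltW.
  by rewrite /K1 -[leRHS]mulrA; exact: (ler_wpM2l A0 rate_n).
have r0 : 0 <= rate n by exact: powR_ge0.
split => //; split => //.
  by rewrite (le_trans klK1)// ler_wpM2r// lerDl.
apply: (@le_trans _ _ (K2 * rate n)); last by rewrite ler_wpM2r// lerDr.
have f0bb x : 0 <= x < 1 -> `|f0 x| <= b by rewrite -f0E; exact: f0b.
rewrite f0E in S_dens.
apply: le_trans (link_sqr_dist_le S01 bf0 S_dens f0bb bfn fnb) _.
have c1 : 0 <= expR (2 * b) * expR (4 * b + 2) ^+ 2.
  by rewrite mulr_ge0 ?exprn_ge0 ?expR_ge0.
have c2 : 0 <= 2 * (4 * b + 2) by rewrite mulr_ge0.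
rewrite [leRHS](_ : _ =
  expR (2 * b) * expR (4 * b + 2) ^+ 2 * (2 * (4 * b + 2) * (K1 * rate n))).
  exact: (ler_wpM2l c1 (ler_wpM2l c2 klK1)).
by rewrite /K2 !mulrA.
Qed.

Lemma outer_measure_le (A E : set T) : measurable E -> A `<=` E -> (P^*%mu A <= P E)%E.
Proof.
by move=> mE AE; rewrite -(measurable_mu_extE P mE); exact: le_mu_ext.
Qed.

Lemma hal_mle_d0_rate : OP_rate P (fun n w => (d0 P0 (fn n w) f0)%:E) (fun n => rate n).
Proof.
move=> eps eps0; have [K K0 near_E] := hal_mle_kl_rate eps0; exists K.
apply: filterS near_E => n [E [mE PE hE]].
apply: le_trans (outer_measure_le mE _) PE => w /=; apply: contraPP => /hE[n0 [bfn kl_le _]].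
apply/negP; rewrite -leNgt (d0_kl bf0 P0_density bfn) lee_fin ger0_norm//.
exact: (kl_ge0 (borel_law_unit P0_density) bf0 (borel_law_density bf0 P0_density) bfn).
Qed.

Lemma hal_mle_L2_rate : OP_rate P (fun n w => L2dist (link (fn n w)) (link f0))
  (fun n => n%:R `^ (- ((k + 1)%:R / (2 * k + 3)%:R))).
Proof.
move=> eps eps0; have [K K0 near_E] := hal_mle_kl_rate eps0; exists (Num.sqrt K).
apply: filterS near_E => n [E [mE PE hE]].
apply: le_trans (outer_measure_le mE _) PE => w /=; apply: contraPP => /hE[n0 [bfn _ L2_le]].
apply/negP; rewrite -leNgt (L2dist_link bf0 bfn) lee_fin ger0_norm ?sqrtr_ge0//.
have -> : n%:R `^ (- ((k + 1)%:R / (2 * k + 3)%:R)) = Num.sqrt (rate n) :> R.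
  rewrite -powR12_sqrt ?powR_ge0// -powRrM; congr (_ `^ _).
  have k3 : 2 * k%:R + 3 != 0 :> R by rewrite gt_eqF// ltr_wpDl// mulr_ge0.
  by rewrite (natrD _ k) !(natrD _ (2 * k)%N) !natrM; field.
by rewrite -sqrtrM// ler_wsqrtr.
Qed.

End main.

Theorem theorem4p1 (R : realType) (d : measure_display) (T : measurableType d)
  (P : probability T R) (X : nat -> {RV P >-> R}) (P0 : probability R R)
  (k : nat) (U M : R) (f0 : R -> R) (fn : nat -> T -> R -> R) :
  0 < U ->
  iid X P0 ->
  argmin (D k U) (risk P0) f0 ->
  has_density P0 (link f0) ->
  D k M f0 ->
  (forall n w, (0 < n)%N -> is_hal_mle k (fun i : 'I_n => X i w) M (fn n w)) ->
  OP_rate P (fun n w => (d0 P0 (fn n w) f0)%:E)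
    (fun n => n%:R `^ (- ((2 * k + 2)%:R / (2 * k + 3)%:R))) /\
  OP_rate P (fun n w => L2dist (link (fn n w)) (link f0))
    (fun n => n%:R `^ (- ((k + 1)%:R / (2 * k + 3)%:R))).
Proof.
move=> _ X_iid _ P0_density f0_class mle; split.
  exact: hal_mle_d0_rate X_iid P0_density f0_class mle.
exact: hal_mle_L2_rate X_iid P0_density f0_class mle.
Qed.
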